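(* Assume that $\mathbf{u}_0\in\mathcal{V}$ lies strictly inside the strength domain, i.e. there is a closed interval $I\subset(r^e,r^c)$ such that $\sqrt{|\mathbf{y}-\mathbf{x}|}\,S(\mathbf{y},\mathbf{x},\mathbf{u}_0)\in I$ for all $\mathbf{x}\in\Omega$ and $\mathbf{y}\in\Omega\cap H_\epsilon(\mathbf{x})$, and that $\Omega$ satisfies the interior cone condition. Then $\mathrm{Ker}\{D(\mathcal{L})[\mathbf{u}_0]\}=\{\mathbf{0}\}$ and there is a $\gamma>0$ for which $\mathbb{A}[\mathbf{u}_0]-\gamma\mathbb{I}>0$; consequently $D(\mathcal{L})[\mathbf{u}_0]^{-1}$ is well defined on $\mathcal{V}$ and $|||D(\mathcal{L})[\mathbf{u}_0]^{-1}|||<\infty$.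
   Context: Let $d\in\{2,3\}$ and let $\Omega\subset\mathbb{R}^d$ be a bounded domain (connected open set). Interior cone condition: there are $\lambda>0$, $\theta>0$ such that every $\mathbf{x}\in\Omega$ is the apex of a spherical cone contained in $\Omega$ of radius $\lambda$ and aperture angle $2\theta$ (with axis along some unit vector $\mathbf{e}_{\mathbf{x}}$). Fix $\epsilon>0$ and let $H_\epsilon(\mathbf{x})$ be the ball of radius $\epsilon$ centered at $\mathbf{x}$; $\omega_d$ is the volume of the unit ball of $\mathbb{R}^d$; $\mathbf{e}_{\mathbf{y}-\mathbf{x}}=(\mathbf{y}-\mathbf{x})/|\mathbf{y}-\mathbf{x}|$. $J$ is a non-negative bounded measurable function supported on $[0,1]$, positive on $[0,1)$, and $J^\epsilon(r)=J(r/\epsilon)$. The function $g:\mathbb{R}\to\mathbb{R}$ is three times continuously differentiable, $g,g',g'',g'''$ are bounded, $g(0)=0$, $g(r)>0$ for $r\ne0$, $g$ is convex on $(r^e,r^c)$ with $r^e<0<r^c$ and concave outside this interval, $g''>0$ on $(r^e,r^c)$, $g$ has finite limits at $\pm\infty$, and $\max_r|g''(r)|=g''(0)$. The strain is $S(\mathbf{y},\mathbf{x},\mathbf{u})=\frac{\mathbf{u}(\mathbf{y})-\mathbf{u}(\mathbf{x})}{|\mathbf{y}-\mathbf{x}|}\cdot\mathbf{e}_{\mathbf{y}-\mathbf{x}}$. Let $\Pi=\{\mathbf{Q}\mathbf{x}+\mathbf{c}:\mathbf{Q}^T=-\mathbf{Q}\in\mathbb{R}^{d\times d},\ \mathbf{c}\in\mathbb{R}^d\}$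 and $\mathcal{V}=\{\mathbf{u}\in L^\infty(\Omega;\mathbb{R}^d):\int_\Omega\mathbf{u}\cdot\mathbf{w}\,d\mathbf{x}=0\ \text{for all }\mathbf{w}\in\Pi\}$ with the norm $\|\cdot\|_\infty$. For $\mathbf{u}\in\mathcal{V}$ the linear operator $D(\mathcal{L})[\mathbf{u}]:\mathcal{V}\to\mathcal{V}$ is $$D(\mathcal{L})[\mathbf{u}]\mathbf{w}(\mathbf{x})=-\int_{H_\epsilon(\mathbf{x})\cap\Omega}\frac{J^\epsilon(|\mathbf{y}-\mathbf{x}|)}{\epsilon^{d+1}\omega_d}\,g''\!\left(\sqrt{|\mathbf{y}-\mathbf{x}|}\,S(\mathbf{y},\mathbf{x},\mathbf{u})\right)S(\mathbf{y},\mathbf{x},\mathbf{w})\,\mathbf{e}_{\mathbf{y}-\mathbf{x}}\,d\mathbf{y},$$ and the stability tensor is $$\mathbb{A}[\mathbf{u}](\mathbf{x})=\int_{H_\epsilon(\mathbf{x})\cap\Omega}\frac{J^\epsilon(|\mathbf{y}-\mathbf{x}|)}{\epsilon^{d+1}\omega_d|\mathbf{y}-\mathbf{x}|}\,g''\!\left(\sqrt{|\mathbf{y}-\mathbf{x}|}\,S(\mathbf{y},\mathbf{x},\mathbf{u})\right)\mathbf{e}_{\mathbf{y}-\mathbf{x}}\otimes\mathbf{e}_{\mathbf{y}-\mathbf{x}}\,d\mathbf{y}.$$ $\mathbb{A}[\mathbf{u}]-\gamma\mathbb{I}>0$ means $\mathbb{A}[\mathbf{u}](\mathbf{x})\mathbf{v}\cdot\mathbf{v}-\gamma|\mathbf{v}|^2>0$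 for all $\mathbf{x}\in\Omega$ and all nonzero $\mathbf{v}\in\mathbb{R}^d$. $|||D(\mathcal{L})[\mathbf{u}]^{-1}|||=\sup_{\mathbf{0}\ne\Delta\mathbf{u}\in\mathcal{V}}\|D(\mathcal{L})[\mathbf{u}]^{-1}\Delta\mathbf{u}\|_\infty/\|\Delta\mathbf{u}\|_\infty$. *)

(* Defs.v *)
From HB Require Import structures.
From mathcomp Require Import all_boot all_order all_algebra.
From mathcomp Require Import all_classical all_reals all_analysis.

Set Implicit Arguments.
Unset Strict Implicit.
Unset Printing Implicit Defensive.

Import Order.TTheory GRing.Theory Num.Theory.
Import numFieldNormedType.Exports.

Local Open Scope classical_set_scope.
Local Open Scope ring_scope.

(* R^n is 'cV[R]_n.  The library gives it the topology and the (sup) norm of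
   its entries; its sigma-algebra is the one generated by the coordinates,
   that is, the Borel sigma-algebra. *)
Section measurable_cV.
Context {R : realType} (n : nat).

Definition cV_measurable : set (set 'cV[R]_n) :=
  <<s \bigcup_(i in [set: 'I_n])
        preimage_set_system setT (fun x : 'cV[R]_n => x i 0) measurable >>.

Let cV_measurable0 : cV_measurable set0.
Proof. exact: sigma_algebra0. Qed.

Let cV_measurableC A : cV_measurable A -> cV_measurable (~` A).
Proof. exact: sigma_algebraC. Qed.

Let cV_measurable_bigcup (F : (set 'cV[R]_n)^nat) :
  (forall i, cV_measurable (F i)) -> cV_measurable (\bigcup_i F i).
Proof. exact: sigma_algebra_bigcup. Qed.

Definition cV_display : measure_display -> measure_display.
Proof. exact. Qed.

HB.instance Definition _ := @isMeasurable.Build (cV_display default_measure_display)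
  'cV[R]_n cV_measurable cV_measurable0 cV_measurableC cV_measurable_bigcup.

Lemma measurable_coord (i : 'I_n) :
  measurable_fun [set: 'cV[R]_n] (fun x : 'cV[R]_n => x i 0).
Proof.
move=> _ Y mY; rewrite setTI; apply: sub_sigma_algebra.
by exists i => //; exists Y => //; rewrite setTI.
Qed.

Lemma measurable_fun_coordP d (T : measurableType d) (D : set T)
    (f : T -> 'cV[R]_n) : measurable D ->
  (forall i, measurable_fun D (fun t => f t i 0)) -> measurable_fun D f.
Proof.
move=> mD mf.
apply: (@measurability _ _ _ _ D f (\bigcup_(i in [set: 'I_n])
        preimage_set_system setT (fun x : 'cV[R]_n => x i 0) measurable)) => //.
move=> _ [_ [i _ [B mB <-]] <-]; rewrite setTI.
exact: mf.
Qed.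

End measurable_cV.

Section lebesgue_succ.
Context {R : realType} (n : nat).
Variable mu : {sigma_finite_measure set 'cV[R]_n -> \bar R}.

Definition cV_cons (p : R * 'cV[R]_n) : 'cV[R]_n.+1 := col_mx (p.1)%:M p.2.

Lemma measurable_cV_cons : measurable_fun setT cV_cons.
Proof.
apply: measurable_fun_coordP => // i; rewrite /cV_cons.
have [j ->|j ->] := split_ordP (i : 'I_(1 + n)).
  rewrite (_ : (fun _ => _) = fst); first exact: measurable_fst.
  apply/funext => p; apply: etrans (col_mxEu _ _ _ _) _.
  by rewrite ord1 mxE eqxx mulr1n.
rewrite (_ : (fun _ => _) = (fun x : 'cV[R]_n => x j 0) \o snd).
  exact: (measurableT_comp (measurable_coord j) measurable_snd).
by apply/funext => p; exact: col_mxEd.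
Qed.

Definition lebesgue_succ : set 'cV[R]_n.+1 -> \bar R :=
  pushforward (@lebesgue_measure R \x mu)%E cV_cons.

Let preimage_cons (A : set 'cV[R]_n.+1) : measurable A ->
  measurable (cV_cons @^-1` A).
Proof. by move=> mA; rewrite -[X in measurable X]setTI; exact: measurable_cV_cons. Qed.

Let lebesgue_succ0 : lebesgue_succ set0 = 0%E.
Proof. by rewrite /lebesgue_succ /pushforward preimage_set0 measure0. Qed.

Let lebesgue_succ_ge0 A : (0 <= lebesgue_succ A)%E.
Proof. by rewrite /lebesgue_succ /pushforward. Qed.

Let lebesgue_succ_sigma_additive : semi_sigma_additive lebesgue_succ.
Proof.
move=> F mF tF mUF; rewrite /lebesgue_succ /pushforward preimage_bigcup.
apply: measure_semi_sigma_additive.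
- by move=> k; exact: preimage_cons.
- apply/trivIsetP => i j _ _ ij; rewrite -preimage_setI.
  by move/trivIsetP : tF => /(_ _ _ I I ij) ->; rewrite preimage_set0.
- by rewrite -preimage_bigcup; exact: preimage_cons.
Qed.

HB.instance Definition _ := isMeasure.Build _ _ _ lebesgue_succ
  lebesgue_succ0 lebesgue_succ_ge0 lebesgue_succ_sigma_additive.

Let cV_uncons (x : 'cV[R]_n.+1) : R * 'cV[R]_n :=
  (x ord0 0, @dsubmx R 1 n 1 x).

Let cV_consK : cancel cV_cons cV_uncons.
Proof.
move=> [a v]; congr pair; last exact: (@col_mxKd R 1 n 1 a%:M v).
have e0 : ord0 = lshift n ord0 :> 'I_(1 + n) by exact: val_inj.
apply: etrans (congr1 (fun i => cV_cons (a, v) i 0) e0) _.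
by apply: etrans (col_mxEu _ _ _ _) _; rewrite mxE eqxx mulr1n.
Qed.

Let measurable_cV_uncons : measurable_fun setT cV_uncons.
Proof.
apply: measurable_fun_pair; first exact: measurable_coord.
apply: measurable_fun_coordP => // i.
rewrite (_ : (fun _ => _) = (fun x : 'cV[R]_n.+1 => x (rshift 1 i) 0)).
  exact: measurable_coord.
by apply/funext => x; rewrite mxE.
Qed.

Let lebesgue_succ_sigma_finite : sigma_finite setT lebesgue_succ.
Proof.
have /sigma_finiteP[F [FT ndF Foo]] := sigma_finiteT (@lebesgue_measure R).
have /sigma_finiteP[G [GT ndG Goo]] := sigma_finiteT mu.
exists (fun k => cV_uncons @^-1` (F k `*` G k)).
  rewrite -preimage_bigcup (_ : \bigcup_k _ = setT) ?preimage_setT//.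
  rewrite -setXTT FT GT predeqE => -[x y]; split.
    by move=> [k _ []/= ? ?]; split; exists k.
  move=> [/= [k _ Fkx] [l _ Gly]]; exists (maxn k l) => //; split.
    by move: x Fkx; exact/subsetPset/ndF/leq_maxl.
  by move: y Gly; exact/subsetPset/ndG/leq_maxr.
move=> k; have [mF Fk] := Foo k; have [mG Gk] := Goo k; split.
  rewrite -[X in measurable X]setTI; apply: measurable_cV_uncons => //.
  exact: measurableX.
rewrite /lebesgue_succ /pushforward -comp_preimage.
rewrite (_ : cV_uncons \o cV_cons = id); last first.
  by apply/funext => p; exact: cV_consK.
by rewrite [ltLHS]product_measure1E// lte_mul_pinfty// ge0_fin_numE.
Qed.

HB.instance Definition _ := Measure_isSigmaFinite.Build _ _ _
  lebesgue_succ lebesgue_succ_sigma_finite.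
End lebesgue_succ.

(* Lebesgue measure on R^n, as the n-fold product of lebesgue_measure. *)
Fixpoint lebesgue_cV (R : realType) (n : nat) :
    {sigma_finite_measure set 'cV[R]_n -> \bar R} :=
  match n with
  | 0 => \d_(0 : 'cV[R]_0)
  | n'.+1 => lebesgue_succ (lebesgue_cV R n')
  end.

Section euclidean.
Context {R : realType} {d : nat}.
Implicit Types (x y e : 'cV[R]_d) (A Omega : set 'cV[R]_d).

Definition dot x y : R := \sum_(i < d) x i 0 * y i 0.

(* Euclidean norm; the library's `|x| on matrices is the sup norm. *)
Definition enorm x : R := Num.sqrt (dot x x).

Definition eball x (r : R) : set 'cV[R]_d := [set y | enorm (y - x) < r].

Definition omega : R := fine (lebesgue_cV R d (eball 0 1)).

(* Unit vector pointing from x to y; it is 0 when y = x. *)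
Definition dir y x : 'cV[R]_d := (enorm (y - x))^-1 *: (y - x).

(* The angle at the apex x between y - x and the axis e is less than theta. *)
Definition spherical_cone x e (lambda theta : R) : set 'cV[R]_d :=
  [set y | enorm (y - x) < lambda /\ acos (dot (dir y x) e) < theta].

Definition interior_cone_condition Omega : Prop :=
  exists lambda theta : R, [/\ 0 < lambda, 0 < theta &
    forall x, Omega x -> exists e, enorm e = 1 /\
      spherical_cone x e lambda theta `<=` Omega].

Definition mxintegral {m n : nat} A (F : 'cV[R]_d -> 'M[R]_(m, n)) : 'M[R]_(m, n) :=
  \matrix_(i, j) \int[lebesgue_cV R d]_(y in A) F y i j.

End euclidean.

Arguments omega R d : clear implicits.

Record influence_function (R : realType) (J : R -> R) : Prop := {
  influence_measurable : measurable_fun setT J;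
  influence_bounded : bounded_fun J;
  influence_ge0 : forall r, 0 <= J r;
  influence_support : forall r, J r != 0 -> 0 <= r <= 1;
  influence_gt0 : forall r, 0 <= r -> r < 1 -> 0 < J r }.

(* g is convex on ]re, rc[ and concave on each of the two half-lines outside. *)
Record potential_function (R : realType) (g : R -> R) (re rc : R) : Prop := {
  potential_re : re < 0;
  potential_rc : 0 < rc;
  potential_derivable : forall k x, (k < 3)%N -> derivable (derive1n k g) x 1;
  potential_C3 : continuous (derive1n 3 g);
  potential_bounded : forall k, (k <= 3)%N -> bounded_fun (derive1n k g);
  potential_at0 : g 0 = 0;
  potential_gt0 : forall r, r != 0 -> 0 < g r;
  potential_convex : convex_function (`]re, rc[%classic : set R) g;
  potential_concavel : convex_function (`]-oo, re]%classic : set R) (\- g);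
  potential_concaver : convex_function (`[rc, +oo[%classic : set R) (\- g);
  potential_d2_gt0 : forall r, re < r -> r < rc -> 0 < derive1n 2 g r;
  potential_cvgy : cvg (g r @[r --> +oo]);
  potential_cvgNy : cvg (g r @[r --> -oo]);
  potential_d2_max : forall r, `|derive1n 2 g r| <= derive1n 2 g 0 }.

(* Elements of L^oo(Omega; R^d) are represented by functions on R^d, of which
   only the values on Omega matter, and are identified when they agree almost
   everywhere on Omega. *)
Section spaces.
Context {R : realType} {d : nat}.
Variable Omega : set 'cV[R]_d.
Implicit Types u v w f : 'cV[R]_d -> 'cV[R]_d.

Definition aeeq u v : Prop := u = v %[ae (lebesgue_cV R d) in Omega].

Definition linf_norm u : \bar R :=
  Lnorm (lebesgue_cV R d) +oo%E ((fun x => (enorm (u x))%:E) \_ Omega).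

Definition Linfty : set ('cV[R]_d -> 'cV[R]_d) :=
  [set u | measurable_fun Omega u /\ (linf_norm u < +oo)%E].

Definition rigid_motions : set ('cV[R]_d -> 'cV[R]_d) :=
  [set w | exists (Q : 'M[R]_d) (c : 'cV[R]_d),
     Q^T = - Q /\ w = (fun x => Q *m x + c)].

Definition V : set ('cV[R]_d -> 'cV[R]_d) :=
  [set u | Linfty u /\ forall w, rigid_motions w ->
     \int[lebesgue_cV R d]_(x in Omega) dot (u x) (w x) = 0].

Definition Ker (L : ('cV[R]_d -> 'cV[R]_d) -> 'cV[R]_d -> 'cV[R]_d) :
    set ('cV[R]_d -> 'cV[R]_d) :=
  [set w | V w /\ aeeq (L w) (fun=> 0)].

(* T is the two-sided inverse of L : V -> V, everything being taken modulo
   equality almost everywhere. *)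
Record inverse_on_V (L T : ('cV[R]_d -> 'cV[R]_d) -> 'cV[R]_d -> 'cV[R]_d) :
    Prop := {
  inverse_L_V : forall w, V w -> V (L w);
  inverse_T_V : forall f, V f -> V (T f);
  inverse_L_ae : forall w w', V w -> V w' -> aeeq w w' -> aeeq (L w) (L w');
  inverse_T_ae : forall f f', V f -> V f' -> aeeq f f' -> aeeq (T f) (T f');
  inverse_LT : forall f, V f -> aeeq (L (T f)) f;
  inverse_TL : forall w, V w -> aeeq (T (L w)) w }.

Definition opnorm (T : ('cV[R]_d -> 'cV[R]_d) -> 'cV[R]_d -> 'cV[R]_d) : \bar R :=
  ereal_sup [set (linf_norm (T f) / linf_norm f)%E |
             f in [set f | V f /\ ~ aeeq f (fun=> 0)]].

End spaces.

Section peridynamics.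
Context {R : realType} {d : nat}.
Variables (Omega : set 'cV[R]_d) (eps : R) (J g : R -> R).
Implicit Types (x y : 'cV[R]_d) (u w : 'cV[R]_d -> 'cV[R]_d).

Definition strain y x u : R :=
  dot ((enorm (y - x))^-1 *: (u y - u x)) (dir y x).

Definition DL u w x : 'cV[R]_d :=
  - mxintegral (eball x eps `&` Omega) (fun y =>
      (J (enorm (y - x) / eps) / (eps ^+ d.+1 * omega R d) *
       derive1n 2 g (Num.sqrt (enorm (y - x)) * strain y x u) *
       strain y x w) *: dir y x).

Definition stability_tensor u x : 'M[R]_d :=
  mxintegral (eball x eps `&` Omega) (fun y =>
      (J (enorm (y - x) / eps) / (eps ^+ d.+1 * omega R d * enorm (y - x)) *
       derive1n 2 g (Num.sqrt (enorm (y - x)) * strain y x u)) *: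
      (dir y x *m (dir y x)^T)).

(* The strain is undefined for y = x, hence the side condition y != x. *)
Definition strictly_inside_strength_domain (re rc : R) u : Prop :=
  exists a b : R, [/\ re < a, a <= b, b < rc &
    forall x y, Omega x -> Omega y -> eball x eps y -> y != x ->
      a <= Num.sqrt (enorm (y - x)) * strain y x u <= b].

End peridynamics.

(* Main.v *)
From HB Require Import structures.
Require Import Defs.
From mathcomp Require Import all_boot all_order all_algebra.
From mathcomp Require Import ring lra.
From mathcomp Require Import all_classical all_reals all_analysis.
From mathcomp Require Import measurable_realfun ess_sup_inf.

Set Implicit Arguments.
Unset Strict Implicit.
Unset Printing Implicit Defensive.

Import Order.TTheory GRing.Theory Num.Theory.
Import numFieldNormedType.Exports.

Local Open Scope classical_set_scope.
Local Open Scope ring_scope.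

(** The operator DL is the linear elasticity of a network of springs.  The spring
between x and y has a stiffness c(x, y), proportional to J times the value of g''
at the stretch of u0.  It is symmetric and bounded, and it is positive because the
stretch stays in a compact part of the interval on which g'' > 0.  With e the
direction of y - x and k(x, y) = c(x, y) / |y - x| e e^T,

  DL w x = A x w x - (K w) x,  A x = int k(x, y) dy,  (K w) x = int k(x, y) w y dy,

and A is the stability tensor.

Coercivity of A.  The cone condition provides, for every x and every vector v, a
set of points y of measure bounded below, all in Omega, on which J is bounded
below and y - x makes a definite angle with the hyperplane orthogonal to v
[uniform_mass].  Only those y are kept in the integral of (A x v) . v.

Injectivity.  Action and reaction give the energy identity

  2 int DL w . w = int int c(x, y) / |y - x| (e . (w x - w y))^2 dx dy

[elastic_energy].  A field of zero energy has almost everywhere no strain between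
points at distance less than eps.  On a connected open set such a field is a
rigid motion [strain_free_rigid], and it vanishes if it is also orthogonal to the
rigid motions.

Surjectivity.  The kernel is dominated by 1 / |y - x|, which is integrable for
d >= 2, and A - K is handled by a Fredholm alternative in the space of bounded
measurable fields [coercive_fredholm].  As c is merely measurable, it is the square
of T = A^-1 K, rather than T, that finite rank operators approximate in the
sup norm: the composition of two bounded kernels is controlled by the L^1 norm of
the inner one [mop_bounded_approx], and separable kernels are dense in L^1
[separable_limit_bounded].  The equation (1 - T) w = f is therefore reduced to
(1 - T^3) w = f.  This loses no injectivity, since T is symmetric for the inner
product defined by A, which makes 1 + T + T^2 positive.

The rigid motions are both the kernel of A - K and the orthogonal complement of its
range.  Adding the operator sum_l phi_l (phi_l . w), where the phi_l span them, makes
the sum injective, and for data orthogonal to the rigid motions the added term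
vanishes at the solution [elastic_solve].  The estimate that comes with the
alternative bounds the inverse. *)

(** * Lebesgue measure on R^n: cubes, translations, open sets *)

Section cubes.
Context {R : realType}.

Lemma cV_consE0 n (t : R) (y : 'cV[R]_n) : cV_cons (t, y) ord0 0 = t.
Proof.
have -> : ord0 = lshift n ord0 :> 'I_(1 + n) by exact: val_inj.
by apply: etrans (col_mxEu _ _ _ _) _; rewrite mxE eqxx mulr1n.
Qed.

Lemma cV_consES n (t : R) (y : 'cV[R]_n) i :
  cV_cons (t, y) (lift ord0 i) 0 = y i 0.
Proof.
have -> : lift ord0 i = rshift 1 i :> 'I_(1 + n) by exact: val_inj.
exact: col_mxEd.
Qed.

Lemma forall_ordS n (P : 'I_n.+1 -> Prop) :
  (forall i, P i) <-> P ord0 /\ forall i, P (lift ord0 i).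
Proof.
split=> [h|[h0 hS] i]; first by split.
by case: (unliftP ord0 i) => [j ->|->].
Qed.

Definition cube {n} (x : 'cV[R]_n) (r : R) : set 'cV[R]_n :=
  [set y | forall i, `|y i 0 - x i 0| < r].

Lemma measurable_cube n (x : 'cV[R]_n) r : measurable (cube x r).
Proof.
rewrite (_ : cube x r = \bigcap_(i in [set: 'I_n])
   ((fun y : 'cV[R]_n => y i 0) @^-1` [set t | `|t - x i 0| < r])); last first.
  by apply/seteqP; split=> y /= h i; [move=> _|]; apply: h.
apply: fin_bigcap_measurable => // i _.
rewrite -[X in measurable X]setTI; apply: measurable_coord => //.
rewrite (_ : [set t | _] = `](x i 0 - r), (x i 0 + r)[%classic).
  exact: measurable_itv.
by apply/seteqP; split=> t /=; rewrite in_itv/= ltr_distl.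
Qed.

Lemma lebesgue_cV_cube n (x : 'cV[R]_n) r : 0 < r ->
  lebesgue_cV R n (cube x r) = ((2 * r) ^+ n)%:E.
Proof.
move=> r0; elim: n x => [|n IH] x.
  by rewrite expr0 /= diracE (_ : _ \in _)// inE => -[].
change (lebesgue_succ (lebesgue_cV R n) (cube x r) = ((2 * r) ^+ n.+1)%:E).
pose x0 : R := x ord0 0; pose x' : 'cV[R]_n := \col_i x (lift ord0 i) 0.
rewrite /lebesgue_succ /pushforward (_ : @cV_cons R n @^-1` _ =
    `](x0 - r), (x0 + r)[%classic `*` cube x' r); last first.
  apply/predeqP => -[t y]; rewrite /= [cube _ _ _]forall_ordS cV_consE0.
  rewrite in_itv/= -ltr_distl; apply: and_iff_compat_l.
  by split=> h i; move: (h i); rewrite cV_consES mxE.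
rewrite product_measure1E//; last exact: measurable_cube.
rewrite exprS EFinM; congr (_ * _)%E; last exact: IH.
apply: etrans (lebesgue_measure_itv _) _; rewrite /= lte_fin ifT; last by lra.
by rewrite -EFinD; congr EFin; lra.
Qed.

Lemma lebesgue_measure_translate (a : R) (A : set (measurableTypeR R)) : measurable A ->
  lebesgue_measure ((fun t => t + a) @^-1` A) = lebesgue_measure A.
Proof.
move=> mA.
have mf : measurable_fun setT
    ((fun t => t + a) : measurableTypeR R -> measurableTypeR R).
  exact: measurable_funD.
pose mf_mixin := isMeasurableFun.Build _ _ _ _ _ mf.
pose f : {mfun measurableTypeR R >-> measurableTypeR R} :=
  HB.pack ((fun t => t + a) : measurableTypeR R -> measurableTypeR R) mf_mixin.
apply/esym; rewrite -[RHS]/(pushforward lebesgue_measure f A).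
apply: lebesgue_measure_unique => //.
move=> _ [[b c]] _ <-.
have pre : f @^-1` [set` `]b, c]] = `](b - a), (c - a)]%classic.
  by apply/seteqP; split=> t /=; rewrite !in_itv/= ltrBlDr lerBrDr.
apply: etrans (lebesgue_measure_itv _) _; apply/esym.
apply: etrans (congr1 _ pre) _.
apply: etrans (lebesgue_measure_itv _) _; rewrite /= !lte_fin ltrD2r.
by case: ifP => // _; rewrite -!EFinD; congr EFin; lra.
Qed.

Lemma measurable_translate n (a : 'cV[R]_n) :
  measurable_fun setT (fun y : 'cV[R]_n => y + a).
Proof.
apply: measurable_fun_coordP => // i.
under eq_fun do rewrite mxE.
by apply: measurable_funD => //; exact: measurable_coord.
Qed.

(** Induction on the dimension: on a product the translated measure agrees with
the product measure on rectangles, hence everywhere. *)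
Lemma lebesgue_cV_translate n (a : 'cV[R]_n) (A : set 'cV[R]_n) : measurable A ->
  lebesgue_cV R n ((fun y => y + a) @^-1` A) = lebesgue_cV R n A.
Proof.
elim: n a A => [|n IH] a A mA.
  congr (lebesgue_cV R 0 _); apply/seteqP; split=> y;
    by rewrite /= (_ : y + a = y)//; apply/matrixP => -[].
change (lebesgue_succ (lebesgue_cV R n) ((fun y => y + a) @^-1` A) =
        lebesgue_succ (lebesgue_cV R n) A).
pose a0 : R := a ord0 0; pose a' : 'cV[R]_n := \col_i a (lift ord0 i) 0.
pose sh (p : measurableTypeR R * 'cV[R]_n) : measurableTypeR R * 'cV[R]_n :=
  (p.1 + a0, p.2 + a').
have msh : measurable_fun setT sh.
  apply: measurable_fun_pair; first exact: measurable_funD.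
  exact: (measurableT_comp (measurable_translate a')).
pose sh_mixin := isMeasurableFun.Build _ _ _ _ _ msh.
pose f : {mfun (measurableTypeR R * 'cV[R]_n)%type >->
  (measurableTypeR R * 'cV[R]_n)%type} := HB.pack sh sh_mixin.
have mcA : measurable (@cV_cons R n @^-1` A).
  by rewrite -[X in measurable X]setTI; exact: measurable_cV_cons.
rewrite /lebesgue_succ /pushforward.
have E p : @cV_cons R n p + a = @cV_cons R n (sh p).
  case: p => t y; apply/colP; apply/forall_ordS.
  split=> [|i]; rewrite mxE; first by rewrite !cV_consE0.
  by rewrite !cV_consES !mxE.
have -> : @cV_cons R n @^-1` ((fun y => y + a) @^-1` A) =
    sh @^-1` (@cV_cons R n @^-1` A).
  by apply/predeqP => p; rewrite /preimage /= E.
apply/esym.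
apply: (product_measure_unique (m' := pushforward
  (@lebesgue_measure R \x lebesgue_cV R n)%E f)) => //= B C mB mC.
rewrite /pushforward (_ : _ @^-1` _ = ((fun t => t + a0) @^-1` B) `*`
   ((fun y => y + a') @^-1` C)); last by apply/seteqP; split=> -[].
rewrite product_measure1E//.
- by congr (_ * _)%E; [exact: lebesgue_measure_translate|exact: IH].
- by rewrite -[X in measurable X]setTI; exact: measurable_funD.
- by rewrite -[X in measurable X]setTI; exact: measurable_translate.
Qed.


Lemma cV_norm_leP n (x : 'cV[R]_n) m : 0 <= m ->
  `|x| <= m <-> forall i, `|x i 0| <= m.
Proof.
move=> m0; rewrite [in X in X <-> _]/Num.norm /= mx_normrE; split=> [h i|h].
  exact: le_trans (le_bigmax _ (fun ij => `|x ij.1 ij.2|) (i, 0)) h.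
by apply: bigmax_le => // -[i j] _ /=; rewrite ord1.
Qed.

Lemma cV_coord_le n (x : 'cV[R]_n) i : `|x i 0| <= `|x|.
Proof. by move: i; apply/(cV_norm_leP x (normr_ge0 x)). Qed.

Lemma cube_ball n (x : 'cV[R]_n) r : 0 < r -> cube x r = ball x r.
Proof.
move=> r0; apply/seteqP; split=> y /=.
  by move=> h; split=> // i j; rewrite ord1 /ball/= distrC.
by move=> [_ h] i; rewrite distrC; apply: h.
Qed.

Lemma open_cube n (x : 'cV[R]_n) r : 0 < r -> open (cube x r).
Proof. by move=> r0; rewrite cube_ball//; exact: ball_open. Qed.

Lemma cube_center n (x : 'cV[R]_n) r : 0 < r -> cube x r x.
Proof. by move=> r0 i; rewrite subrr normr0. Qed.

Lemma open_subset_cube n (U : set 'cV[R]_n) x : open U -> U x ->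
  exists2 r, 0 < r & cube x r `<=` U.
Proof.
move=> oU Ux; have /nbhs_ballP[r /= r0 h] := open_nbhs_nbhs (conj oU Ux).
by exists r => //; rewrite cube_ball.
Qed.

Lemma open_lebesgue_gt0 n (U : set 'cV[R]_n) : open U -> measurable U ->
  U !=set0 -> (0 < lebesgue_cV R n U)%E.
Proof.
move=> oU mU [x Ux]; have [r r0 rU] := open_subset_cube oU Ux.
apply: (@lt_le_trans _ _ (lebesgue_cV R n (cube x r))).
  by rewrite lebesgue_cV_cube// lte_fin exprn_gt0// mulr_gt0.
by apply: le_measure; rewrite ?inE//; exact: measurable_cube.
Qed.

(** The rational cubes are countably many and form a basis of the topology, so
that local measurability and local negligibility are global. *)
Definition rat_cube n (k : nat) : set 'cV[R]_n :=
  if unpickle k is Some (q, r) then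
    cube (map_mx ratr (q : 'cV[rat]_n)) (ratr (r : rat)) else set0.

Lemma measurable_rat_cube n k : measurable (@rat_cube n k).
Proof.
by rewrite /rat_cube; case: unpickle => [[q r]|//]; exact: measurable_cube.
Qed.

Lemma rat_cube_basis n (U : set 'cV[R]_n) x : open U -> U x ->
  exists k, @rat_cube n k x /\ @rat_cube n k `<=` U.
Proof.
move=> oU Ux; have [r r0 rU] := open_subset_cube oU Ux.
have [s [s0 sr]] : exists s : rat, 0 < (ratr s : R) /\ ratr s < r / 2.
  have [|s] := @rat_in_itvoo R 0 (r / 2); first by rewrite divr_gt0.
  by rewrite in_itv/= => /andP[? ?]; exists s.
have /choice[q hq] : forall i, exists q : rat, `|x i 0 - ratr q| < ratr s :> R.
  move=> i; have [|q] := @rat_in_itvoo R (x i 0 - ratr s) (x i 0 + ratr s).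
    by rewrite ltrD2l gtrN.
  by rewrite in_itv/= -ltr_distl distrC => hq; exists q.
exists (pickle ((\col_i q i : 'cV[rat]_n), s)).
rewrite /rat_cube pickleK; split=> [i|y hy]; first by rewrite !mxE.
apply: rU => i; have := hy i; have := hq i; rewrite !mxE => h1 h2.
rewrite (_ : y i 0 - x i 0 = (y i 0 - ratr (q i)) - (x i 0 - ratr (q i))).
  by apply: le_lt_trans (ler_normB _ _) _; move: h1 h2 sr; lra.
by ring.
Qed.

Lemma open_cV_measurable n (U : set 'cV[R]_n) : open U -> measurable U.
Proof.
move=> oU.
rewrite (_ : U = \bigcup_(k in [set k | @rat_cube n k `<=` U]) @rat_cube n k).
  by apply: bigcup_measurable => k _; exact: measurable_rat_cube.
apply/seteqP; split=> [x Ux|x [k /= kU /kU//]].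
by have [k [kx kU]] := rat_cube_basis oU Ux; exists k.
Qed.

(** A set is covered by those countably many rational cubes that meet it in a
null set. *)
Lemma locally_negligible n (N : set 'cV[R]_n) :
  (forall x, N x -> exists W, [/\ open W, W x &
    (lebesgue_cV R n).-negligible (W `&` N)]) ->
  (lebesgue_cV R n).-negligible N.
Proof.
move=> h.
pose F k := if `[< (lebesgue_cV R n).-negligible (@rat_cube n k `&` N) >]
            then @rat_cube n k `&` N else set0.
apply: (@negligibleS _ _ _ _ (\bigcup_k F k)); last first.
  apply: negligible_bigcup => k; rewrite /F.
  by case: asboolP => // _; exact: negligible_set0.
move=> x Nx; have [W [oW Wx nW]] := h x Nx.
have [k [kx kW]] := rat_cube_basis oW Wx; exists k => //.
rewrite /F; case: asboolP => [_|h'] //; exfalso; apply: h'.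
by apply: negligibleS nW; exact: setSI.
Qed.

Lemma bounded_subset_cube n (A : set 'cV[R]_n) : bounded_set A ->
  exists2 r, 0 < r & A `<=` cube 0 r.
Proof.
move=> [M [Mreal hM]]; exists (`|M| + 2); first by rewrite ltr_wpDl.
move=> x Ax i; rewrite mxE subr0.
have M1 : M < `|M| + 1 by have := ler_norm M; lra.
have := le_trans (cV_coord_le x i) (hM _ M1 x Ax); lra.
Qed.
End cubes.

(** * Euclidean scalar product and norm *)

Section euclid.
Context {R : realType} {d : nat}.
Implicit Types x y z : 'cV[R]_d.

Lemma dotC x y : dot x y = dot y x.
Proof. by apply: eq_bigr => i _; rewrite mulrC. Qed.

Lemma dotDl x y z : dot (x + y) z = dot x z + dot y z.
Proof. by rewrite -big_split; apply: eq_bigr => i _; rewrite mxE mulrDl. Qed.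

Lemma dotZl a x y : dot (a *: x) y = a * dot x y.
Proof. by rewrite mulr_sumr; apply: eq_bigr => i _; rewrite mxE mulrA. Qed.

Lemma dotDr x y z : dot z (x + y) = dot z x + dot z y.
Proof. by rewrite !(dotC z) dotDl. Qed.

Lemma dotZr a x y : dot y (a *: x) = a * dot y x.
Proof. by rewrite !(dotC y) dotZl. Qed.

Lemma dotNl x y : dot (- x) y = - dot x y.
Proof. by rewrite -scaleN1r dotZl mulN1r. Qed.

Lemma dotNr x y : dot y (- x) = - dot y x.
Proof. by rewrite !(dotC y) dotNl. Qed.

Lemma dotBl x y z : dot (x - y) z = dot x z - dot y z.
Proof. by rewrite dotDl dotNl. Qed.

Lemma dotBr x y z : dot z (x - y) = dot z x - dot z y.
Proof. by rewrite dotDr dotNr. Qed.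

Lemma dot0l x : dot 0 x = 0.
Proof. by rewrite -(scale0r 0) dotZl mul0r. Qed.

Lemma dot0r x : dot x 0 = 0.
Proof. by rewrite dotC dot0l. Qed.

Lemma dotxx_ge0 x : 0 <= dot x x.
Proof. by apply: sumr_ge0 => i _; rewrite -expr2 sqr_ge0. Qed.

Lemma dotxx_eq0 x : dot x x = 0 -> x = 0.
Proof.
move=> /eqP; rewrite psumr_eq0; last by move=> i _; rewrite -expr2 sqr_ge0.
move=> /allP h; apply/colP => i; rewrite mxE.
by have := h i (mem_index_enum _); rewrite -expr2 sqrf_eq0 => /eqP.
Qed.

Lemma enorm_ge0 x : 0 <= enorm x.
Proof. exact: sqrtr_ge0. Qed.

Lemma sqr_enorm x : enorm x ^+ 2 = dot x x.
Proof. by rewrite sqr_sqrtr// dotxx_ge0. Qed.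

Lemma enorm0 : enorm (0 : 'cV[R]_d) = 0.
Proof. by rewrite /enorm dot0l sqrtr0. Qed.

Lemma enorm_eq0 x : enorm x = 0 -> x = 0.
Proof. by move=> h; apply: dotxx_eq0; rewrite -sqr_enorm h expr0n. Qed.

Lemma enorm_gt0 x : x != 0 -> 0 < enorm x.
Proof.
move=> x0; rewrite lt_def enorm_ge0 andbT; apply: contra x0 => /eqP.
by move=> /enorm_eq0 ->.
Qed.

Lemma enormZ a x : enorm (a *: x) = `|a| * enorm x.
Proof.
by rewrite /enorm dotZl dotZr mulrA -expr2 sqrtrM ?sqr_ge0// sqrtr_sqr.
Qed.

Lemma enormN x : enorm (- x) = enorm x.
Proof. by rewrite -scaleN1r enormZ normrN1 mul1r. Qed.

Lemma dot_sqr_le x y : dot x y ^+ 2 <= dot x x * dot y y.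
Proof.
have [->|y0] := eqVneq y 0; first by rewrite !dot0r expr0n mulr0.
have yy : 0 < dot y y by rewrite -sqr_enorm exprn_gt0// enorm_gt0.
have := dotxx_ge0 (x - (dot x y / dot y y) *: y).
rewrite dotBl !dotBr !dotZl !dotZr (dotC y x) => h.
rewrite -ler_pdivrMr// -subr_ge0; apply: le_trans h _.
by rewrite le_eqVlt; apply/orP; left; apply/eqP; field; rewrite gt_eqF.
Qed.

Lemma normr_dot_le x y : `|dot x y| <= enorm x * enorm y.
Proof.
rewrite /enorm -sqrtrM ?dotxx_ge0// -sqrtr_sqr ler_sqrt ?dot_sqr_le//.
by rewrite mulr_ge0 ?dotxx_ge0.
Qed.

Lemma enormD_le x y : enorm (x + y) <= enorm x + enorm y.
Proof.
rewrite -(@ler_pXn2r _ 2)// ?nnegrE ?addr_ge0 ?enorm_ge0//.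
rewrite sqrrD !sqr_enorm dotDl !dotDr (dotC y x).
have := le_trans (ler_norm _) (normr_dot_le x y); lra.
Qed.

Lemma coord_le_enorm x i : `|x i 0| <= enorm x.
Proof.
rewrite -sqrtr_sqr ler_sqrt ?dotxx_ge0// expr2 /dot (bigD1 i)//= lerDl.
by apply: sumr_ge0 => j _; rewrite -expr2 sqr_ge0.
Qed.

Lemma enorm_le_norm x : enorm x <= d%:R * `|x|.
Proof.
rewrite -(@ler_pXn2r _ 2)// ?nnegrE ?enorm_ge0 ?mulr_ge0//.
rewrite sqr_enorm; apply: (@le_trans _ _ (\sum_(i < d) `|x| ^+ 2)).
  apply: ler_sum => i _; rewrite -expr2 -[leLHS]real_normK ?num_real//.
  by rewrite ler_pXn2r ?nnegrE// cV_coord_le.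
rewrite sumr_const card_ord -[leLHS]mulr_natl exprMn ler_wpM2r ?sqr_ge0//.
by rewrite -natrX ler_nat; case: d => // n; rewrite -mulnn leq_pmulr.
Qed.

Lemma eball_cube x r : eball x r `<=` cube x r.
Proof.
move=> y h i; apply: le_lt_trans h.
by have := coord_le_enorm (y - x) i; rewrite !mxE.
Qed.

Lemma measurable_dot disp (T : measurableType disp) (D : set T)
    (f g : T -> 'cV[R]_d) : (forall i, measurable_fun D (fun t => f t i 0)) ->
  (forall i, measurable_fun D (fun t => g t i 0)) ->
  measurable_fun D (fun t => dot (f t) (g t)).
Proof. by move=> mf mg; apply: measurable_sum => i; exact: measurable_funM. Qed.

Lemma measurable_enorm disp (T : measurableType disp) (D : set T)
    (f : T -> 'cV[R]_d) : (forall i, measurable_fun D (fun t => f t i 0)) ->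
  measurable_fun D (fun t => enorm (f t)).
Proof.
move=> mf; apply: (measurableT_comp (f := @Num.sqrt R)).
  by apply: continuous_measurable_fun; exact: sqrt_continuous.
exact: measurable_dot.
Qed.

Lemma measurable_eball x r : measurable (eball x r).
Proof.
have m : measurable_fun setT (fun y => enorm (y - x)).
  by apply: measurable_enorm => i; under eq_fun do rewrite !mxE;
    apply: measurable_funB => //; exact: measurable_coord.
rewrite (_ : eball x r = (fun y => enorm (y - x)) @^-1` `]-oo, r[%classic).
  by rewrite -[X in measurable X]setTI; exact: m.
by apply/seteqP; split=> y /=; rewrite in_itv.
Qed.

Lemma cube_eball x r : 0 < r -> cube x (r / d.+1%:R) `<=` eball x r.
Proof.
move=> r0 y h; rewrite /eball /=; apply: le_lt_trans (enorm_le_norm _) _.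
have le : `|y - x| <= r / d.+1%:R.
  apply/cV_norm_leP => [|i]; first by rewrite divr_ge0// ltW.
    by rewrite !mxE ltW//; exact: h.
apply: (@le_lt_trans _ _ (d%:R * (r / d.+1%:R))); first by rewrite ler_wpM2l.
by rewrite mulrCA gtr_pMr// ltr_pdivrMr// mul1r ltr_nat.
Qed.

Lemma open_eball x r : open (eball x r).
Proof.
rewrite openE => y yx.
rewrite /interior; pose s := r - enorm (y - x).
have s0 : 0 < s by rewrite subr_gt0.
apply: (@filterS _ _ _ (cube y (s / d.+1%:R))).
  move=> z /(cube_eball s0); rewrite /eball/= => h.
  rewrite (_ : z - x = (z - y) + (y - x)); last by rewrite addrA subrK.
  by apply: le_lt_trans (enormD_le _ _) _; move: h; rewrite /s; lra.
by rewrite cube_ball ?divr_gt0//; apply: nbhsx_ballx; rewrite divr_gt0.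
Qed.

End euclid.

(** * The kernel 1/|y - x| is integrable, uniformly in x *)

Section singular.
Context {R : realType} {d : nat}.
Implicit Types x y : 'cV[R]_d.

Lemma measurable_enormB (x : 'cV[R]_d) :
  measurable_fun setT (fun y => enorm (y - x)).
Proof.
apply: measurable_enorm => i; under eq_fun do rewrite !mxE.
by apply: measurable_funB => //; exact: measurable_coord.
Qed.

Lemma measurable_invr_comp disp (T : measurableType disp) (D : set T)
    (f : T -> R) : measurable_fun D f -> measurable_fun D (fun t => (f t)^-1).
Proof.
move=> mf.
rewrite (_ : (fun t => _) = f \* (fun t => (`|f t| `^ (-1)) ^+ 2)); last first.
  apply/funext => t /=; rewrite powR_inv1//.
  have [->|ft0] := eqVneq (f t) 0; first by rewrite mul0r invr0.
  rewrite exprVn real_normK ?num_real// expr2 invfM mulrA mulfV// mul1r.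
  by [].
apply: measurable_funM => //; apply: measurable_funX.
apply: (measurableT_comp (f := fun x : R => x `^ (-1))).
  exact: measurable_powR.
exact: measurableT_comp.
Qed.

(** On the dyadic shell of radii between r / 2^(k+1) and r / 2^k the kernel is at
most 2^(k+1) / r and the shell sits in a cube of volume (2 r / 2^k)^d; for d >= 2
the products are summable. *)
Lemma integral_inv_enorm x r : (1 < d)%N -> 0 < r -> r <= 1 ->
  (\int[lebesgue_cV R d]_(y in eball x r) ((enorm (y - x))^-1)%:E
   <= (2 ^+ d.+2 * r)%:E)%E.
Proof.
move=> d2 r0 r1.
have p2 k : 0 < 2 ^+ k :> R by rewrite exprn_gt0.
pose F k y : \bar R :=
  ((2 ^+ k.+1 / r) * (\1_(cube x (r / 2 ^+ k)) y))%:E.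
have F0 k y : (0 <= F k y)%E.
  by rewrite lee_fin mulr_ge0// divr_ge0// ltW.
have mF k : measurable_fun setT (F k).
  apply/measurable_EFinP/measurable_funM => //.
  by apply: measurable_indic; exact: measurable_cube.
have mxr : measurable (eball x r) by exact: measurable_eball.
apply: (@le_trans _ _ (\int[lebesgue_cV R d]_(y in eball x r)
    (\sum_(k <oo) F k y))%E).
  apply: ge0_le_integral => //.
  - by move=> y _; rewrite lee_fin invr_ge0 enorm_ge0.
  - apply/measurable_EFinP/measurable_funTS/measurable_invr_comp.
    exact: measurable_enormB.
  - by apply: ge0_emeasurable_sum => // k _; exact: measurable_funTS.
  move=> y xy; set s := enorm (y - x).
  have [s0|s0] := eqVneq s 0.
    by rewrite s0 invr0; apply: nneseries_ge0.
  have {}s0 : 0 < s by rewrite lt_def s0 enorm_ge0.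
  have exk : exists k, r / 2 ^+ k <= s.
    exists (Num.bound (r / s)); rewrite ler_pdivrMr// mulrC -ler_pdivrMr//.
    exact/ltW/upper_nthrootP.
  have [[|k] hk hmin] := ex_minnP exk.
    move: xy; rewrite /eball/= -/s => ?; move: hk; rewrite expr0 divr1.
    by move=> ?; exfalso; lra.
  have ks : s < r / 2 ^+ k by rewrite ltNge; apply/negP => /hmin; rewrite ltnn.
  apply: (@le_trans _ _ (F k y)).
    rewrite /F indicE mem_set ?mulr1; last first.
      move=> i; apply: le_lt_trans ks.
      by have := coord_le_enorm (y - x) i; rewrite !mxE.
    rewrite lee_fin -[leRHS]invrK lef_pV2 ?posrE ?invr_gt0 ?divr_gt0//.
    by rewrite invf_div.
  have := @nneseries_lim_ge R (F ^~ y) xpredT 0%N k.+1 (fun n _ _ => F0 n y).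
  apply: le_trans; rewrite big_nat_recr//= leeDr//.
  exact: sume_ge0.
rewrite integral_nneseries//; last first.
  by move=> k; exact: measurable_funTS.
have hlim := @cvg_geometric_eseries_half R (2 ^+ d.+2 * r) 0.
rewrite expr0 divr1 in hlim; rewrite -(cvg_lim _ hlim)//.
apply: lee_nneseries => [k _ _|k _].
  by apply: integral_ge0.
rewrite addn1 natrX.
apply: (@le_trans _ _ (\int[lebesgue_cV R d]_(y in setT) F k y)%E).
  exact: ge0_subset_integral.
rewrite /F; under eq_integral do rewrite EFinM.
rewrite ge0_integralZl_EFin//; last 2 first.
- by apply/measurable_EFinP/measurable_indic; exact: measurable_cube.
- by rewrite divr_ge0// ltW.
rewrite integral_indic//; last exact: measurable_cube.
rewrite setIT [X in (_ * X)%E](_ : _ = ((2 * (r / 2 ^+ k)) ^+ d)%:E);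
  last by apply: lebesgue_cV_cube; rewrite divr_gt0.
rewrite -EFinM lee_fin.
rewrite exprMn expr_div_n.
have rd : r ^+ d <= r ^+ 2 by rewrite ler_wiXn2l// ltW.
have kd : (2 ^+ k) ^- d <= (2 ^+ k) ^- 2 :> R.
  by rewrite lef_pV2 ?posrE ?exprn_gt0// ler_weXn2l// exprn_ege1// ler1n.
apply: (@le_trans _ _ (2 ^+ k.+1 / r * (2 ^+ d * (r ^+ 2 / (2 ^+ k) ^+ 2)))).
  rewrite ler_wpM2l//; first by rewrite divr_ge0 // ltW.
  rewrite ler_wpM2l//.
  by rewrite ler_pM// ?exprn_ge0 ?invr_ge0 ?exprn_ge0// ltW.
have k0 := p2 k.
rewrite le_eqVlt; apply/orP; left; apply/eqP; rewrite !exprS; field.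
by rewrite !gt_eqF.
Qed.

End singular.

(** * Integral operators on bounded measurable functions *)

Section kernels.
Context {disp} {T : measurableType disp} {R : realType}.
Variable nu : {finite_measure set T -> \bar R}.
Implicit Types (h : T -> R) (k : T -> T -> R).

(** Genuinely bounded functions instead of classes: integral operators are then
defined, linear and bounded at every point. *)
Definition bmeas h := measurable_fun setT h /\ exists m, forall x, `|h x| <= m.

Lemma bmeas_cst (c : R) : bmeas (fun=> c).
Proof. by split=> //; exists `|c|. Qed.

Lemma bmeasD h1 h2 : bmeas h1 -> bmeas h2 -> bmeas (fun x => h1 x + h2 x).
Proof.
move=> [m1 [b1 B1]] [m2 [b2 B2]]; split; first exact: measurable_funD.
by exists (b1 + b2) => x; apply: le_trans (ler_normD _ _) _; exact: lerD.
Qed.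

Lemma bmeasM h1 h2 : bmeas h1 -> bmeas h2 -> bmeas (fun x => h1 x * h2 x).
Proof.
move=> [m1 [b1 B1]] [m2 [b2 B2]]; split; first exact: measurable_funM.
by exists (b1 * b2) => x; rewrite normrM ler_pM.
Qed.

Lemma bmeasZ (a : R) h : bmeas h -> bmeas (fun x => a * h x).
Proof. by apply: bmeasM; exact: bmeas_cst. Qed.

Lemma bmeasN h : bmeas h -> bmeas (fun x => - h x).
Proof. by move=> /(bmeasZ (-1)); under eq_fun do rewrite mulN1r. Qed.

Lemma bmeas_sum (I : Type) (r : seq I) (P : pred I) (F : I -> T -> R) :
  (forall i, bmeas (F i)) -> bmeas (fun x => \sum_(i <- r | P i) F i x).
Proof.
move=> hF; elim: r => [|i r IH].
  by under eq_fun do rewrite big_nil; exact: bmeas_cst.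
under eq_fun do rewrite big_cons; case: (P i) => //; exact: bmeasD.
Qed.

Lemma bmeas_indic A : measurable A -> bmeas (\1_A : T -> R).
Proof.
move=> mA; split; first exact: measurable_indic.
by exists 1 => x; rewrite indicE; case: (_ \in _); rewrite ?normr1 ?normr0.
Qed.

Lemma bmeas_integrable h : bmeas h -> nu.-integrable setT (EFin \o h).
Proof.
move=> [mh [m hm]]; apply: measurable_bounded_integrable => //.
  by apply: fin_num_fun_lty; exact: fin_num_measure.
by exists m; split=> [|M mM x _]; [exact: num_real|exact: le_trans (hm x) (ltW mM)].
Qed.

(** Kernels acting boundedly on bounded functions; the bound is on each row. *)
Definition ker k (M : R) := measurable_fun setT (fun z : T * T => k z.1 z.2) /\
  forall x, (\int[nu]_y `|k x y|%:E <= M%:E)%E.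

Definition kint k h x := \int[nu]_y (k x y * h y).

Lemma ker_measurable k M x : ker k M -> measurable_fun setT (k x).
Proof.
move=> [mk _].
exact: (measurable_fun_pair2 (f := fun z : T * T => k z.1 z.2) x).
Qed.

Lemma ker_integrable k M x : ker k M -> nu.-integrable setT (EFin \o k x).
Proof.
move=> kk; apply/integrableP; split.
  by apply/measurable_EFinP; exact: ker_measurable kk.
by apply: le_lt_trans (kk.2 x) _; rewrite ltry.
Qed.

Lemma ker_ge0 k M (x : T) : ker k M -> 0 <= M.
Proof.
by move=> kk; rewrite -lee_fin; apply: le_trans (kk.2 x); exact: integral_ge0.
Qed.

Lemma kint_integrable k M h x : ker k M -> bmeas h ->
  nu.-integrable setT (fun y => (k x y * h y)%:E).
Proof.
move=> kk [mh [m hm]]; apply: (@integrableMl _ _ _ nu setT _ (EFin \o k x) h) => //.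
  exact: ker_integrable kk.
by exists m; split=> [|M' mM y _]; [exact: num_real|exact: le_trans (hm y) (ltW mM)].
Qed.

Lemma ker_mul (k : T -> T -> R) (b : T -> T -> R) M B : ker k M ->
  measurable_fun setT (fun z : T * T => b z.1 z.2) -> (forall x y, `|b x y| <= B) ->
  ker (fun x y => k x y * b x y) (M * B).
Proof.
move=> hk mb hb; split; first by apply: measurable_funM => //; exact: hk.1.
move=> x; have B0 : 0 <= B by exact: le_trans (normr_ge0 _) (hb x x).
have mk := ker_measurable x hk.
have mbx : measurable_fun setT (b x).
  exact: (measurable_fun_pair2 (f := fun z : T * T => b z.1 z.2) x).
apply: (@le_trans _ _ (\int[nu]_y (B%:E * `|k x y|%:E))%E).
  apply: ge0_le_integral => //.
  - by apply/measurable_EFinP; apply: measurableT_comp => //; exact: measurable_funM.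
  - apply/(measurable_EFinP setT (fun y => B * `|k x y|)).
    by apply: measurable_funM => //; exact: measurableT_comp.
  - by move=> y _; rewrite -EFinM lee_fin normrM mulrC ler_wpM2r.
rewrite ge0_integralZl_EFin//; last first.
  by apply/measurable_EFinP; exact: measurableT_comp.
by rewrite mulrC EFinM lee_wpmul2l ?lee_fin//; exact: hk.2.
Qed.

Lemma kint_abs_le k M h m x : ker k M -> bmeas h -> (forall y, `|h y| <= m) ->
  (\int[nu]_y `|k x y * h y|%:E <= (M * m)%:E)%E.
Proof.
move=> kk bh hm; apply: (ker_mul kk (b := fun _ => h) _ (fun _ => hm)).2.
exact: (measurableT_comp bh.1 measurable_snd).
Qed.

Lemma kint_le k M h m x : ker k M -> bmeas h -> (forall y, `|h y| <= m) ->
  `|kint k h x| <= M * m.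
Proof.
move=> kk bh hm; have i := kint_integrable x kk bh.
apply: le_trans (le_normr_Rintegral _ i) _ => //.
rewrite -lee_fin; apply: le_trans _ (kint_abs_le x kk bh hm).
rewrite /Rintegral fineK//; apply: integrable_fin_num => //.
exact: integrable_norm.
Qed.

Lemma kint_prod_integrable k M h : ker k M -> bmeas h ->
  (nu \x nu)%E.-integrable setT (fun z : T * T => (k z.1 z.2 * h z.2)%:E).
Proof.
move=> kk bh; have [mh [m hm]] := bh; apply/integrable12ltyP.
  apply/measurable_EFinP/measurable_funM; first exact: kk.1.
  exact: (measurableT_comp mh).
apply: (@le_lt_trans _ _ (\int[nu]_x (M * m)%:E)%E).
  apply: ge0_le_integral => //.
  - by move=> x _; apply: integral_ge0.
  - apply: (measurable_fun_fubini_tonelli_F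
      (fun z : T * T => `|k z.1 z.2 * h z.2|%:E)) => //.
    apply/measurable_EFinP/measurableT_comp => //; apply/measurable_funM.
      exact: kk.1.
    exact: (measurableT_comp mh).
  - by move=> x _; exact: kint_abs_le kk bh hm.
rewrite integral_cst//; move: (@point T) => x.
have Mm0 : 0 <= M * m.
  by rewrite mulr_ge0 ?(ker_ge0 x kk)//; exact: le_trans (normr_ge0 _) (hm x).
rewrite lte_mul_pinfty ?lee_fin//.
exact/fin_num_fun_lty/fin_num_measure.
Qed.

Lemma measurable_kint k M h : ker k M -> bmeas h -> measurable_fun setT (kint k h).
Proof.
move=> kk bh; have i := kint_prod_integrable kk bh.
rewrite (_ : kint k h = fine \o (fubini_F nu
  (fun z : T * T => (k z.1 z.2 * h z.2)%:E)))//.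
by apply: measurableT_comp; [exact: fine_measurable|exact: (measurable_fubini_F i)].
Qed.

Lemma bmeas_kint k M h : ker k M -> bmeas h -> bmeas (kint k h).
Proof.
move=> kk bh; split; first exact: measurable_kint kk bh.
by have [_ [m hm]] := bh; exists (M * m) => x; exact: kint_le.
Qed.

Lemma kint_lin k M a h1 h2 x : ker k M -> bmeas h1 -> bmeas h2 ->
  kint k (fun y => a * h1 y + h2 y) x = a * kint k h1 x + kint k h2 x.
Proof.
move=> kk b1 b2; rewrite /kint -RintegralZl//; last exact: kint_integrable kk b1.
rewrite -RintegralD//; last exact: kint_integrable kk b2.
  by apply: eq_Rintegral => y _; ring.
exact: (integrableZl measurableT a (kint_integrable x kk b1)).
Qed.

Lemma kint_kerB k1 k2 M1 M2 h x : ker k1 M1 -> ker k2 M2 -> bmeas h ->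
  kint (fun x y => k1 x y - k2 x y) h x = kint k1 h x - kint k2 h x.
Proof.
move=> kk1 kk2 bh; rewrite /kint -RintegralB//.
- by apply: eq_Rintegral => y _; ring.
- exact: kint_integrable kk1 bh.
- exact: kint_integrable kk2 bh.
Qed.

Lemma eq_ae_kint k h1 h2 x : (forall y, measurable_fun setT (k y)) ->
  measurable_fun setT h1 -> measurable_fun setT h2 ->
  {ae nu, forall y, h1 y = h2 y} -> kint k h1 x = kint k h2 x.
Proof.
move=> mk m1 m2 h; rewrite /kint /Rintegral; congr fine.
apply: ae_eq_integral => //.
- by apply/measurable_EFinP/measurable_funM.
- by apply/measurable_EFinP/measurable_funM.
- by apply: filterS h => y hy _; rewrite hy.
Qed.

End kernels.

(** * Fredholm alternative in the space of bounded measurable functions *)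

Section fredholm.
Context {disp} {T : measurableType disp} {R : realType} {d : nat}.
Implicit Types (u v w f : T -> 'cV[R]_d).

Definition vbm w := forall i, bmeas (fun x => w x i 0).

Definition vle w (m : R) := forall x i, `|w x i 0| <= m.

Lemma vbm_lin a u v : vbm u -> vbm v -> vbm (fun x => a *: u x + v x).
Proof.
move=> bu bv i; under eq_fun do rewrite !mxE.
by apply: bmeasD => //; exact: bmeasZ.
Qed.

Lemma vbm0 : vbm (fun=> 0).
Proof. by move=> i; under eq_fun do rewrite mxE; exact: bmeas_cst. Qed.

Lemma vbmZ a u : vbm u -> vbm (fun x => a *: u x).
Proof. by move=> bu; under eq_fun do rewrite -[_ *: _]addr0; exact: vbm_lin vbm0. Qed.

Lemma vbmD u v : vbm u -> vbm v -> vbm (fun x => u x + v x).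
Proof. by move=> bu; under eq_fun do rewrite -[u _]scale1r; exact: vbm_lin. Qed.

Lemma vbmB u v : vbm u -> vbm v -> vbm (fun x => u x - v x).
Proof.
move=> bu bv; rewrite (_ : (fun x => _) = fun x => (-1) *: v x + u x).
  exact: vbm_lin.
by apply/funext => x; rewrite scaleN1r addrC.
Qed.

Lemma vbm_sum (I : Type) (r : seq I) (F : I -> T -> 'cV[R]_d) :
  (forall i, vbm (F i)) -> vbm (fun x => \sum_(i <- r) F i x).
Proof.
move=> hF; elim: r => [|i r IH]; first by under eq_fun do rewrite big_nil; exact: vbm0.
by under eq_fun do rewrite big_cons; exact: vbmD.
Qed.

Lemma vbm_bound w : vbm w -> exists2 m, 0 <= m & vle w m.
Proof.
move=> bw; have /choice[m hm] : forall i, exists m, forall x, `|w x i 0| <= m.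
  by move=> i; exact: (bw i).2.
exists (\sum_i `|m i|); first exact: sumr_ge0.
move=> x i; apply: (le_trans (hm i x)); apply: (le_trans (ler_norm _)).
by rewrite (bigD1 i)//= lerDl sumr_ge0.
Qed.

Lemma vle_sum (I : Type) (r : seq I) (F : I -> T -> 'cV[R]_d) (m : I -> R) :
  (forall i, vle (F i) (m i)) ->
  vle (fun x => \sum_(i <- r) F i x) (\sum_(i <- r) m i).
Proof.
move=> hF x j; rewrite summxE; apply: le_trans (ler_norm_sum _ _ _) _.
by apply: ler_sum => i _; exact: hF.
Qed.

Record bop (S : (T -> 'cV[R]_d) -> T -> 'cV[R]_d) (C : R) : Prop := {
  bop_vbm : forall w, vbm w -> vbm (S w);
  bop_lin : forall a u v, vbm u -> vbm v ->
    forall x, S (fun x => a *: u x + v x) x = a *: S u x + S v x;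
  bop_le : forall w m, vbm w -> vle w m -> vle (S w) (C * m) }.

Record bfunctional (phi : (T -> 'cV[R]_d) -> R) (C : R) : Prop := {
  bfunctional_lin : forall a u v, vbm u -> vbm v ->
    phi (fun x => a *: u x + v x) = a * phi u + phi v;
  bfunctional_le : forall w m, vbm w -> vle w m -> `|phi w| <= C * m }.

Definition finrank (F : (T -> 'cV[R]_d) -> T -> 'cV[R]_d) : Prop :=
  exists (I : finType) (phi : I -> (T -> 'cV[R]_d) -> R) (b : I -> T -> 'cV[R]_d),
  [/\ forall l, exists C, bfunctional (phi l) C, forall l, vbm (b l) &
      forall w x, vbm w -> F w x = \sum_l phi l w *: b l x].

Section bop_theory.
Variables (S : (T -> 'cV[R]_d) -> T -> 'cV[R]_d) (C : R).
Hypothesis hS : bop S C.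

Lemma bopB u v x : vbm u -> vbm v -> S (fun x => u x - v x) x = S u x - S v x.
Proof.
move=> bu bv; rewrite (_ : (fun x => _) = fun x => (-1) *: v x + u x).
  by rewrite (bop_lin hS)// scaleN1r addrC.
by apply/funext => y; rewrite scaleN1r addrC.
Qed.

Lemma bop0 x : S (fun=> 0) x = 0.
Proof.
rewrite -[RHS](subrr (S (fun=> 0) x)) -(bopB x vbm0 vbm0).
by congr (S _ x); apply/funext => y; rewrite subrr.
Qed.

Lemma bopZ a u x : vbm u -> S (fun x => a *: u x) x = a *: S u x.
Proof.
move=> bu; rewrite -[RHS]addr0 -[in RHS](bop0 x) -(bop_lin hS)//; last exact: vbm0.
by congr (S _ x); apply/funext => y; rewrite addr0.
Qed.

Lemma bopD u v x : vbm u -> vbm v -> S (fun x => u x + v x) x = S u x + S v x.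
Proof.
move=> bu bv; rewrite -[S u x]scale1r -(bop_lin hS)//.
by congr (S _ x); apply/funext => y; rewrite scale1r.
Qed.

Lemma bop_sum (I : Type) (r : seq I) (c : I -> R) (F : I -> T -> 'cV[R]_d) x :
  (forall i, vbm (F i)) ->
  S (fun x => \sum_(i <- r) c i *: F i x) x = \sum_(i <- r) c i *: S (F i) x.
Proof.
move=> hF; elim: r => [|i r IH].
  rewrite big_nil; apply: etrans (bop0 x).
  by congr (S _ x); apply/funext => y; rewrite big_nil.
rewrite big_cons -IH -(bop_lin hS)//.
  by congr (S _ x); apply/funext => y; rewrite big_cons.
by apply: vbm_sum => j; exact: vbmZ.
Qed.

End bop_theory.

Lemma bfunctional_sum (I : Type) (r : seq I) (c : I -> R)
    (F : I -> T -> 'cV[R]_d) phi C : bfunctional phi C ->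
  (forall i, vbm (F i)) ->
  phi (fun x => \sum_(i <- r) c i *: F i x) = \sum_(i <- r) c i * phi (F i).
Proof.
move=> hphi hF; elim: r => [|i r IH].
  have := bfunctional_lin hphi (-1) vbm0 vbm0.
  rewrite mulN1r addNr big_nil => <-.
  by congr phi; apply/funext => y; rewrite big_nil scaler0 addr0.
rewrite big_cons -IH -(bfunctional_lin hphi)//.
  by congr phi; apply/funext => y; rewrite big_cons.
by apply: vbm_sum => j; exact: vbmZ.
Qed.

Lemma expr_le_eq0 (q C a : R) : 0 <= q -> q < 1 ->
  (forall n, `|a| <= C * q ^+ n) -> a = 0.
Proof.
move=> q0 q1 h; apply/eqP; rewrite -normr_eq0 eq_le normr_ge0 andbT.
have c : C * q ^+ n @[n --> \oo] --> C * 0.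
  by apply: cvgMr; apply: cvg_expr; rewrite ger0_norm.
rewrite mulr0 in c.
rewrite -(cvg_lim _ c)//; apply: limr_ge; first by apply/cvg_ex; exists 0.
exact: nearW.
Qed.

(** Neumann series: w = f + S f + S^2 f + ... converges geometrically in sup norm. *)
Lemma neumann S q f m : bop S q -> 0 <= q -> q < 1 -> vbm f -> vle f m ->
  exists w, [/\ vbm w, vle w ((1 - q)^-1 * m) & forall x, w x - S w x = f x].
Proof.
move=> hS q0 q1 bf hf.
have q1' : 0 < 1 - q by rewrite subr_gt0.
pose it n := iter n S f.
have bit n : vbm (it n) by elim: n => //= n IH; exact: (bop_vbm hS).
have leit n : vle (it n) (q ^+ n * m).
  elim: n => [|n IH]; first by rewrite expr0 mul1r.
  by rewrite exprS -mulrA; exact: (bop_le hS).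
pose W n x : 'cV[R]_d := \sum_(0 <= k < n) it k x.
have bW n : vbm (W n) by exact: vbm_sum.
have SW n x : S (W n) x = W n.+1 x - f x.
  rewrite /W big_nat_recl// addrC addKr.
  transitivity (\sum_(0 <= k < n) 1 *: S (it k) x); last first.
    by apply: eq_bigr => k _; rewrite scale1r.
  rewrite -(bop_sum hS)//; congr (S _ x); apply/funext => y.
  by apply: eq_bigr => k _; rewrite scale1r.
have geo n p : \sum_(n <= k < n + p) q ^+ k <= (1 - q)^-1 * q ^+ n.
  have -> : \sum_(n <= k < n + p) q ^+ k = (1 - q)^-1 * (q ^+ n - q ^+ (n + p)).
    elim: p => [|p IH]; first by rewrite addn0 big_geq// subrr mulr0.
    rewrite addnS big_nat_recr ?leq_addr//= IH exprS; field.
    by rewrite gt_eqF.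
  by rewrite ler_pM2l ?invr_gt0// gerBl exprn_ge0.
pose L x i := limn (fun n => W n x i 0).
have m0 (x : T) (i : 'I_d) : 0 <= m by exact: le_trans (normr_ge0 _) (hf x i).
have WE n x i : W n x i 0 = \sum_(0 <= k < n) it k x i 0 by rewrite summxE.
have cv x i : W n x i 0 @[n --> \oo] --> L x i.
  rewrite /L (_ : (fun n => W n x i 0) = series (fun k => it k x i 0)); last first.
    by apply/funext => n; rewrite WE.
  apply: (@normed_cvg _ R^o (fun k => it k x i 0)).
  apply: (@series_le_cvg _ _ (geometric m q)) => [n|n|n|].
  - exact: normr_ge0.
  - by rewrite /= mulr_ge0 ?(m0 x i)// exprn_ge0.
  - by rewrite /= mulrC; exact: leit.
  - by apply: is_cvg_geometric_series; rewrite ger0_norm.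
pose w x : 'cV[R]_d := \col_i L x i.
have tail n : vle (fun x => w x - W n x) (q ^+ n * ((1 - q)^-1 * m)).
  move=> x i; rewrite !mxE.
  have c : `|W p x i 0 - W n x i 0| @[p --> \oo] --> `|L x i - W n x i 0|.
    by apply: cvg_norm; apply: cvgB => //; exact: cvg_cst.
  rewrite -(cvg_lim _ c)//; apply: limr_le; first exact: cvgP c.
  exists n => // p /= np; rewrite -(subnKC np) !WE.
  rewrite (big_cat_nat (leq0n n) (leq_addr _ _))//= [X in `|X|]addrAC subrr add0r.
  apply: le_trans (ler_norm_sum _ _ _) _.
  rewrite mulrCA (mulrC _ m) mulrA mulrC mulrA -mulrA.
  apply: le_trans (_ : m * ((1 - q)^-1 * q ^+ n) <= _); last first.
    by rewrite le_eqVlt; apply/orP; left; apply/eqP; ring.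
  apply: le_trans (ler_wpM2l (m0 x i) (geo n (p - n)%N)).
  by rewrite mulr_sumr; apply: ler_sum => k _; rewrite mulrC; exact: leit.
have wm : vle w ((1 - q)^-1 * m).
  move=> x i; have := tail 0%N x i; rewrite /= expr0 mul1r /W.
  by rewrite big_geq// subr0.
have bw : vbm w.
  move=> i; split; last by exists ((1 - q)^-1 * m) => x; exact: wm.
  apply: (@measurable_fun_cvg _ _ _ _ (fun n x => W n x i 0)).
    by move=> n; exact: (bW n i).1.
  by move=> x _; rewrite mxE; exact: cv.
exists w; split=> // x; apply/eqP; rewrite -subr_eq0; apply/eqP/colP => i.
rewrite [RHS]mxE.
apply: (@expr_le_eq0 q (2 * ((1 - q)^-1 * m))) => // n.
have -> : w x - S w x - f x =
    (w x - W n.+1 x) - S (fun x => w x - W n x) x.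
  rewrite (bopB hS)// SW; rewrite !opprD !opprK !addrA.
  by rewrite -!addrA; congr (_ + _); rewrite addrCA addKr addrC.
rewrite [X in `|X|]mxE [X in `|_ + X|]mxE; apply: le_trans (ler_normB _ _) _.
rewrite -mulrA mulr_natl mulr2n.
have q1n : q ^+ n.+1 <= q ^+ n by rewrite exprS ler_piMl ?exprn_ge0// ltW.
have mq : 0 <= (1 - q)^-1 * m by rewrite mulr_ge0 ?(m0 x i)// invr_ge0 ltW.
rewrite !(mulrC _ (q ^+ n)); apply: lerD.
  by apply: le_trans (tail n.+1 x i) _; rewrite ler_wpM2r.
have bWn : vbm (fun x => w x - W n x) by exact: vbmB.
apply: le_trans ((bop_le hS) _ _ bWn (tail n) x i) _.
by rewrite mulrA -exprS ler_wpM2r.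
Qed.

Lemma sum_enum_val (U : nmodType) (I : finType) (F : I -> U) :
  \sum_l F l = \sum_(a < #|I|) F (enum_val a).
Proof. by rewrite -big_enum_val; apply: eq_bigl. Qed.

Lemma bfunctional0 phi C : bfunctional phi C -> phi (fun=> 0) = 0.
Proof.
move=> hphi; have := bfunctional_lin hphi (-1) vbm0 vbm0.
rewrite mulN1r addNr => h; rewrite -[RHS]h.
by congr phi; apply/funext => x; rewrite scaler0 addr0.
Qed.

Lemma finrank_vbm F w : finrank F -> vbm w -> vbm (F w).
Proof.
move=> [I [phi [b [_ bb FE]]]] bw.
rewrite (_ : F w = fun x => \sum_l phi l w *: b l x).
  by apply: vbm_sum => l; exact: vbmZ.
by apply/funext => x; exact: FE.
Qed.

(** With u_l solving (1 - S) u_l = b_l, the equation (1 - S - F) w = f reduces to a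
square linear system for the numbers phi_l w, whose matrix is invertible exactly
when 1 - S - F is injective. *)
Lemma fredholm_finrank S F q : bop S q -> 0 <= q -> q < 1 -> finrank F ->
  (forall w, vbm w -> (forall x, w x = S w x + F w x) -> forall x, w x = 0) ->
  exists C, forall f m, vbm f -> vle f m ->
    exists w, [/\ vbm w, vle w (C * m) & forall x, w x - S w x - F w x = f x].
Proof.
move=> hS q0 q1 [I [phi [b [hphi bb FE]]]] inj.
set K := (1 - q)^-1.
have /choice[Cphi hCphi] := hphi.
have /choice[u hu] : forall l, exists u, vbm u /\ forall x, u x - S u x = b l x.
  move=> l; have [m m0 hm] := vbm_bound (bb l).
  by have [u [bu _ hu]] := neumann hS q0 q1 (bb l) hm; exists u.
have bu l : vbm (u l) by exact: (hu l).1.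
have /choice[U hU] : forall l, exists U, 0 <= U /\ vle (u l) U.
  by move=> l; have [U U0 hU] := vbm_bound (bu l); exists U.
pose ev := @enum_val I (mem I).
(* Up to the particular solution g below, w is the combination of the u_l with
coefficients phi_l w. *)
pose M := \matrix_(a < #|I|, c < #|I|) ((a == c)%:R - phi (ev a) (u (ev c))).
pose comb (v : 'I_#|I| -> R) x := \sum_a v a *: u (ev a) x.
have bcomb (v : 'I_#|I| -> R) : vbm (comb v) by apply: vbm_sum => a; exact: vbmZ.
have Scomb (v : 'I_#|I| -> R) x : comb v x - S (comb v) x = \sum_a v a *: b (ev a) x.
  rewrite (bop_sum hS)// -sumrB; apply: eq_bigr => a _.
  by rewrite -scalerBr (hu _).2.
have phicomb l (v : 'I_#|I| -> R) : phi l (comb v) = \sum_a v a * phi l (u (ev a)).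
  exact: bfunctional_sum (hCphi l) _.
have Mv (v : 'I_#|I| -> R) a : \sum_c M a c * v c = v a - phi (ev a) (comb v).
  rewrite phicomb (eq_bigr (fun c => (a == c)%:R * v c - v c * phi (ev a) (u (ev c)))).
    rewrite sumrB; congr (_ - _); rewrite (bigD1 a)//= eqxx mul1r big1 ?addr0//.
    by move=> c ca; rewrite eq_sym (negbTE ca) mul0r.
  by move=> c _; rewrite mxE mulrBl (mulrC (phi _ _)).
have FE' w x : vbm w -> F w x = \sum_a phi (ev a) w *: b (ev a) x.
  by move=> bw; rewrite FE// sum_enum_val.
have uM : M \in unitmx.
  rewrite unitmxE unitfE; apply/negP => /eqP detM.
  have /det0P[v v0 hv] : \det M^T == 0 by rewrite det_tr detM.
  pose v' a := v 0 a.
  have fix_v a : phi (ev a) (comb v') = v' a.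
    apply/esym/eqP; rewrite -subr_eq0 -Mv.
    apply/eqP; transitivity ((v *m M^T) 0 a); last by rewrite hv mxE.
    by rewrite [RHS]mxE; apply: eq_bigr => c _; rewrite [M^T _ _]mxE mulrC.
  have w0 : comb v' = fun=> 0.
    apply/funext; apply: inj => // x; apply/eqP.
    rewrite addrC -subr_eq Scomb FE'//; apply/eqP.
    by apply: eq_bigr => a _; rewrite fix_v.
  move: v0; apply/negP; rewrite negbK; apply/eqP/rowP => a.
  by rewrite mxE -[LHS]/(v' a) -fix_v w0; exact: bfunctional0 (hCphi _).
pose D a := \sum_c `|invmx M a c| * (Cphi (ev c) * K).
exists (K + \sum_a D a * U (ev a)) => f m bf hf.
have [g [bg hg gf]] := neumann hS q0 q1 bf hf; rewrite -/K in hg.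
pose r := \col_a phi (ev a) g.
pose c := invmx M *m r.
pose w x := g x + comb (c^~ 0) x.
have bw : vbm w by exact: vbmD.
have phiw a : phi (ev a) w = c a 0.
  rewrite /w -[X in phi _ X](_ : (fun x => 1 *: g x + comb (c^~ 0) x) = _); last first.
    by apply/funext => x; rewrite scale1r.
  rewrite (bfunctional_lin (hCphi _))// mul1r.
  have := Mv (c^~ 0) a; rewrite (_ : \sum_c0 _ = r a 0); last first.
    by rewrite -(mulKVmx uM r) mxE.
  by rewrite mxE => ->; rewrite subrK.
exists w; split => //.
- rewrite mulrDl mulr_suml => x i; rewrite mxE.
  apply: le_trans (ler_normD _ _) _; apply: lerD; first exact: hg.
  suff hD : forall a, vle (fun y => c a 0 *: u (ev a) y) (D a * U (ev a) * m).
    exact: (@vle_sum _ (index_enum _) _ _ hD).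
  move=> a y j; rewrite mxE normrM mulrAC; apply: ler_pM => //; last exact: (hU _).2.
  rewrite mxE mulr_suml; apply: le_trans (ler_norm_sum _ _ _) _.
  apply: ler_sum => e _; rewrite normrM -!mulrA ler_wpM2l// mxE.
  exact: (bfunctional_le (hCphi _)).
- move=> x; rewrite FE'// (bopD hS)//.
  rewrite opprD addrACA gf Scomb.
  rewrite (eq_bigr (fun a => phi (ev a) w *: b (ev a) x)) ?addrK//.
  by move=> a _; rewrite phiw.
Qed.

Lemma bop_mono S C C' : bop S C -> C <= C' -> bop S C'.
Proof.
move=> hS CC'; split; [exact: bop_vbm hS|exact: bop_lin hS|].
move=> w m bw hw x i; apply: le_trans (bop_le hS bw hw x i) _.
by rewrite ler_wpM2r//; exact: le_trans (normr_ge0 _) (hw x i).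
Qed.

Lemma eq_bop S S' C C' : bop S' C' -> (forall w x, vbm w -> S w x = S' w x) ->
  (forall w m, vbm w -> vle w m -> vle (S' w) (C * m)) -> bop S C.
Proof.
move=> hS' E hle; split.
- move=> w bw; rewrite (_ : S w = S' w); first exact: (bop_vbm hS').
  by apply/funext => x; exact: E.
- by move=> a u v bu bv x; rewrite !E//; [exact: (bop_lin hS')|exact: vbm_lin].
- by move=> w m bw hw x i; rewrite E//; exact: hle.
Qed.

Lemma bop_comp S P C1 C2 : bop S C1 -> bop P C2 ->
  bop (fun w => S (P w)) (C1 * C2).
Proof.
move=> hS hP; split.
- by move=> w bw; apply: (bop_vbm hS); exact: (bop_vbm hP).
- move=> a u v bu bv x; rewrite -(bop_lin hS); [|exact: (bop_vbm hP)..].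
  by congr (S _ x); apply/funext => y; rewrite (bop_lin hP).
- move=> w m bw hw; rewrite -mulrA; apply: (bop_le hS); first exact: (bop_vbm hP).
  exact: (bop_le hP).
Qed.

Lemma bop_add S P C1 C2 : bop S C1 -> bop P C2 ->
  bop (fun w x => S w x + P w x) (C1 + C2).
Proof.
move=> hS hP; split.
- by move=> w bw; apply: vbmD; [exact: (bop_vbm hS)|exact: (bop_vbm hP)].
- move=> a u v bu bv x; rewrite (bop_lin hS)// (bop_lin hP)//.
  by rewrite scalerDr addrACA.
- move=> w m bw hw x i; rewrite mxE mulrDl; apply: le_trans (ler_normD _ _) _.
  by apply: lerD; [exact: (bop_le hS)|exact: (bop_le hP)].
Qed.

Lemma bop_sub S P C1 C2 : bop S C1 -> bop P C2 ->
  bop (fun w x => S w x - P w x) (C1 + C2).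
Proof.
move=> hS hP; split.
- by move=> w bw; apply: vbmB; [exact: (bop_vbm hS)|exact: (bop_vbm hP)].
- move=> a u v bu bv x; rewrite (bop_lin hS)// (bop_lin hP)//.
  by rewrite scalerBr opprD addrACA.
- move=> w m bw hw x i; rewrite !mxE mulrDl; apply: le_trans (ler_normB _ _) _.
  by apply: lerD; [exact: (bop_le hS)|exact: (bop_le hP)].
Qed.

Lemma finrank_comp S C F : bop S C -> finrank F -> finrank (fun w => S (F w)).
Proof.
move=> hS [I [phi [b [hphi bb FE]]]]; exists I, phi, (fun l => S (b l)); split => //.
  by move=> l; exact: (bop_vbm hS).
move=> w x bw; rewrite (_ : F w = fun x => \sum_l phi l w *: b l x).
  by rewrite (bop_sum hS).
by apply/funext => y; exact: FE.
Qed.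

(** The form in which compactness is used: approximation in operator norm. *)
Definition nearly_finrank S := forall eta, 0 < eta ->
  exists2 F, finrank F & bop (fun w x => S w x - F w x) eta.

Lemma nearly_finrank_comp S P C : bop S C -> nearly_finrank P ->
  (forall w, vbm w -> vbm (P w)) ->
  nearly_finrank (fun w => S (P w)).
Proof.
move=> hS aP bP eta eta0.
have C1 : 0 < `|C| + 1 by rewrite ltr_pwDr.
have [|F hF hPF] := aP (eta / (`|C| + 1)); first by rewrite divr_gt0.
exists (fun w => S (F w)); first exact: finrank_comp hS hF.
have h := bop_mono (bop_comp (bop_mono hS (ler_norm C)) hPF).
have {h} h : bop (fun w => S (fun x => P w x - F w x)) eta.
  apply: h; rewrite mulrCA ger_pMr// ler_pdivrMr// mul1r; lra.
have E w x : vbm w -> S (P w) x - S (F w) x = S (fun x => P w x - F w x) x.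
  by move=> bw; rewrite (bopB hS)//; [exact: bP|exact: finrank_vbm hF bw].
by apply: (eq_bop h) => [w x bw|]; [exact: E|exact: (bop_le h)].
Qed.

(** S is an operator of norm at most 1/2 plus one of finite rank. *)
Lemma fredholm_nearly_finrank S : nearly_finrank S ->
  (forall w, vbm w -> (forall x, w x = S w x) -> forall x, w x = 0) ->
  exists C, forall f m, vbm f -> vle f m ->
    exists w, [/\ vbm w, vle w (C * m) & forall x, w x - S w x = f x].
Proof.
move=> aS inj; have [|F hF hSF] := aS 2^-1; first by rewrite invr_gt0.
have [|||C hC] := fredholm_finrank hSF _ _ hF.
- by rewrite invr_ge0.
- by rewrite invf_lt1 ?ltr1n.
- move=> w bw hw; apply: inj => // x.
  by have := hw x; rewrite subrK.
exists C => f m bf hf; have [w [bw hw Ew]] := hC f m bf hf; exists w; split => // x.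
by rewrite -(Ew x); rewrite opprB addrA addrAC addrK.
Qed.

End fredholm.

(** * Separable kernels are dense in L^1 of a product *)

Section separable.
Context {disp} {T : measurableType disp} {R : realType}.
Variable nu : {finite_measure set T -> \bar R}.
Implicit Types (f g s : T * T -> R).
Local Notation mfun f := (measurable_fun [set: T * T] f).

Definition L1norm f := (\int[(nu \x nu)%E]_z `|f z|%:E)%E.

Definition separable s := exists (I : finType) (a c : I -> T -> R),
  [/\ forall l, bmeas (a l), forall l, bmeas (c l) &
      s = fun z => \sum_l a l z.1 * c l z.2].

Definition separable_limit f := forall eta, 0 < eta ->
  exists2 s, separable s & (L1norm (fun z => f z - s z)%R <= eta%:E)%E.

Lemma measurable_separable s : separable s -> mfun s.
Proof.
move=> [I [a [c [ba bc ->]]]]; apply: measurable_sum => l.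
apply: measurable_funM.
  by apply: (measurableT_comp (ba l).1); exact: measurable_fst.
by apply: (measurableT_comp (bc l).1); exact: measurable_snd.
Qed.

Lemma separable_bounded s : separable s -> exists C : R, forall z, `|s z| <= C.
Proof.
move=> [I [a [c [ba bc ->]]]].
have /choice[A hA] : forall l, exists A, forall x, `|a l x| <= A.
  by move=> l; exact: (ba l).2.
have /choice[C hC] : forall l, exists C, forall x, `|c l x| <= C.
  by move=> l; exact: (bc l).2.
exists (\sum_l A l * C l) => z; apply: le_trans (ler_norm_sum _ _ _) _.
by apply: ler_sum => l _; rewrite normrM ler_pM.
Qed.

Lemma separableM (a c : T -> R) : bmeas a -> bmeas c ->
  separable (fun z => a z.1 * c z.2).
Proof.
move=> ba bc; exists unit, (fun=> a), (fun=> c); split=> //.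
by apply/funext => z; rewrite big_const card_unit /= addr0.
Qed.

Lemma separableD s1 s2 : separable s1 -> separable s2 ->
  separable (fun z => s1 z + s2 z).
Proof.
move=> [I1 [a1 [c1 [ba1 bc1 ->]]]] [I2 [a2 [c2 [ba2 bc2 ->]]]].
exists (I1 + I2)%type, (fun l => match l with inl l => a1 l | inr l => a2 l end),
  (fun l => match l with inl l => c1 l | inr l => c2 l end).
split; [by case|by case|].
by apply/funext => z; rewrite big_sumType.
Qed.

Lemma separableZ e s : separable s -> separable (fun z => e * s z).
Proof.
move=> [I [a [c [ba bc ->]]]]; exists I, (fun l x => e * a l x), c; split=> //.
  by move=> l; exact: bmeasZ.
by apply/funext => z; rewrite mulr_sumr; apply: eq_bigr => l _; rewrite mulrA.
Qed.

Lemma measurable_absE f : mfun f -> measurable_fun setT (fun z => `|f z|%:E).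
Proof. by move=> mf; apply/measurable_EFinP; exact: measurableT_comp. Qed.

Lemma L1normD f g : mfun f -> mfun g ->
  (L1norm (fun z => f z + g z)%R <= L1norm f + L1norm g)%E.
Proof.
move=> mf mg; rewrite /L1norm -ge0_integralD//; [|exact: measurable_absE..].
apply: ge0_le_integral => //.
- by apply: measurable_absE; exact: measurable_funD.
- by apply: emeasurable_funD; exact: measurable_absE.
- by move=> z _; rewrite -EFinD lee_fin ler_normD.
Qed.

Lemma L1normZ e f : mfun f -> L1norm (fun z => e * f z) = (`|e|%:E * L1norm f)%E.
Proof.
move=> mf; rewrite /L1norm -ge0_integralZl_EFin//; last exact: measurable_absE.
by apply: eq_integral => z _; rewrite normrM EFinM.
Qed.

Lemma separable_limit_close f : mfun f ->
  (forall eta, 0 < eta -> exists g, [/\ mfun g, separable_limit g &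
     (L1norm (fun z => f z - g z)%R <= eta%:E)%E]) -> separable_limit f.
Proof.
move=> mf h eta eta0; have e2 : 0 < eta / 2 by rewrite divr_gt0.
have [g [mg sg fg]] := h _ e2; have [s ss gs] := sg _ e2; exists s => //.
have ms := measurable_separable ss.
rewrite (_ : (fun z => _) = fun z => (f z - g z) + (g z - s z)); last first.
  by apply/funext => z; rewrite addrA subrK.
apply: le_trans (L1normD _ _) _; [exact: measurable_funB..|].
by rewrite (splitr eta) EFinD leeD.
Qed.

Lemma separable_limit_sep s : separable s -> separable_limit s.
Proof.
move=> ss eta eta0; exists s => //; rewrite /L1norm.
under eq_integral do rewrite subrr normr0.
by rewrite integral0 lee_fin ltW.
Qed.

Lemma separable_limitD f g : mfun f -> mfun g ->
  separable_limit f -> separable_limit g -> separable_limit (fun z => f z + g z).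
Proof.
move=> mf mg sf sg eta eta0; have e2 : 0 < eta / 2 by rewrite divr_gt0.
have [s ss fs] := sf _ e2; have [t st gt] := sg _ e2.
exists (fun z => s z + t z); first exact: separableD.
have ms := measurable_separable ss; have mt := measurable_separable st.
rewrite (_ : (fun z => _) = fun z => (f z - s z) + (g z - t z)); last first.
  by apply/funext => z; rewrite opprD addrACA.
apply: le_trans (L1normD _ _) _; [exact: measurable_funB..|].
by rewrite (splitr eta) EFinD leeD.
Qed.

Lemma separable_limitZ e f : mfun f ->
  separable_limit f -> separable_limit (fun z => e * f z).
Proof.
move=> mf sf eta eta0; have e1 : 0 < `|e| + 1 by rewrite ltr_pwDr.
have [|s ss fs] := sf (eta / (`|e| + 1)); first by rewrite divr_gt0.
exists (fun z => e * s z); first exact: separableZ.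
have ms := measurable_separable ss.
rewrite (_ : (fun z => _) = fun z => e * (f z - s z)); last first.
  by apply/funext => z; rewrite mulrBr.
rewrite L1normZ; last exact: measurable_funB.
apply: le_trans (lee_wpmul2l _ fs) _ => //.
by rewrite -EFinM lee_fin mulrCA ger_pMr// ler_pdivrMr// mul1r lerDl.
Qed.

Lemma separable_limit_cst e : separable_limit (fun=> e).
Proof.
apply: separable_limit_sep.
rewrite (_ : (fun=> e) = fun z : T * T => (fun=> e) z.1 * (fun=> 1) z.2).
  exact: (separableM (bmeas_cst e) (bmeas_cst 1)).
by apply/funext => z; rewrite mulr1.
Qed.

Lemma prod_fin : ((nu \x nu)%E setT < +oo)%E.
Proof.
rewrite -setXTT product_measure1E//.
rewrite lte_mul_pinfty ?fin_num_measure//.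
exact/fin_num_fun_lty/fin_num_measure.
Qed.

(** Bounded pointwise convergence implies convergence in L^1, as the measure is
finite. *)
Lemma separable_limit_cvg (f_ : nat -> T * T -> R) f (C : R) :
  (forall n, mfun (f_ n)) -> (forall n, separable_limit (f_ n)) ->
  (forall n z, `|f_ n z| <= C) -> (forall z, f_ n z @[n --> \oo] --> f z) ->
  separable_limit f.
Proof.
move=> mf_ sf_ f_C f_f.
have mf : mfun f by apply: (@measurable_fun_cvg _ _ _ _ f_) => // z _; exact: f_f.
have [|||||_ + _] := @dominated_convergence _ _ _ (nu \x nu)%E setT measurableT
  (fun n z => (f_ n z)%:E) (fun z => (f z)%:E) (fun=> C%:E).
- by move=> n; apply/measurable_EFinP.
- exact/measurable_EFinP.
- by apply: nearW => z _; apply: cvg_comp (f_f z) _; exact: cvg_id.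
- apply: (@measurable_bounded_integrable _ _ _ _ (fun=> C)) => //.
    exact: prod_fin.
  by exists `|C|; split=> [|M mM x _]; [exact: num_real|exact: ltW].
- by apply: nearW => z n _; exact: f_C.
move=> /fine_cvgP[fin_f cvg_f].
apply: separable_limit_close => // eta eta0.
have /cvgr_dist_lt/(_ eta eta0) h := cvg_f.
have [n _ /(_ n (leqnn n))/= [fn hn]] := filterI fin_f h.
exists (f_ n); split => //.
move: hn; rewrite sub0r normrN => hn; rewrite /L1norm.
rewrite (_ : (\int[_]_z _)%E =
  (\int[(nu \x nu)%E]_z `|(f_ n z)%:E - (EFin \o f) z|)%E); last first.
  by apply: eq_integral => z _; rewrite /= distrC.
by rewrite -(fineK fn) lee_fin; apply: le_trans (ler_norm _) (ltW hn).
Qed.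

(** Indicators: the sets whose indicator is a limit of separable kernels form a
Dynkin system containing the rectangles. *)
Lemma separable_limit_indic (A : set (T * T)) : measurable A ->
  separable_limit \1_A.
Proof.
rewrite measurable_prod_measurableType.
pose G : set (set (T * T)) := [set B `*` C | B in measurable & C in measurable].
apply: (@dynkin_induction _ _ G (fun A => separable_limit \1_A)).
- by rewrite measurable_prod_measurableType.
- move=> _ _ [B1 mB1 [C1 mC1 <-]] [B2 mB2 [C2 mC2 <-]].
  exists (B1 `&` B2); first exact: measurableI.
  by exists (C1 `&` C2); [exact: measurableI|rewrite setXI].
- by rewrite indicT; exact: separable_limit_cst.
- move=> _ [B mB [C mC <-]]; apply: separable_limit_sep.
  rewrite (_ : \1_(B `*` C) = fun z : T * T => \1_B z.1 * \1_C z.2 :> R).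
    exact: (separableM (bmeas_indic mB) (bmeas_indic mC)).
  by apply/funext => z; rewrite !indicE -natrM mulnb in_setX.
- move=> S mS sS.
  rewrite (_ : \1_(~` S) = fun z : T * T => 1 + (-1) * \1_S z :> R).
    apply: separable_limitD => //; last exact: separable_limitZ.
    - by apply: measurable_funM => //; exact: measurable_indic.
    - exact: separable_limit_cst.
  by apply/funext => z; rewrite !indicE in_setC; case: (_ \in _); rewrite /=; ring.
- move=> F mF tF sF.
  pose A_ n := \big[setU/set0]_(k < n) F k.
  have mA n : measurable (A_ n) by exact: bigsetU_measurable.
  have AE n z : (z \in A_ n) = `[< exists2 k, (k < n)%N & F k z >].
    rewrite /A_ -bigcup_mkord; apply/idP/asboolP; rewrite inE/=.
      by move=> [k /= kn Fk]; exists k.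
    by move=> [k kn Fk]; exists k.
  apply: (@separable_limit_cvg (fun n => \1_(A_ n)) _ 1).
  + by move=> n; exact: measurable_indic.
  + elim=> [|n IH].
      by rewrite /A_ big_ord0 indic0; exact: separable_limit_cst.
    rewrite (_ : \1_(A_ n.+1) = fun z : T * T => \1_(A_ n) z + \1_(F n) z :> R).
      by apply: separable_limitD => //; exact: measurable_indic.
    apply/funext => z; rewrite !indicE.
    rewrite {1}/A_ big_ord_recr/= in_setU -natrD.
    have [zF|zF] := boolP (z \in F n); last by rewrite orbF addn0.
    rewrite orbT; case: (boolP (z \in _)) => //; rewrite AE => /asboolP[k kn Fk].
    exfalso; move/trivIsetP : tF => /(_ k n I I); rewrite ltn_eqF// => /(_ isT).
    by apply/eqP/set0P; exists z; split=> //; rewrite inE in zF.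
  + by move=> n z; rewrite indicE; case: (_ \in _); rewrite ?normr1 ?normr0.
  + move=> z; have [[k _ Fk]|zF] := pselect ((\bigcup_k F k) z).
      apply: cvg_near_cst; exists k.+1 => // n /= kn; rewrite !indicE.
      by rewrite AE asboolT; [rewrite mem_set//; exists k|exists k].
    apply: cvg_near_cst; exists 0%N => // n /= _; rewrite !indicE.
    rewrite AE asboolF ?(memNset zF)// => -[k _ Fk].
    by apply: zF; exists k.
Qed.

Lemma separable_limit_sum (I : Type) (r : seq I) (e : I -> R)
    (F : I -> T * T -> R) : (forall i, mfun (F i)) ->
  (forall i, separable_limit (F i)) ->
  separable_limit (fun z => \sum_(i <- r) e i * F i z).
Proof.
move=> mF sF; elim: r => [|i r IH].
  by under eq_fun do rewrite big_nil; exact: separable_limit_cst.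
under eq_fun do rewrite big_cons.
apply: separable_limitD => //; last exact: separable_limitZ.
  exact: measurable_funM.
by apply: measurable_sum => k; exact: measurable_funM.
Qed.

Import HBNNSimple.

(** Bounded functions are bounded limits of simple functions, that is, of
combinations of indicators. *)
Lemma separable_limit_bounded f (C : R) : mfun f -> (forall z, `|f z| <= C) ->
  separable_limit f.
Proof.
wlog f0 : f C / forall z, 0 <= f z => [wh mf fC|mf fC].
  rewrite (_ : f = fun z => (f z + C) + - C); last first.
    by apply/funext => z; rewrite addrK.
  have mfC : mfun (fun z => f z + C) by exact: measurable_funD.
  apply: separable_limitD => //; last exact: separable_limit_cst.
  apply: (wh _ (C + C)) => // z.
    by have := fC z; rewrite ler_norml => /andP[]; rewrite -subr_ge0 opprK.
  apply: le_trans (ler_normD _ _) _; rewrite lerD//.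
  by rewrite ger0_norm//; exact: le_trans (normr_ge0 _) (fC z).
have mf' : measurable_fun setT (EFin \o f) by exact/measurable_EFinP.
pose f_ := nnsfun_approx measurableT mf'.
have f_f z : f_ n z @[n --> \oo] --> f z.
  have h : forall x, [set: T * T] x -> (0 <= (EFin \o f) x)%E.
    by move=> x _; rewrite lee_fin.
  by have /fine_cvg := @cvg_nnsfun_approx _ _ _ _ measurableT _ mf' h z I.
have f_le n z : f_ n z <= f z.
  rewrite -(cvg_lim _ (f_f z))//; apply: nondecreasing_cvgn_le.
    by move=> i j ij; have /lefP := nd_nnsfun_approx measurableT mf' ij; apply.
  exact: cvgP (f_f z).
apply: (@separable_limit_cvg f_ f C) => //.
- move=> n; rewrite (_ : (f_ n : T * T -> R) = fun z => \sum_(y <- finmap.enum_fset (fset_set (range (f_ n))))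
    y * \1_(f_ n @^-1` [set y]) z :> R); last first.
    by apply/funext => z; rewrite {1}fimfunE fsbig_finite.
  by apply: separable_limit_sum => y;
    [exact: measurable_indic|exact: separable_limit_indic].
- move=> n z; rewrite ger0_norm//; apply: le_trans (f_le n z) _.
  exact: le_trans (ler_norm _) (fC z).
Qed.

End separable.

(** * Matrix kernels: the square of a weakly singular operator is nearly of finite rank *)

Section matrix_kernels.
Context {disp} {T : measurableType disp} {R : realType} {d : nat}.
Variable nu : {finite_measure set T -> \bar R}.
Implicit Types (t K : T -> T -> 'M[R]_d) (u v w f : T -> 'cV[R]_d).

Definition mop t w x : 'cV[R]_d :=
  \col_i \sum_j kint nu (fun x y => t x y i j) (fun y => w y j 0) x.

Definition mker t M := forall i j, ker nu (fun x y => t x y i j) M.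

Lemma mop_bop t M : mker t M -> bop (mop t) (d%:R * M).
Proof.
move=> kt; split.
- move=> w bw i; under eq_fun do rewrite mxE.
  by apply: bmeas_sum => j; exact: bmeas_kint (kt i j) (bw j).
- move=> a u v bu bv x; apply/colP => i; rewrite !mxE mulr_sumr -big_split/=.
  apply: eq_bigr => j _; under [X in kint _ _ X]eq_fun do rewrite !mxE.
  exact: kint_lin (kt i j) (bu j) (bv j).
- move=> w m bw hw x i; rewrite mxE; apply: le_trans (ler_norm_sum _ _ _) _.
  rewrite -mulrA mulr_natl -[X in _ *+ X]card_ord -sumr_const.
  by apply: ler_sum => j _; apply: kint_le (kt i j) (bw j) _ => y; exact: hw.
Qed.

Lemma mopB t1 t2 M1 M2 w x : mker t1 M1 -> mker t2 M2 -> vbm w ->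
  mop (fun x y => t1 x y - t2 x y) w x = mop t1 w x - mop t2 w x.
Proof.
move=> k1 k2 bw; apply/colP => i; rewrite !mxE -sumrB; apply: eq_bigr => j _.
rewrite -(kint_kerB x (k1 i j) (k2 i j) (bw j)).
by congr (kint _ _ _ x); apply/funext => a; apply/funext => b; rewrite !mxE.
Qed.

Lemma eq_ae_mop t M u v x : mker t M -> vbm u -> vbm v ->
  {ae nu, forall y, u y = v y} -> mop t u x = mop t v x.
Proof.
move=> kt bu bv uv; apply/colP => i; rewrite !mxE; apply: eq_bigr => j _.
apply: eq_ae_kint; [|exact: (bu j).1|exact: (bv j).1|].
  by move=> y; exact: ker_measurable (kt i j).
by apply: filterS uv => y ->.
Qed.

Lemma ker_bounded (k : T -> T -> R) C :
  measurable_fun setT (fun z : T * T => k z.1 z.2) ->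
  (forall x y, `|k x y| <= C) -> ker nu k (C * fine (nu setT)).
Proof.
move=> mk kC; split=> // x.
have fT : nu setT \is a fin_num by exact: fin_num_measure.
rewrite EFinM fineK// -integral_cst//; apply: ge0_le_integral => //.
- apply/measurable_EFinP; apply: measurableT_comp => //.
  exact: (measurable_fun_pair2 (f := fun z : T * T => k z.1 z.2) x).
- by move=> y _; rewrite lee_fin.
Qed.

Lemma mker_bounded t :
  (forall i j, measurable_fun setT (fun z : T * T => t z.1 z.2 i j)) ->
  (forall i j, exists C, forall x y, `|t x y i j| <= C) -> exists M, mker t M.
Proof.
move=> mt ht.
have /choice[C hC] : forall ij : 'I_d * 'I_d, exists C, forall x y,
    `|t x y ij.1 ij.2| <= C by move=> [i j]; exact: ht.
exists ((\sum_ij `|C ij|) * fine (nu setT)) => i j; apply: ker_bounded => // x y.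
apply: le_trans (hC (i, j) x y) _; apply: (le_trans (ler_norm _)).
by rewrite (bigD1 (i, j))//= lerDl sumr_ge0.
Qed.

(** Composition with a bounded kernel only sees the L^1 norm of the other
kernel. *)
Lemma kint_L1_le (k : T -> T -> R) M e h m : ker nu k M -> bmeas h ->
  (forall y, `|h y| <= m) ->
  (L1norm nu (fun z => k z.1 z.2) <= e%:E)%E ->
  \int[nu]_x `|kint nu k h x| <= e * m.
Proof.
move=> kk bh hm ke; have m0 : 0 <= m by apply: le_trans (hm point).
have bk := bmeas_kint kk bh.
have mabs : measurable_fun setT (fun z : T * T => `|k z.1 z.2|%:E).
  by apply/measurable_EFinP; apply: measurableT_comp => //; exact: kk.1.
rewrite -lee_fin /Rintegral fineK; last first.
  apply: integrable_fin_num => //.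
  exact: (integrable_norm (bmeas_integrable nu bk)).
apply: (@le_trans _ _ (\int[nu]_x (m%:E * \int[nu]_y `|k x y|%:E))%E).
  apply: ge0_le_integral => //.
  - by apply/measurable_EFinP; apply: measurableT_comp => //; exact: bk.1.
  - apply: emeasurable_funM => //.
    exact: (measurable_fun_fubini_tonelli_F (fun z : T * T => `|k z.1 z.2|%:E)).
  - move=> x _; have i := kint_integrable x kk bh.
    apply: (@le_trans _ _ (\int[nu]_y `|k x y * h y|%:E)%E).
      rewrite EFin_normr_Rintegral//; exact: le_abse_integral (measurable_int _ i).
    have mkx := ker_measurable x kk.
    rewrite -ge0_integralZl_EFin//; last first.
      by apply/measurable_EFinP; exact: measurableT_comp.
    apply: ge0_le_integral => //.
    + apply/measurable_EFinP; apply: measurableT_comp => //.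
      by apply: measurable_funM => //; exact: bh.1.
    + apply/(measurable_EFinP setT (fun y => m * `|k x y|)).
      by apply: measurable_funM => //; exact: measurableT_comp.
    + by move=> y _; rewrite -EFinM lee_fin normrM mulrC ler_wpM2r.
rewrite ge0_integralZl_EFin//; last 2 first.
- by move=> x _; exact: integral_ge0.
- exact: (measurable_fun_fubini_tonelli_F (fun z : T * T => `|k z.1 z.2|%:E)).
rewrite mulrC EFinM; apply: lee_wpmul2l; first by rewrite lee_fin.
by move: ke; rewrite /L1norm fubini_tonelli1.
Qed.

Lemma kint_bounded_le (k : T -> T -> R) (C : R) h x :
  measurable_fun setT (k x) -> (forall y, `|k x y| <= C) ->
  bmeas h -> `|kint nu k h x| <= C * \int[nu]_y `|h y|.
Proof.
move=> mk kC bh.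
have bk : bmeas (k x) by split=> //; exists C.
have ba : bmeas (fun y => `|h y|).
  have [mh [m hm]] := bh; split; first exact: measurableT_comp.
  by exists m => y; rewrite normr_id.
have bkh := bmeasM bk bh.
apply: le_trans (le_normr_Rintegral _ (bmeas_integrable nu bkh)) _ => //.
rewrite -RintegralZl//; last exact: bmeas_integrable.
apply: le_Rintegral => //.
- exact: integrable_norm (bmeas_integrable nu bkh).
- exact: (bmeas_integrable nu (bmeasZ C ba)).
- by move=> y _; rewrite normrM ler_wpM2r.
Qed.

Lemma finrank0 : finrank (fun (w : T -> 'cV[R]_d) (_ : T) => 0 : 'cV[R]_d).
Proof.
exists void, (fun=> fun=> 0), (fun=> fun=> 0); split; [by case|by case|].
by move=> w x _; rewrite big1// => -[].
Qed.

Lemma finrankD (F1 F2 : (T -> 'cV[R]_d) -> T -> 'cV[R]_d) :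
  finrank F1 -> finrank F2 -> finrank (fun w x => F1 w x + F2 w x).
Proof.
move=> [I1 [p1 [b1 [h1 bb1 E1]]]] [I2 [p2 [b2 [h2 bb2 E2]]]].
exists (I1 + I2)%type, (fun l => match l with inl l => p1 l | inr l => p2 l end),
  (fun l => match l with inl l => b1 l | inr l => b2 l end).
split; [by case|by case|].
by move=> w x bw; rewrite big_sumType E1// E2.
Qed.

Lemma finrank_sum (I : Type) (r : seq I)
    (F : I -> (T -> 'cV[R]_d) -> T -> 'cV[R]_d) :
  (forall i, finrank (F i)) -> finrank (fun w x => \sum_(i <- r) F i w x).
Proof.
move=> hF; elim: r => [|i r IH].
  rewrite (_ : (fun w x => _) = fun _ _ => 0); first exact: finrank0.
  by apply/funext => w; apply/funext => x; rewrite big_nil.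
rewrite (_ : (fun w x => _) = fun w x => F i w x + \sum_(i <- r) F i w x).
  exact: finrankD.
by apply/funext => w; apply/funext => x; rewrite big_cons.
Qed.

Lemma eq_finrank (F G : (T -> 'cV[R]_d) -> T -> 'cV[R]_d) :
  (forall w x, vbm w -> F w x = G w x) -> finrank F -> finrank G.
Proof.
move=> FG [I [p [b [h bb E]]]]; exists I, p, b; split=> // w x bw.
by rewrite -FG// E.
Qed.

Lemma Rintegral_sumZ (I : Type) (r : seq I) (e : I -> R) (h : I -> T -> R) :
  (forall l, nu.-integrable setT (EFin \o h l)) ->
  \int[nu]_y (\sum_(l <- r) e l * h l y) = \sum_(l <- r) e l * \int[nu]_y h l y.
Proof.
move=> ih; have iZ l : nu.-integrable setT (EFin \o (fun y => e l * h l y)).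
  exact: (integrableZl measurableT (e l) (ih l)).
elim: r => [|l r IH].
  under eq_Rintegral do rewrite big_nil.
  by rewrite big_nil Rintegral_cst// mul0r.
under eq_Rintegral do rewrite big_cons.
rewrite big_cons -IH -RintegralZl// RintegralD//.
rewrite (_ : _ \o _ = fun y => (\sum_(l <- r) (e l * h l y)%:E)%E).
  by apply: integrable_sum => // k _; exact: iZ.
by apply/funext => y /=; rewrite -sumEFin.
Qed.

Lemma Rintegral_lincomb (I : Type) (r : seq I) (e : I -> R) (h : I -> T -> R) :
  (forall l, bmeas (h l)) ->
  \int[nu]_y (\sum_(l <- r) e l * h l y) = \sum_(l <- r) e l * \int[nu]_y h l y.
Proof. by move=> bh; apply: Rintegral_sumZ => l; exact: bmeas_integrable. Qed.

Lemma finrank_separable (s : T -> T -> 'M[R]_d) :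
  (forall i j, separable (fun z : T * T => s z.1 z.2 i j)) -> finrank (mop s).
Proof.
move=> hs.
apply: (@eq_finrank (fun w x => \sum_i \sum_j
  kint nu (fun x y => s x y i j) (fun y => w y j 0) x *: delta_mx i 0)).
  move=> w x _; apply/colP => i; rewrite !mxE summxE (bigD1 i)//= [X in _ + X]big1.
    rewrite addr0 summxE; apply: eq_bigr => j _.
    by rewrite !mxE !eqxx mulr1.
  move=> k ki; rewrite summxE big1// => j _.
  by rewrite !mxE eq_sym (negbTE ki) mulr0.
apply: finrank_sum => i; apply: finrank_sum => j.
have [I [a [c [ba bc E]]]] := hs i j.
exists I, (fun l w => \int[nu]_y (c l y * w y j 0)), (fun l x => a l x *: delta_mx i 0).
have int_c l w : vbm w -> nu.-integrable setT (EFin \o (fun y => c l y * w y j 0)).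
  by move=> bw; apply: bmeas_integrable; apply: bmeasM.
split.
- move=> l; have [_ [m hm]] := bc l; exists (m * fine (nu setT)); split.
    move=> e u v bu bv; rewrite -RintegralZl//; last exact: int_c.
    rewrite -RintegralD//; last exact: int_c.
      by apply: eq_Rintegral => y _; rewrite !mxE; ring.
    by exact: (integrableZl measurableT e (int_c l u bu)).
  move=> w m' bw hw; apply: le_trans (le_normr_Rintegral _ (int_c l w bw)) _ => //.
  rewrite mulrAC -Rintegral_cst//; apply: le_Rintegral => //.
  + exact: integrable_norm (int_c l w bw).
  + by apply: bmeas_integrable; exact: bmeas_cst.
  + by move=> y _; rewrite normrM ler_pM.
- by move=> l k; under eq_fun do rewrite mxE mulrC; exact: bmeasZ.
- move=> w x bw; rewrite /kint (_ : \int[nu]_y _ =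
    \int[nu]_y (\sum_l a l x * (c l y * w y j 0))); last first.
    apply: eq_Rintegral => y _; have /(congr1 (fun g => g (x, y)))/= -> := E.
    by rewrite mulr_suml; apply: eq_bigr => l _; rewrite mulrA.
  rewrite Rintegral_lincomb; last by move=> l; exact: bmeasM.
  by rewrite scaler_suml; apply: eq_bigr => l _; rewrite scalerA mulrC.
Qed.

(** The inner kernel is replaced by a separable one that is close in L^1 only; the
bounded outer kernel turns the L^1 error into a uniform one. *)
Lemma mop_bounded_approx t1 t2 (C : R) :
  (forall i j, measurable_fun setT (fun z : T * T => t1 z.1 z.2 i j)) ->
  (forall i j, measurable_fun setT (fun z : T * T => t2 z.1 z.2 i j)) ->
  (forall x y i j, `|t1 x y i j| <= C) -> (forall x y i j, `|t2 x y i j| <= C) ->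
  nearly_finrank (fun w => mop t1 (mop t2 w)).
Proof.
move=> m1 m2 C1 C2 eta eta0.
have k1 : mker t1 (C * fine (nu setT)).
  by move=> i j; apply: (ker_bounded (m1 i j)) => x y; exact: C1.
have k2 : mker t2 (C * fine (nu setT)).
  by move=> i j; apply: (ker_bounded (m2 i j)) => x y; exact: C2.
pose e := eta / ((d%:R * d%:R * `|C|) + 1).
have D0 : 0 < d%:R * d%:R * `|C| + 1 by rewrite ltr_wpDl// !mulr_ge0.
have e0 : 0 < e by rewrite divr_gt0.
have /choice[s hs] : forall ij, exists s, separable s /\
    (L1norm nu (fun z => t2 z.1 z.2 ij.1 ij.2 - s z)%R <= e%:E)%E.
  move=> [i j]; have [s ss hs] := @separable_limit_bounded _ _ _ nu _ C (m2 i j)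
    (fun z => C2 _ _ _ _) _ e0.
  by exists s.
pose t3 x y : 'M[R]_d := \matrix_(i, j) s (i, j) (x, y).
have s3 i j : separable (fun z : T * T => t3 z.1 z.2 i j).
  rewrite (_ : (fun z => _) = s (i, j)); first exact: (hs (i, j)).1.
  by apply/funext => -[x y]; rewrite mxE.
have mt3 i j : measurable_fun setT (fun z : T * T => t3 z.1 z.2 i j).
  exact: measurable_separable (s3 i j).
have bt3 i j : exists C3, forall x y, `|t3 x y i j| <= C3.
  by have [C3 h3] := separable_bounded (s3 i j); exists C3 => x y; exact: (h3 (x, y)).
have [M3 k3] := mker_bounded mt3 bt3.
have b1 := mop_bop k1; have b2 := mop_bop k2; have b3 := mop_bop k3.
exists (fun w => mop t1 (mop t3 w)).
  by apply: (finrank_comp b1); exact: finrank_separable.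
have E w x : vbm w -> mop t1 (mop t2 w) x - mop t1 (mop t3 w) x =
    mop t1 (mop (fun x y => t2 x y - t3 x y) w) x.
  move=> bw; rewrite -(bopB b1); [|exact: (bop_vbm b2)|exact: (bop_vbm b3)].
  by congr (mop _ _ x); apply/funext => y; rewrite (mopB _ k2 k3).
have [M23 k23] : exists M23, mker (fun x y => t2 x y - t3 x y) M23.
  apply: mker_bounded => i j.
    by under eq_fun do rewrite !mxE; apply: measurable_funB => //;
       have := mt3 i j; under eq_fun do rewrite mxE.
  have [C3 h3] := bt3 i j; exists (C + C3) => x y; rewrite 2!mxE.
  by apply: le_trans (ler_normB _ _) _; rewrite lerD.
have b23 := mop_bop k23; have b123 := bop_comp b1 b23.
apply: (eq_bop b123) => [w x bw|w m bw hw x i]; first exact: E.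
  rewrite mxE.
  have C0 : 0 <= C by exact: le_trans (normr_ge0 _) (C1 x x i i).
  have m0 : 0 <= m by exact: le_trans (normr_ge0 _) (hw x i).
  set G := mop _ w; have bG : vbm G by exact: (bop_vbm b23).
  have bk j l : bmeas (kint nu (fun x y => (t2 x y - t3 x y) j l) (fun y => w y l 0)).
    exact: bmeas_kint (k23 j l) (bw l).
  have babs (h : T -> R) : bmeas h -> bmeas (fun y => `|h y|).
    move=> [mh [mm hm]]; split; first exact: measurableT_comp.
    by exists mm => y; rewrite normr_id.
  have hG j : \int[nu]_y `|G y j 0| <= d%:R * (e * m).
    apply: (@le_trans _ _ (\int[nu]_y (\sum_l 1 *
        `|kint nu (fun x y => (t2 x y - t3 x y) j l) (fun y => w y l 0) y|))).
      apply: le_Rintegral => //.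
      + by apply: bmeas_integrable; apply: babs; exact: bG.
      + apply: bmeas_integrable; apply: bmeas_sum => l; apply: bmeasZ.
        exact: babs (bk j l).
      + move=> y _; rewrite mxE; apply: le_trans (ler_norm_sum _ _ _) _.
        by apply: ler_sum => l _; rewrite mul1r.
    rewrite Rintegral_lincomb; last by move=> l; exact: babs (bk j l).
    rewrite mulr_natl -[X in _ *+ X]card_ord -sumr_const.
    apply: ler_sum => l _; rewrite mul1r.
    apply: kint_L1_le (k23 j l) (bw l) _ _ => [y|]; first exact: hw.
    have [_] := hs (j, l); congr (_ <= _)%E; congr (L1norm nu).
    by apply/funext => -[a b]; rewrite !mxE.
  apply: le_trans (ler_norm_sum _ _ _) _.
  apply: (@le_trans _ _ (\sum_(j < d) C * (d%:R * (e * m)))).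
    apply: ler_sum => j _; apply: le_trans (kint_bounded_le _ _ (bG j)) _.
    + exact: (measurable_fun_pair2 (f := fun z : T * T => t1 z.1 z.2 i j) x).
    + by move=> y; exact: C1.
    + by rewrite ler_wpM2l.
  rewrite sumr_const card_ord -[leLHS]mulr_natl.
  rewrite (_ : _ * _ = (d%:R * d%:R * `|C|) * e * m); last first.
    by rewrite ger0_norm//; ring.
  rewrite ler_wpM2r// /e mulrCA ger_pMr// ler_pdivrMr// mul1r.
  by rewrite lerDl.
Qed.

End matrix_kernels.

(** * Coercive multiplication minus a symmetric weakly singular operator *)

Section coercive.
Context {disp} {T : measurableType disp} {R : realType} {d : nat}.
Variable nu : {finite_measure set T -> \bar R}.
Implicit Types (t K : T -> T -> 'M[R]_d) (u v w f : T -> 'cV[R]_d).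

Definition mxmeas t :=
  forall i j, measurable_fun setT (fun z : T * T => t z.1 z.2 i j).

(** Kernels that bounded kernels approximate in the norm of operators on bounded
functions. *)
Definition weakly_singular t := (exists M, mker nu t M) /\
  forall delta, 0 < delta -> exists t', [/\ mxmeas t',
    exists C, forall x y i j, `|t' x y i j| <= C &
    mker nu (fun x y => t x y - t' x y) delta].

(** With t' bounded and close to t, T^2 = T (T - T') + (T - T') T' + T'^2. *)
Lemma mop_sqr_nearly_finrank t : weakly_singular t ->
  nearly_finrank (fun w => mop nu t (mop nu t w)).
Proof.
move=> [[M kt] wt] eta eta0.
pose D : R := d%:R * d%:R * (2 * `|M| + 1) + 1.
have D0 : 0 < D by rewrite ltr_wpDl// !mulr_ge0// addr_ge0// mulr_ge0.
pose delta := Num.min 1 (eta / 2 / D).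
have delta0 : 0 < delta by rewrite lt_min ltr01 !divr_gt0.
have delta1 : delta <= 1 by rewrite ge_min lexx.
have deltaD : delta * D <= eta / 2 by rewrite -ler_pdivlMr// ge_min lexx orbT.
have [t' [mt' [C ht'] kd]] := wt _ delta0.
have [|F hF hTF] := mop_bounded_approx nu mt' mt' ht' ht' (eta := eta / 2).
  by rewrite divr_gt0.
exists F => //.
have bT : bop (mop nu t) (d%:R * `|M|).
  by apply: bop_mono (mop_bop kt) _; rewrite ler_wpM2l// ler_norm.
have bd := mop_bop kd.
have [M' kt'] : exists M', mker nu t' M'.
  by apply: mker_bounded => // i j; exists C => x y; exact: ht'.
have dE w x : vbm w ->
    mop nu (fun x y => t x y - t' x y) w x = mop nu t w x - mop nu t' w x.
  by move=> bw; exact: mopB kt kt' bw.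
have bT' : bop (mop nu t') (d%:R * `|M| + d%:R * delta).
  apply: (eq_bop (bop_sub bT bd)) => [w x bw|w m bw hw].
    by rewrite dE// opprB addrC subrK.
  exact: (bop_le (bop_sub bT bd)).
have h := bop_add (bop_add (bop_comp bT bd) (bop_comp bd bT')) hTF.
apply: (eq_bop h) => [w x bw|w m bw hw].
  rewrite (dE (mop nu t' w))//; last exact: (bop_vbm bT').
  rewrite (_ : mop nu (fun x y => t x y - t' x y) w =
    fun x => mop nu t w x - mop nu t' w x); last first.
    by apply/funext => y; exact: dE.
  rewrite (bopB bT); [|exact: (bop_vbm bT)|exact: (bop_vbm bT')].
  by rewrite !subrKA.
apply: (bop_le (bop_mono h _)) => //.
have e2 : eta = eta / 2 + eta / 2 by field.
rewrite [leRHS]e2 lerD2r; apply: le_trans deltaD.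
have d0 : 0 <= d%:R * d%:R :> R by rewrite mulr_ge0.
have dd : d%:R * d%:R * delta * delta <= d%:R * d%:R * delta.
  by rewrite ler_piMr// mulr_ge0// ltW.
rewrite /D; move: dd delta0; nra.
Qed.

Lemma vbm_ae0 w : vbm w -> \int[nu]_x dot (w x) (w x) = 0 ->
  {ae nu, forall x, w x = 0}.
Proof.
move=> bw w0.
have b : bmeas (fun x => dot (w x) (w x)).
  by apply: bmeas_sum => i; exact: bmeasM.
have i := bmeas_integrable nu b.
have : (\int[nu]_x `|(dot (w x) (w x))%:E| = 0)%E.
  rewrite (_ : (fun _ => _) = EFin \o (fun x => dot (w x) (w x))); last first.
    by apply/funext => x /=; rewrite ger0_norm// dotxx_ge0.
  rewrite -[LHS]fineK ?integrable_fin_num//.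
  by congr EFin.
move/(ae_eq_integral_abs nu measurableT (measurable_int _ i)).
by apply: filterS => x /(_ I) [] /dotxx_eq0.
Qed.

Lemma Rintegral_swap (h : T * T -> R) :
  (nu \x nu)%E.-integrable setT (EFin \o h) ->
  (forall x, nu.-integrable setT (fun y => (h (x, y))%:E)) ->
  (forall y, nu.-integrable setT (fun x => (h (x, y))%:E)) ->
  \int[nu]_x \int[nu]_y h (x, y) = \int[nu]_y \int[nu]_x h (x, y).
Proof.
move=> ih ix iy; rewrite /Rintegral; congr fine.
transitivity (\int[nu]_x \int[nu]_y (EFin \o h) (x, y))%E.
  by apply: eq_integral => x _; rewrite fineK// integrable_fin_num.
rewrite Fubini//; apply: eq_integral => y _.
by rewrite fineK// integrable_fin_num.
Qed.

Lemma kint_adjoint (k k' : T -> T -> R) M M' (a b : T -> R) :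
  ker nu k M -> ker nu k' M' -> (forall x y, k' x y = k y x) ->
  bmeas a -> bmeas b ->
  \int[nu]_x (kint nu k a x * b x) = \int[nu]_x (a x * kint nu k' b x).
Proof.
move=> kk kk' kE ba bb.
pose h (z : T * T) := k z.1 z.2 * a z.2 * b z.1.
have ix x : nu.-integrable setT (fun y => (h (x, y))%:E).
  have := integrableZl measurableT (b x) (kint_integrable x kk ba).
  by congr (_.-integrable _ _); apply/funext => y; rewrite -EFinM mulrC.
have iy y : nu.-integrable setT (fun x => (h (x, y))%:E).
  have := integrableZl measurableT (a y) (kint_integrable y kk' bb).
  congr (_.-integrable _ _); apply/funext => x; rewrite -EFinM kE /h /=.
  by congr EFin; ring.
have -> : \int[nu]_x (kint nu k a x * b x) = \int[nu]_x \int[nu]_y h (x, y).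
  apply: eq_Rintegral => x _; rewrite -RintegralZr//.
  exact: kint_integrable kk ba.
rewrite Rintegral_swap//.
  apply: eq_Rintegral => y _; rewrite -RintegralZl//; last first.
    exact: kint_integrable kk' bb.
  by apply: eq_Rintegral => x _; rewrite kE /h/=; ring.
have [mb [m hm]] := bb.
have := @integrableMl _ _ _ (nu \x nu)%E setT measurableT
  (fun z => (k z.1 z.2 * a z.2)%:E) (b \o fst) (kint_prod_integrable kk ba).
apply; first exact: (measurableT_comp mb measurable_fst).
by exists m; split=> [|M0 mM x _]; [exact: num_real|exact: le_trans (hm _) (ltW mM)].
Qed.

Lemma bmeas_dot u v : vbm u -> vbm v -> bmeas (fun x => dot (u x) (v x)).
Proof. by move=> bu bv; apply: bmeas_sum => i; exact: bmeasM. Qed.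

Lemma mop_sym K M u v : mker nu K M -> (forall x y, K y x = (K x y)^T) ->
  vbm u -> vbm v ->
  \int[nu]_x dot (mop nu K u x) (v x) = \int[nu]_x dot (u x) (mop nu K v x).
Proof.
move=> kK sK bu bv.
have bk i j w : vbm w ->
    bmeas (kint nu (fun x y => K x y i j) (fun y => w y j 0)).
  by move=> bw; exact: bmeas_kint (kK i j) (bw j).
transitivity (\int[nu]_x \sum_ij
    1 * (kint nu (fun x y => K x y ij.1 ij.2) (fun y => u y ij.2 0) x * v x ij.1 0)).
  apply: eq_Rintegral => x _; rewrite -(pair_bigA _ (fun i j =>
    1 * (kint nu (fun x y => K x y i j) (fun y => u y j 0) x * v x i 0)))/=.
  apply: eq_bigr => i _; rewrite mxE mulr_suml; apply: eq_bigr => j _.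
  by rewrite mul1r.
rewrite Rintegral_lincomb; last by move=> -[i j]; apply: bmeasM => //; exact: bk.
transitivity (\int[nu]_x \sum_ij
    1 * (u x ij.2 0 * kint nu (fun x y => K x y ij.2 ij.1) (fun y => v y ij.1 0) x)).
  rewrite Rintegral_lincomb; last by move=> -[i j]; apply: bmeasM => //; exact: bk.
  apply: eq_bigr => -[i j] _ /=; congr (1 * _).
  apply: (kint_adjoint (kK i j) (kK j i)) => // x y.
  by rewrite sK mxE.
apply: eq_Rintegral => x _; rewrite -(pair_bigA _ (fun i j =>
    1 * (u x j 0 * kint nu (fun x y => K x y j i) (fun y => v y i 0) x)))/=.
rewrite exchange_big; apply: eq_bigr => j _; rewrite mxE mulr_sumr.
by apply: eq_bigr => i _; rewrite mul1r.
Qed.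

Lemma measurable_det n (B : T -> 'M[R]_n) :
  (forall i j, measurable_fun setT (fun x => B x i j)) ->
  measurable_fun setT (fun x => \det (B x)).
Proof.
move=> mB; apply: measurable_sum => s; apply: measurable_funM => //.
by apply: measurable_prod => i _; exact: mB.
Qed.

(** By Cramer's rule the entries of the inverse are rational functions of those
of B. *)
Lemma measurable_invmx n (B : T -> 'M[R]_n) i j :
  (forall i j, measurable_fun setT (fun x => B x i j)) ->
  (forall x, B x \in unitmx) ->
  measurable_fun setT (fun x => invmx (B x) i j).
Proof.
move=> mB uB; rewrite (_ : (fun x => _) =
    fun x => (\det (B x))^-1 * (\adj (B x)) i j); last first.
  by apply/funext => x; rewrite /invmx uB mxE.
apply: measurable_funM; first exact: measurable_invr_comp (measurable_det mB).
under eq_fun do rewrite mxE /cofactor; apply: measurable_funM => //.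
apply: measurable_det => a b; under eq_fun do rewrite !mxE.
exact: mB.
Qed.

Lemma coercive_unitmx (B : 'M[R]_d) (gamma : R) : 0 < gamma ->
  (forall z : 'cV[R]_d, gamma * dot z z <= dot (B *m z) z) -> B \in unitmx.
Proof.
move=> g0 hB; rewrite unitmxE unitfE; apply/negP => /eqP detB.
have /det0P[v v0 hv] : \det B^T == 0 by rewrite det_tr detB.
have Bv : B *m v^T = 0.
  by apply: (can_inj trmxK); rewrite trmx_mul trmxK hv trmx0.
have := hB v^T; rewrite Bv dot0l pmulr_rle0// => h.
have /dotxx_eq0 vT : dot v^T v^T = 0 by apply/eqP; rewrite eq_le h dotxx_ge0.
by move: v0; rewrite -(trmxK v) vT trmx0 eqxx.
Qed.

Lemma coercive_invmx_le (B : 'M[R]_d) (gamma : R) i j : 0 < gamma ->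
  (forall z : 'cV[R]_d, gamma * dot z z <= dot (B *m z) z) -> `|invmx B i j| <= gamma^-1.
Proof.
move=> g0 hB; have uB := coercive_unitmx g0 hB.
pose e : 'cV[R]_d := delta_mx j 0; pose v := invmx B *m e.
have ve : v i 0 = invmx B i j by rewrite /v /e -colE mxE.
have e1 : enorm e = 1.
  rewrite /enorm /dot (bigD1 j)//= big1 => [|k kj].
    by rewrite addr0 mxE !eqxx mulr1 sqrtr1.
  by rewrite mxE (negbTE kj) mul0r.
have := hB v; rewrite {2}/v mulKVmx// -sqr_enorm => h.
rewrite -ve; apply: le_trans (coord_le_enorm v i) _.
have [->|v0] := eqVneq (enorm v) 0; first by rewrite invr_ge0 ltW.
have {}v0 : 0 < enorm v by rewrite lt_def v0 enorm_ge0.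
have := le_trans h (le_trans (ler_norm _) (normr_dot_le e v)).
by rewrite e1 mul1r expr2 mulrA ger_pMl// -ler_pdivlMl// mulr1.
Qed.

Lemma dot_mulmx_sym (B : 'M[R]_d) (a b : 'cV[R]_d) : B^T = B ->
  dot (B *m a) b = dot a (B *m b).
Proof.
have dotE (x y : 'cV[R]_d) : dot x y = (x^T *m y) 0 0.
  by rewrite mxE; apply: eq_bigr => i _; rewrite mxE.
by move=> sB; rewrite !dotE trmx_mul sB mulmxA.
Qed.

Section solve.
Variables (A : T -> 'M[R]_d) (K : T -> T -> 'M[R]_d) (gamma : R).
Hypothesis mA : forall i j, measurable_fun setT (fun x => A x i j).
Hypothesis symA : forall x, (A x)^T = A x.
Hypothesis gamma0 : 0 < gamma.
Hypothesis coA : forall x (z : 'cV[R]_d), gamma * dot z z <= dot (A x *m z) z.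
Hypothesis wK : weakly_singular K.
Hypothesis symK : forall x y, K y x = (K x y)^T.
Hypothesis inj : forall w, vbm w -> (forall x, A x *m w x = mop nu K w x) ->
  {ae nu, forall x, w x = 0}.

Let uA x : A x \in unitmx. Proof. exact: coercive_unitmx (coA x). Qed.

Let t x y := invmx (A x) *m K x y.

Let mulmx_ker K' M : mker nu K' M ->
  mker nu (fun x y => invmx (A x) *m K' x y) (d%:R * (gamma^-1 * M)).
Proof.
move=> kK i j.
have mt l : measurable_fun setT (fun z : T * T => invmx (A z.1) i l * K' z.1 z.2 l j).
  apply: measurable_funM; last exact: (kK l j).1.
  by apply: (measurableT_comp (measurable_invmx i l mA uA)); exact: measurable_fst.
split.
  by under eq_fun do rewrite mxE; exact: measurable_sum.
move=> x.
have mKx l := ker_measurable x (kK l j).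
apply: (@le_trans _ _ (\int[nu]_y (\sum_(l < d) (gamma^-1)%:E * `|K' x y l j|%:E))%E).
  apply: ge0_le_integral => //.
  - apply/measurable_EFinP; apply: measurableT_comp => //.
    under eq_fun do rewrite mxE; apply: measurable_sum => l.
    exact: measurable_funM.
  - apply: emeasurable_sum => l.
    apply/(measurable_EFinP setT (fun y => gamma^-1 * `|K' x y l j|)).
    by apply: measurable_funM => //; exact: measurableT_comp.
  - move=> y _; rewrite mxE sumEFin lee_fin.
    apply: le_trans (ler_norm_sum _ _ _) _; apply: ler_sum => l _.
    rewrite normrM ler_wpM2r//.
    exact: coercive_invmx_le.
have g1 : 0 <= gamma^-1 by rewrite invr_ge0 ltW.
rewrite ge0_integral_sum//; last 2 first.
- move=> l; apply/(measurable_EFinP setT (fun y => gamma^-1 * `|K' x y l j|)).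
  by apply: measurable_funM => //; exact: measurableT_comp.
- by move=> l y _; rewrite -EFinM lee_fin mulr_ge0.
rewrite mulr_natl -[X in _ *+ X]card_ord -sumr_const -sumEFin.
apply: lee_sum => l _; rewrite ge0_integralZl_EFin//; last first.
  by apply/measurable_EFinP; exact: measurableT_comp.
by rewrite EFinM lee_wpmul2l ?lee_fin//; exact: (kK l j).2.
Qed.

Let wt : weakly_singular t.
Proof.
have [[M kK] aK] := wK; split.
  by exists (d%:R * (gamma^-1 * M)); exact: mulmx_ker.
move=> delta delta0.
have D0 : 0 < d%:R * gamma^-1 + 1.
  by rewrite ltr_wpDl// mulr_ge0// invr_ge0 ltW.
have [|K' [mK' [C hC] kd]] := aK (delta / (d%:R * gamma^-1 + 1)).
  by rewrite divr_gt0.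
exists (fun x y => invmx (A x) *m K' x y); split.
- move=> i j; under eq_fun do rewrite mxE; apply: measurable_sum => l.
  apply: measurable_funM; last exact: mK'.
  by apply: (measurableT_comp (measurable_invmx i l mA uA)); exact: measurable_fst.
- exists (\sum_(l < d) gamma^-1 * C) => x y i j; rewrite mxE.
  apply: le_trans (ler_norm_sum _ _ _) _; apply: ler_sum => l _.
  rewrite normrM ler_pM//; exact: coercive_invmx_le.
- have := mulmx_ker kd => h i j; have [mh hh] := h i j.
  have E x y : (t x y - invmx (A x) *m K' x y) = invmx (A x) *m (K x y - K' x y).
    by rewrite mulmxBr.
  split; first by under eq_fun do rewrite E.
  move=> x; under eq_integral do rewrite E.
  apply: le_trans (hh x) _; rewrite lee_fin mulrA mulrCA ger_pMr//.
  by rewrite ler_pdivrMr// mul1r lerDl.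
Qed.

Let kK : exists M, mker nu K M. Proof. exact: wK.1. Qed.

Let T_E w x : vbm w -> mop nu t w x = invmx (A x) *m mop nu K w x.
Proof.
move=> bw; have [M kM] := kK; apply/colP => i; rewrite !mxE.
under [RHS]eq_bigr do rewrite mxE mulr_sumr.
rewrite exchange_big; apply: eq_bigr => j _ /=.
rewrite /kint; under eq_Rintegral do rewrite mxE mulr_suml.
transitivity (\int[nu]_y (\sum_(l < d) invmx (A x) i l * (K x y l j * w y j 0))).
  by apply: eq_Rintegral => y _; apply: eq_bigr => l _; rewrite mulrA.
have ik l : nu.-integrable setT (EFin \o (fun y => K x y l j * w y j 0)).
  exact: kint_integrable (kM l j) (bw j).
by rewrite Rintegral_sumZ// => l; exact: ik.
Qed.

(** A is an inner product for which T = A^-1 K is symmetric, so 1 + T + T^2 is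
positive and 1 - T^3 = (1 + T + T^2)(1 - T) is as injective as 1 - T. The cube is
within a small operator of a finite rank one, which decides solvability of
(1 - T^3) w = f, hence of (1 - T) w = f. *)
Theorem coercive_fredholm : exists C, forall f m, vbm f -> vle f m ->
  exists w, [/\ vbm w, vle w (C * m) &
    forall x, A x *m w x - mop nu K w x = f x].
Proof.
have [M kM] := kK; have [[M' kt] _] := wt.
have bT := mop_bop kt; have bK := mop_bop kM.
pose S := mop nu t; rewrite -/S in bT.
have AS w x : vbm w -> A x *m S w x = mop nu K w x.
  by move=> bw; rewrite /S T_E// mulKVmx.
have bS w : vbm w -> vbm (S w) by exact: (bop_vbm bT).
have S0 w : vbm w -> {ae nu, forall x, w x = 0} -> forall x, S w x = 0.
  move=> bw w0 x; rewrite -(bop0 bT x).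
  exact: (eq_ae_mop x kt bw vbm0).
(* Positivity of 1 + T + T^2. *)
have pos v : vbm v -> (forall x, v x + S v x + S (S v) x = 0) -> forall x, v x = 0.
  move=> bv hv; pose p := S v; pose kv := mop nu K v; pose kp := mop nu K p.
  have bp : vbm p by exact: bS.
  have bkv : vbm kv by exact: (bop_vbm bK).
  have bkp : vbm kp by exact: (bop_vbm bK).
  have Av x : A x *m v x = - kv x - kp x.
    rewrite /kv /kp -!AS// -mulmxN -mulmxBr; congr (_ *m _).
    by apply/eqP; rewrite -subr_eq0 opprD !opprK addrA hv.
  have q_ge x : 2^-1 * gamma * dot (v x) (v x) <= dot (p x) (kv x) - dot (kp x) (v x).
    have Ap : A x *m p x = kv x by exact: AS.
    have h1 := coA x (v x); have h2 := coA x (p x).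
    have h3 := le_trans (mulr_ge0 (ltW gamma0) (dotxx_ge0 (v x + p x)))
      (coA x (v x + p x)).
    have h4 : dot (A x *m v x) (p x) = dot (v x) (kv x).
      by rewrite dot_mulmx_sym// Ap.
    have h5 := mulr_ge0 (ltW gamma0) (dotxx_ge0 (p x)).
    have h6 : dot (A x *m v x) (v x) = - dot (kv x) (v x) - dot (kp x) (v x).
      by rewrite Av dotBl dotNl.
    move: h2 h3; rewrite mulmxDr dotDl !dotDr Ap h4.
    rewrite (dotC (v x) (kv x)) (dotC (p x) (kv x)) => h2 h3.
    by move: h1; rewrite h6 in h3 *; lra.
  have ae : {ae nu, forall x, v x = 0}.
    apply: vbm_ae0 => //; apply/eqP; rewrite eq_le; apply/andP; split; last first.
      by apply: Rintegral_ge0 => x _; exact: dotxx_ge0.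
    have bvv := bmeas_dot bv bv.
    have i0 := bmeas_integrable nu (bmeasZ (2^-1 * gamma) bvv).
    have i1 := bmeas_integrable nu (bmeas_dot bp bkv).
    have i2 := bmeas_integrable nu (bmeas_dot bkp bv).
    have i12 := bmeas_integrable nu
      (bmeasD (bmeas_dot bp bkv) (bmeasN (bmeas_dot bkp bv))).
    have := le_Rintegral measurableT i0 i12 (fun x _ => q_ge x).
    rewrite (RintegralB measurableT i1 i2).
    rewrite (RintegralZl _ measurableT (bmeas_integrable nu bvv)).
    rewrite (mop_sym kM symK bp bv) subrr pmulr_rle0// mulr_gt0//.
  have Sv : S v = fun=> 0 by apply/funext; exact: S0.
  by move=> x; have := hv x; rewrite Sv (bop0 bT) !addr0.
have nS : nearly_finrank (fun w => S (S (S w))).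
  apply: (nearly_finrank_comp bT (mop_sqr_nearly_finrank wt)) => w bw.
  exact: (bS _ (bS _ bw)).
have [w bw hw|C hC] := fredholm_nearly_finrank nS.
  pose v x := w x - S w x.
  have bv : vbm v by apply: vbmB => //; exact: bS.
  have Sv : S v = fun x => S w x - S (S w) x.
    by apply/funext => x; rewrite (bopB bT)//; exact: bS.
  have v0 : forall x, v x = 0.
    apply: pos => // x; rewrite Sv (bopB bT); [|exact: bS|exact: (bS _ (bS _ bw))].
    by rewrite /v !subrKA -hw subrr.
  have wS x : w x = S w x by apply/eqP; rewrite -subr_eq0; apply/eqP; exact: v0.
  have ae : {ae nu, forall x, w x = 0}.
    by apply: inj => // x; rewrite {1}wS AS.
  by move=> x; rewrite wS; exact: S0.
pose c := d%:R * M'.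
exists ((1 + c + c * c) * (C * (d%:R * gamma^-1))) => f m bf hf.
pose f' x := invmx (A x) *m f x.
have bf' : vle f' (d%:R * gamma^-1 * m).
  move=> x i; rewrite mxE; apply: le_trans (ler_norm_sum _ _ _) _.
  rewrite -mulrA mulr_natl -[X in _ *+ X]card_ord -sumr_const.
  apply: ler_sum => l _; rewrite normrM ler_pM//; first exact: coercive_invmx_le.
have vf' : vbm f'.
  move=> i; split; last by exists (d%:R * gamma^-1 * m) => x; exact: bf'.
  under eq_fun do rewrite mxE; apply: measurable_sum => l.
  by apply: measurable_funM; [exact: measurable_invmx|exact: (bf l).1].
have [w0 [bw0 hw0 Ew0]] := hC f' _ vf' bf'.
pose w x := w0 x + S w0 x + S (S w0) x.
have bSw := bS _ bw0; have bSSw := bS _ bSw.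
have bw : vbm w by apply: vbmD => //; exact: vbmD.
exists w; split => //.
  move=> x i; rewrite 2!mxE !mulrDl mul1r.
  have h0 := hw0 x i; have h1 := bop_le bT bw0 hw0.
  have h2 := bop_le bT bSw h1.
  apply: le_trans (ler_normD _ _) _; apply: lerD.
    apply: le_trans (ler_normD _ _) _; apply: lerD.
      by apply: le_trans h0 _; rewrite !mulrA.
    by apply: le_trans (h1 x i) _; rewrite /c !mulrA.
  by apply: le_trans (h2 x i) _; rewrite /c !mulrA.
move=> x; rewrite -AS// -mulmxBr.
have -> : w x - S w x = f' x.
  rewrite -Ew0 (_ : S w x = S w0 x + S (S w0) x + S (S (S w0)) x); last first.
    by rewrite (bopD bT)//; [rewrite (bopD bT)|exact: vbmD].
  have lin (a b c' e : 'cV[R]_d) : a + b + c' - (b + c' + e) = a - e.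
    by apply/colP => i; rewrite !mxE; ring.
  exact: lin.
by rewrite mulKVmx.
Qed.

End solve.

End coercive.

(** * Almost everywhere strain-free fields are rigid motions *)

Section rigidity.
Context {R : realType} {d : nat}.
Local Notation mu := (lebesgue_cV R d).
Implicit Types (x y z p : 'cV[R]_d) (w : 'cV[R]_d -> 'cV[R]_d).

Lemma ae_pick (P U : set 'cV[R]_d) : {ae mu, forall x, P x} -> open U ->
  U !=set0 -> exists2 x, U x & P x.
Proof.
move=> [N [mN N0 PN]] oU U0; apply: contrapT => h.
have mU := open_cV_measurable oU.
have : (mu U <= mu N)%E.
  apply: le_measure; rewrite ?inE// => x Ux; apply: PN => /= Px.
  by apply: h; exists x.
by rewrite N0 leNgt open_lebesgue_gt0.
Qed.

Lemma ae_translate (P : set 'cV[R]_d) a : {ae mu, forall x, P x} ->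
  {ae mu, forall x, P (x + a)}.
Proof.
move=> [N [mN N0 PN]]; exists ((fun x => x + a) @^-1` N); split.
- by rewrite -[X in measurable X]setTI; exact: measurable_translate.
- by rewrite lebesgue_cV_translate.
- by move=> x /= Px; exact: PN.
Qed.

(** Finitely many generic points in a prescribed relative position. *)
Lemma ae_pick_translates (I : finType) (a : I -> 'cV[R]_d) (P U : set 'cV[R]_d) :
  {ae mu, forall x, P x} -> open U -> U !=set0 ->
  exists2 x, U x & forall i, P (x + a i).
Proof.
move=> aeP oU U0; apply: ae_pick => //.
by apply: filter_forall => i; exact: ae_translate.
Qed.

Definition unitv (i : 'I_d) : 'cV[R]_d := delta_mx i 0.

Lemma dot_unitv v i : dot v (unitv i) = v i 0.
Proof.
rewrite /dot (bigD1 i)//= big1 => [|j ji].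
  by rewrite mxE !eqxx mulr1 addr0.
by rewrite mxE (negbTE ji) mulr0.
Qed.

Lemma mulmx_unitv (M : 'M[R]_d) i j : (M *m unitv j) i 0 = M i j.
Proof. by rewrite -colE mxE. Qed.

(** Second differences turn an almost everywhere vanishing quadratic form into the
vanishing of its polar form. *)
Lemma quadratic_ae0 (M : 'M[R]_d) (U : set 'cV[R]_d) : open U -> U !=set0 ->
  {ae mu, forall v, U v -> dot (M *m v) v = 0} -> M^T = - M.
Proof.
move=> oU [v0 Uv0] h.
have [r r0 rU] := open_subset_cube oU Uv0.
pose s := r / 4; have s0 : 0 < s by rewrite divr_gt0.
have unit_le i k : `|unitv i k 0| <= 1.
  by rewrite mxE; case: (_ && _); rewrite ?normr1 ?normr0.
apply/matrixP => i j; rewrite !mxE.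
(* The corners of the parallelogram spanned by s e_i and s e_j. *)
pose a (bc : bool * bool) : 'cV[R]_d :=
  (s * bc.1%:R) *: unitv i + (s * bc.2%:R) *: unitv j.
have [|v Uv hv] := ae_pick_translates a h (@open_cube _ _ v0 _ s0).
  by exists v0; exact: cube_center.
have hin bc : U (v + a bc).
  apply: rU => k; have := Uv k; rewrite !mxE => h1.
  rewrite (_ : _ - _ = (v k 0 - v0 k 0) +
    (s * bc.1%:R * unitv i k 0 + s * bc.2%:R * unitv j k 0)); last first.
    by rewrite /unitv !mxE; ring.
  apply: le_lt_trans (ler_normD _ _) _.
  apply: le_lt_trans (lerD (lexx _) (ler_normD _ _)) _.
  have e (b : bool) l : `|s * b%:R * unitv l k 0| <= s.
    rewrite -mulrA normrM (gtr0_norm s0) ger_pMr// normrM mulr_ile1//.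
    by case: b; rewrite ?normr1 ?normr0.
  have := e bc.1 i; have := e bc.2 j; move: h1; rewrite /s; lra.
have q bc := hv bc (hin bc).
have := q (true, true); have := q (true, false); have := q (false, true).
have := q (false, false); rewrite /a /= !mulr1n !mulr0n !mulr1 !mulr0 !scale0r !addr0 !add0r.
rewrite !mulmxDr -!scalemxAr !dotDl !dotDr !dotZl !dotZr !dot_unitv.
rewrite !mulmx_unitv => q1 q2 q3 q4.
have s2 : s * s * (M i j + M j i) = 0 by lra.
have /eqP := s2; rewrite mulf_eq0 (gt_eqF (mulr_gt0 s0 s0))/= addr_eq0 => /eqP ->.
by rewrite opprK.
Qed.

(** Generic vertices of a small simplex with edges along the axes. *)
Definition simplex_edge (s : R) (o : option 'I_d) : 'cV[R]_d :=
  if o is Some i then s *: unitv i else 0.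

Lemma ae_pick_simplex (P U : set 'cV[R]_d) z : {ae mu, forall x, P x} -> open U ->
  U z -> exists p s, 0 < s /\
    forall o, U (p + simplex_edge s o) /\ P (p + simplex_edge s o).
Proof.
move=> hP oU Uz; have [r r0 rU] := open_subset_cube oU Uz.
pose s := r / 2; have s0 : 0 < s by rewrite divr_gt0.
have [|p Up hp] := ae_pick_translates (simplex_edge s) hP (@open_cube _ _ z _ s0).
  by exists z; exact: cube_center.
exists p, s; split=> // o; split=> //; apply: rU => k; have h3 := Up k.
have h4 : `|simplex_edge s o k 0| <= s.
  case: o => [i|]; last by rewrite mxE normr0 ltW.
  rewrite mxE normrM gtr0_norm// ger_pMr// mxE.
  by case: (_ && _); rewrite ?normr1 ?normr0.
rewrite mxE addrAC; apply: le_lt_trans (ler_normD _ _) _.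
by move: h3 h4; rewrite /s; lra.
Qed.

Definition rigid_on (U : set 'cV[R]_d) w (Q : 'M[R]_d) (c : 'cV[R]_d) :=
  {ae mu, forall y, U y -> w y = Q *m y + c}.

(** d + 1 affinely independent generic points of the overlap determine an affine
map. *)
Lemma rigid_on_unique (U1 U2 : set 'cV[R]_d) w Q1 c1 Q2 c2 :
  open U1 -> open U2 -> U1 `&` U2 !=set0 ->
  rigid_on U1 w Q1 c1 -> rigid_on U2 w Q2 c2 -> Q1 = Q2 /\ c1 = c2.
Proof.
move=> o1 o2 [z [z1 z2]] h1 h2.
have [p [s [s0 hp]]] := ae_pick_simplex (filterI h1 h2) (openI o1 o2) (conj z1 z2).
have E o : Q1 *m (p + simplex_edge s o) + c1 = Q2 *m (p + simplex_edge s o) + c2.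
  have [[u1 u2] [g1 g2]] := hp o.
  by rewrite -g1// -g2.
have QQ : Q1 = Q2.
  apply/matrixP => i j.
  have := E (Some j); have := E None; rewrite /= addr0 !mulmxDr => /colP/(_ i) e0.
  move=> /colP/(_ i); rewrite -!scalemxAr; move: e0; rewrite !mxE => e0 e1.
  have : s * (Q1 *m unitv j) i 0 = s * (Q2 *m unitv j) i 0.
    by rewrite !mxE; lra.
  by rewrite !mulmx_unitv => /mulfI; apply; rewrite gt_eqF.
split=> //; have := E None; rewrite QQ; exact: addrI.
Qed.

Section strain_free.
Variables (Omega : set 'cV[R]_d) (eps : R) (w : 'cV[R]_d -> 'cV[R]_d).
Hypotheses (oO : open Omega) (eps0 : 0 < eps).
Hypothesis free : {ae mu, forall x, Omega x -> {ae mu, forall y, Omega y ->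
  enorm (y - x) < eps -> dot (w y - w x) (y - x) = 0}}.

(** Strain-freeness with respect to d + 1 points p and p + s e_i expresses s w_i(y)
as an affine function of y. *)
Lemma locally_rigid z : Omega z -> exists r Q c,
  [/\ 0 < r, cube z r `<=` Omega, Q^T = - Q & rigid_on (cube z r) w Q c].
Proof.
move=> Oz; have [r1 r10 r1O] := open_subset_cube oO Oz.
(* Any two points of the cube are at distance less than eps. *)
pose r := Num.min r1 (eps / (2 * d.+1%:R)).
have r0 : 0 < r by rewrite lt_min r10 divr_gt0// mulr_gt0.
have rO : cube z r `<=` Omega.
  by move=> y hy; apply: r1O => i; apply: lt_le_trans (hy i) _; rewrite ge_min lexx.
have near x y : cube z r x -> cube z r y -> enorm (y - x) < eps.
  move=> hx hy; apply: le_lt_trans (enorm_le_norm _) _.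
  have re : r <= eps / (2 * d.+1%:R) by rewrite ge_min lexx orbT.
  have xy : `|y - x| <= 2 * r.
    apply/cV_norm_leP => [|i]; first by rewrite mulr_ge0// ltW.
    rewrite !mxE (_ : y i 0 - x i 0 = (y i 0 - z i 0) - (x i 0 - z i 0)); last by ring.
    apply: le_trans (ler_normB _ _) _; rewrite mulr_natl mulr2n.
    by apply: lerD; exact/ltW.
  apply: (@le_lt_trans _ _ (d%:R * (2 * r))); first by rewrite ler_wpM2l.
  apply: (@lt_le_trans _ _ (d.+1%:R * (2 * r))).
    by rewrite ltr_pM2r ?mulr_gt0// ltr_nat.
  by rewrite mulrA -ler_pdivlMl ?mulr_gt0// mulrC (mulrC d.+1%:R).
have [p [s [s0 hp]]] := ae_pick_simplex free (@open_cube _ _ z _ r0) (cube_center z r0).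
pose wi i := w (p + s *: unitv i).
pose Q : 'M[R]_d := \matrix_(i, j) (s^-1 * (w p j 0 - wi i j 0)).
pose c : 'cV[R]_d := \col_i (s^-1 * (dot (wi i) (p + s *: unitv i) - dot (w p) p)).
have wQ : rigid_on (cube z r) w Q c.
  have : {ae mu, forall y, forall o, Omega y ->
      enorm (y - (p + simplex_edge s o)) < eps ->
      dot (w y - w (p + simplex_edge s o)) (y - (p + simplex_edge s o)) = 0}.
    by apply: filter_forall => o; have [/rO zo] := hp o; exact.
  apply: filterS => y hy zy; apply/colP => i.
  have h0 := hy None (rO _ zy) (near _ _ (hp None).1 zy).
  have h1 := hy (Some i) (rO _ zy) (near _ _ (hp (Some i)).1 zy).
  rewrite /= addr0 in h0; rewrite /= -/(wi i) in h1.
  have Qy : (Q *m y) i 0 = s^-1 * (dot (w p) y - dot (wi i) y).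
    rewrite mxE /dot -sumrB mulr_sumr; apply: eq_bigr => j _.
    by rewrite mxE -mulrA mulrBl.
  rewrite mxE Qy mxE -mulrDr; apply: (mulfI (_ : s != 0)); first by rewrite gt_eqF.
  rewrite mulrA mulfV ?gt_eqF// mul1r.
  move: h0 h1; rewrite !(dotBl, dotBr, dotDr, dotZr, dot_unitv); lra.
exists r, Q, c; split => //.
have [|x Ux [hx wx]] := ae_pick (filterI free wQ) (@open_cube _ _ z _ r0).
  by exists z; exact: cube_center.
have [r2 r20 r2U] := open_subset_cube (@open_cube _ _ z _ r0) Ux.
apply: (@quadratic_ae0 _ (cube 0 r2)); first exact: open_cube.
  by exists 0; exact: cube_center.
have h : {ae mu, forall v, (cube z r (v + x) -> w (v + x) = Q *m (v + x) + c) /\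
    (Omega (v + x) -> enorm (v + x - x) < eps ->
     dot (w (v + x) - w x) (v + x - x) = 0)}.
  exact: (ae_translate x (filterI wQ (hx (rO _ Ux)))).
apply: filterS h => v [h1 h2] hv.
have zv : cube z r (v + x).
  by apply: r2U => i; have := hv i; rewrite !mxE subr0 addrK.
have := h2 (rO _ zv) (near _ _ Ux zv).
rewrite h1// wx// addrK opprD addrACA subrr addr0 -mulmxBr addrK.
by [].
Qed.

(** The points near which w is the rigid motion found at one point z0, and those
near which it is another one, form two disjoint open sets. *)
Theorem strain_free_rigid : connected Omega -> exists Q c,
  Q^T = - Q /\ rigid_on Omega w Q c.
Proof.
move=> cO; have [[z0 Oz0]|O0] := pselect (Omega !=set0); last first.
  exists 0, 0; split; first by rewrite trmx0 oppr0.
  by apply: nearW => x Ox; exfalso; apply: O0; exists x.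
have [r0 [Q [c [r00 _ sQ hQ]]]] := locally_rigid Oz0.
exists Q, c; split=> //.
pose G (X : 'M[R]_d -> 'cV[R]_d -> Prop) z :=
  exists r Q' c', [/\ 0 < r, rigid_on (cube z r) w Q' c' & X Q' c'].
have oG X : open (G X).
  rewrite openE => z [r [Q' [c' [rp hr XQ]]]]; rewrite /interior.
  apply: (@filterS _ _ _ (cube z r)); last first.
    by rewrite cube_ball//; exact: nbhsx_ballx.
  move=> y zy; have [r' r'0 r'r] := open_subset_cube (@open_cube _ _ z _ rp) zy.
  exists r', Q', c'; split=> //.
  by apply: filterS hr => v hv yv; apply: hv; exact: r'r.
pose E := G (fun Q' c' => Q' = Q /\ c' = c).
pose F := G (fun Q' c' => ~ (Q' = Q /\ c' = c)).
have EF z : E z -> F z -> False.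
  move=> [r [Q1 [c1 [rp hr [EQ Ec]]]]] [r' [Q' [c' [r'p hr' ne]]]]; apply: ne.
  rewrite EQ Ec in hr.
  apply: (rigid_on_unique _ _ _ hr' hr); try exact: open_cube.
  by exists z; split; exact: cube_center.
have EorF z : Omega z -> E z \/ F z.
  move=> Oz; have [r [Q' [c' [rp _ _ h]]]] := locally_rigid Oz.
  by have [?|?] := pselect (Q' = Q /\ c' = c); [left|right]; exists r, Q', c'.
have OE : Omega `&` E = Omega.
  apply: cO; first by exists z0; split=> //; exists r0, Q, c.
    by exists E => //; exact: oG.
  exists (~` F); first by apply: open_closedC; exact: oG.
  apply/seteqP; split=> z [Oz h]; split=> //; first by move=> /(EF _ h).
  by case: (EorF z Oz).
pose N := [set x | Omega x /\ w x <> Q *m x + c].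
have nN : mu.-negligible N.
  apply: locally_negligible => x [Ox _].
  have [_ [r [Q1 [c1 [rp hr [EQ Ec]]]]]] : (Omega `&` E) x by rewrite OE.
  rewrite EQ Ec in hr.
  exists (cube x r); split; [exact: open_cube|exact: cube_center|].
  apply: negligibleS hr => y [xy [_ ne]] /= h; apply: ne; exact: h.
by apply: negligibleS nN => x /= /not_implyP[].
Qed.

End strain_free.

End rigidity.

(** * Interior cones carry a uniform amount of interaction *)

Section cone.
Context {R : realType} {d : nat}.
Local Notation mu := (lebesgue_cV R d).
Implicit Types (x y z e v : 'cV[R]_d).

Lemma acos_lt (s theta : R) : 0 < theta -> theta <= pi -> cos theta < s -> s <= 1 ->
  acos s < theta.
Proof.
move=> t0 tpi cs s1.
have hs : -1 <= s <= 1 by rewrite s1 andbT (le_trans (cos_geN1 theta))// ltW.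
have ts : theta \in `[0, pi] by rewrite in_itv/= (ltW t0).
have as_ : acos s \in `[0, pi] by rewrite in_itv/= acos_ge0// acos_lepi.
by rewrite -(ltr_cos as_ ts) acosK.
Qed.

(** Near x + t e both the distance to x and the component along e of the
displacement are close to t, so that the cosine of the angle is close to 1. *)
Lemma cone_ball (lambda theta : R) : 0 < lambda -> 0 < theta ->
  exists t rho, [/\ 0 < rho, rho < t, t + rho < lambda &
    forall x e, enorm e = 1 ->
      eball (x + t *: e) rho `<=` spherical_cone x e lambda theta].
Proof.
move=> l0 th0.
pose th := Num.min theta 1.
have th0' : 0 < th by rewrite lt_min th0 ltr01.
have th1 : th <= 1 by rewrite ge_min lexx orbT.
have thpi : th <= pi by apply: le_trans th1 _; have := pi_ge2 R; lra.
pose k := cos th.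
have k1 : k < 1.
  have z0 : 0 \in `[0, pi : R] by rewrite in_itv/= lexx pi_ge0.
  have zt : th \in `[0, pi] by rewrite in_itv/= (ltW th0').
  by rewrite -(@cos0 R) /k ltr_cos.
have kN1 : -1 <= k by exact: cos_geN1.
(* With rho = t sg this gives (t + rho) cos th < t - rho. *)
pose sg := (1 - k) / 4.
have sg0 : 0 < sg by rewrite divr_gt0// subr_gt0.
have sg1 : sg <= 2^-1 by rewrite /sg; lra.
pose t := lambda / 2; pose rho := t * sg.
have t0 : 0 < t by rewrite divr_gt0.
have rho0 : 0 < rho by rewrite mulr_gt0.
have rhot : rho <= t / 2 by rewrite /rho ler_pM2l.
exists t, rho; split=> //.
- by move: rhot t0; lra.
- by move: rhot t0; rewrite /t; lra.
move=> x e e1 y; rewrite /eball/= => hy.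
set q := y - (x + t *: e) in hy.
have yx : y - x = t *: e + q by apply/colP => i; rewrite /q !mxE; ring.
have zle : enorm (y - x) <= t + rho.
  rewrite yx; apply: le_trans (enormD_le _ _) _.
  by rewrite enormZ e1 mulr1 (gtr0_norm t0) lerD2l ltW.
have dz : t - rho <= dot (y - x) e.
  rewrite yx dotDl dotZl -sqr_enorm e1 expr1n mulr1 lerD2l.
  have := normr_dot_le q e; rewrite e1 mulr1 => h.
  have := le_trans (ler_norm _) h; have := lerNnormlW h.
  by move: hy; lra.
have z0 : 0 < enorm (y - x).
  have := le_trans (ler_norm _) (normr_dot_le (y - x) e); rewrite e1 mulr1 => h.
  apply: lt_le_trans h; apply: lt_le_trans dz; move: rhot t0; lra.
split; first by apply: le_lt_trans zle _; move: rhot t0; rewrite /t; lra.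
apply: (@lt_le_trans _ _ th); last by rewrite ge_min lexx.
apply: acos_lt => //.
- rewrite /dir dotZl -/k ltr_pdivlMl//.
  apply: lt_le_trans dz.
  have [k0|k0] := leP k 0.
    apply: (@le_lt_trans _ _ 0); first by rewrite mulr_ge0_le0// ltW.
    by move: rhot t0; lra.
  apply: (@le_lt_trans _ _ ((t + rho) * k)); first by rewrite ler_pM2r.
  have s1 : sg * (1 + k) < sg * 4 by rewrite ltr_pM2l//; lra.
  have s4 : sg * 4 = 1 - k by rewrite /sg; field.
  rewrite /rho (_ : (t + t * sg) * k = t * (k + sg * k)); last by ring.
  rewrite (_ : t - t * sg = t * (1 - sg)); last by ring.
  by rewrite ltr_pM2l//; lra.
- rewrite /dir dotZl ler_pdivrMl// mulr1.
  have := le_trans (ler_norm _) (normr_dot_le (y - x) e); rewrite e1 mulr1; exact.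
Qed.

Lemma measurable_influence_le (J : R -> R) (eps delta : R) : influence_function J ->
  measurable [set z : 'cV[R]_d | eball 0 eps z /\ J (enorm z / eps) <= delta].
Proof.
move=> hJ.
have mJ : measurable_fun setT (fun z : 'cV[R]_d => J (enorm z / eps)).
  apply: (measurableT_comp (influence_measurable hJ)).
  apply: measurable_funM => //; apply: measurable_enorm => i.
  exact: measurable_coord.
have m1 : measurable ((fun z : 'cV[R]_d => J (enorm z / eps)) @^-1` `]-oo, delta]).
  by rewrite -[X in measurable X]setTI; exact: mJ.
rewrite (_ : [set z | _] = eball 0 eps `&` ((fun z => J (enorm z / eps)) @^-1` `]-oo, delta])).
  by apply: measurableI => //; exact: measurable_eball.
by apply/seteqP; split=> z /=; rewrite in_itv.
Qed.

(** J is positive inside the ball, so its sublevel sets there shrink to the empty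
set. *)
Lemma influence_small_set (J : R -> R) (eps eta : R) : influence_function J ->
  0 < eps -> 0 < eta -> exists2 delta, 0 < delta &
    (mu [set z | eball 0 eps z /\ (J (enorm z / eps) <= delta)%R] <= eta%:E)%E.
Proof.
move=> hJ eps0 eta0.
pose B (n : nat) := [set z | eball 0 eps z /\ J (enorm z / eps) <= n.+1%:R^-1] : set 'cV[R]_d.
have mB n : measurable (B n) by exact: measurable_influence_le.
have finB : (mu (B 0%N) < +oo)%E.
  apply: (@le_lt_trans _ _ (mu (cube 0 eps))).
    apply: le_measure; rewrite ?inE//; first exact: measurable_cube.
    by move=> z [/eball_cube].
  by rewrite lebesgue_cV_cube// ltry.
have ndB : {homo B : n m / (n <= m)%N >-> (m <= n)%O}.
  move=> n m nm; apply/subsetPset => z [zb zJ]; split=> //.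
  by apply: le_trans zJ _; rewrite lef_pV2 ?posrE// ler_nat.
have B0 : \bigcap_n B n = set0.
  apply/seteqP; split=> z // h; have [zb _] := h 0%N I.
  have J0 : 0 < J (enorm z / eps).
    apply: (influence_gt0 hJ); first by rewrite divr_ge0 ?enorm_ge0// ltW.
    by move: zb; rewrite /eball/= subr0 ltr_pdivrMr// mul1r.
  have [n hn] := ltr_add_invr J0.
  have [_] := h n I; rewrite leNgt; move: hn; rewrite add0r => ->.
  by [].
have cB := nonincreasing_cvg_mu finB mB (bigcapT_measurable mB) ndB.
rewrite B0 measure0 in cB.
have /fine_cvgP[fB /cvgr_dist_lt/(_ _ eta0) hB] := cB.
have [n _ /(_ n (leqnn n))/= [fn hn]] := filterI fB hB.
exists n.+1%:R^-1; first by rewrite invr_gt0.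
move: hn; rewrite sub0r normrN => hn.
by rewrite -[leLHS](fineK fn) lee_fin; apply: le_trans (ler_norm _) (ltW hn).
Qed.

Lemma measureB_le (A B : set 'cV[R]_d) (a b : R) : measurable A -> measurable B ->
  mu A = a%:E -> (mu B <= b%:E)%E -> ((a - b)%:E <= mu (A `\` B))%E.
Proof.
move=> mA mB muA muB; have fA : (mu A < +oo)%E by rewrite muA ltry.
have -> : mu (A `\` B) = (mu A - mu (A `&` B))%E by exact: measureD.
rewrite muA EFinB leeB//; apply: le_trans muB.
by apply: le_measure; rewrite ?inE//; exact: measurableI.
Qed.

(** Part of the ball inside a cone lies far from the hyperplane orthogonal to v, and
the influence function is bounded below there off a set of small measure; both
facts are translation invariant, hence uniform in x. *)
Lemma uniform_mass (Omega : set 'cV[R]_d) (J : R -> R) (eps : R) :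
  interior_cone_condition Omega -> influence_function J -> 0 < eps ->
  exists delta rho m0, [/\ 0 < delta, 0 < rho, 0 < m0 &
    forall x v, Omega x -> v != 0 -> exists S, [/\ measurable S,
      (m0%:E <= mu S)%E & forall y, S y -> [/\ Omega y, eball x eps y,
        delta < J (enorm (y - x) / eps) & rho * enorm v <= `|dot (y - x) v| ]]].
Proof.
move=> [lambda [theta [l0 th0 hcone]]] hJ eps0.
have l'0 : 0 < Num.min lambda eps by rewrite lt_min l0.
have [t [rho [rho0 rhot trho hball]]] := cone_ball l'0 th0.
(* The cube of half-side h lies in a ball of radius rho / 4. *)
pose h := rho / 4 / d.+1%:R.
have h0 : 0 < h by rewrite !divr_gt0.
(* Half the volume of the cube; the other half is left for the points at which J is
small. *)
pose m0 := (2 * h) ^+ d / 2.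
have m00 : 0 < m0 by rewrite divr_gt0// exprn_gt0// mulr_gt0.
have [delta delta0 hdelta] := influence_small_set hJ eps0 m00.
exists delta, (rho / 4), m0; split=> //; first by rewrite divr_gt0.
move=> x v Ox v0; have [e [e1 he]] := hcone x Ox.
have nv := enorm_gt0 v0.
(* The shift q goes to the side of the hyperplane on which t e lies already, so
that the two distances add up. *)
pose sgn : R := if 0 <= dot (t *: e) v then 1 else -1.
have sgn1 : `|sgn| = 1 by rewrite /sgn; case: ifP; rewrite ?normrN normr1.
pose q := (sgn * (rho / 2) / enorm v) *: v.
pose z1 := t *: e + q.
have qn : enorm q = rho / 2.
  rewrite enormZ normrM normrM sgn1 mul1r ger0_norm; last by rewrite divr_ge0// ltW.
  by rewrite normfV (gtr0_norm nv) mulfVK// gt_eqF.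
have z1v : rho / 2 * enorm v <= `|dot z1 v|.
  have qv : dot q v = sgn * (rho / 2 * enorm v).
    by rewrite dotZl -sqr_enorm expr2; field; rewrite gt_eqF.
  have pos : 0 <= rho / 2 * enorm v by rewrite mulr_ge0 ?divr_ge0// ltW.
  rewrite dotDl qv /sgn; case: (leP 0 (dot (t *: e) v)) => hs.
    by rewrite mul1r ger0_norm ?addr_ge0// lerDr.
  by rewrite mulN1r ler0_norm; lra.
pose B := [set y | eball x eps y /\ J (enorm (y - x) / eps) <= delta].
have mB0 := measurable_influence_le eps delta hJ.
have BE : B = (fun y => y + (- x)) @^-1`
    [set z | eball 0 eps z /\ J (enorm z / eps) <= delta].
  by apply/seteqP; split=> y; rewrite /B /eball /= subr0.
have mB : measurable B.
  by rewrite BE -[X in measurable X]setTI; exact: measurable_translate.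
have muB : (mu B <= m0%:E)%E by rewrite BE lebesgue_cV_translate.
exists (cube (x + z1) h `\` B); split.
- by apply: measurableD => //; exact: measurable_cube.
- have := measureB_le (measurable_cube _ _) mB (lebesgue_cV_cube (x + z1) h0) muB.
  by apply: le_trans; rewrite lee_fin /m0; lra.
move=> y [yc yB].
have r4 : 0 < rho / 4 by rewrite divr_gt0.
have := cube_eball r4 yc; rewrite /eball/= => yb.
have yq : y - x = z1 + (y - (x + z1)) by apply/colP => i; rewrite !mxE; ring.
have ybig : eball (x + t *: e) rho y.
  rewrite /eball/= (_ : y - _ = q + (y - (x + z1))); last first.
    by apply/colP => i; rewrite /z1 !mxE; ring.
  by apply: le_lt_trans (enormD_le _ _) _; rewrite qn; move: yb rho0; lra.
have [yl yth] := hball x e e1 y ybig.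
have yeps : eball x eps y by apply: lt_le_trans yl _; rewrite ge_min lexx orbT.
split => //.
- by apply: he; split=> //; apply: lt_le_trans yl _; rewrite ge_min lexx.
- by rewrite ltNge; apply/negP => hle; apply: yB.
- rewrite yq dotDl; apply: le_trans (lerB_normD _ _).
  have := normr_dot_le (y - (x + z1)) v => h1.
  have h2 : enorm (y - (x + z1)) * enorm v <= rho / 4 * enorm v.
    by rewrite ler_wpM2r ?enorm_ge0// ltW.
  by move: z1v h1 h2; lra.
Qed.

End cone.

(** * Restriction to a set of finite measure; kernels dominated by 1/|y - x| *)

Section weakly_singular_sub.
Context {disp} {T : measurableType disp} {R : realType} {d : nat}.
Variable nu : {finite_measure set T -> \bar R}.

Lemma kerB (k1 k2 : T -> T -> R) M1 M2 : ker nu k1 M1 -> ker nu k2 M2 ->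
  ker nu (fun x y => k1 x y - k2 x y) (M1 + M2).
Proof.
move=> h1 h2; split; first by apply: measurable_funB; [exact: h1.1|exact: h2.1].
move=> x; have m1 := ker_measurable x h1; have m2 := ker_measurable x h2.
apply: (@le_trans _ _ (\int[nu]_y (`|k1 x y|%:E + `|k2 x y|%:E))%E).
  apply: ge0_le_integral => //.
  - apply/measurable_EFinP; apply: measurableT_comp => //.
    exact: measurable_funB.
  - apply: emeasurable_funD; apply/measurable_EFinP; exact: measurableT_comp.
  - by move=> y _; rewrite -EFinD lee_fin ler_normB.
rewrite ge0_integralD//; last 2 first.
- by apply/measurable_EFinP; exact: measurableT_comp.
- by apply/measurable_EFinP; exact: measurableT_comp.
by rewrite EFinD leeD//; [exact: h1.2|exact: h2.2].
Qed.

Lemma weakly_singularB (k p : T -> T -> 'M[R]_d) : weakly_singular nu k ->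
  mxmeas p -> (exists C, forall x y i j, `|p x y i j| <= C) ->
  weakly_singular nu (fun x y => k x y - p x y).
Proof.
move=> [[M kM] wk] mp [C hC].
have [M' kp] : exists M', mker nu p M'.
  by apply: mker_bounded => // i j; exists C => x y; exact: hC.
split.
  exists (M + M') => i j; have [h1 h2] := kerB (kM i j) (kp i j).
  split; first by under eq_fun do rewrite !mxE.
  by move=> x; under eq_integral do rewrite !mxE; exact: h2.
move=> delta delta0; have [t [mt [C' hC'] kd]] := wk _ delta0.
exists (fun x y => t x y - p x y); split.
- move=> i j; under eq_fun do rewrite !mxE.
  by apply: measurable_funB; [exact: mt|exact: mp].
- exists (C' + C) => x y i j; rewrite !mxE; apply: le_trans (ler_normB _ _) _.
  exact: lerD.
- move=> i j; have E x y : k x y - p x y - (t x y - p x y) = k x y - t x y.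
    by apply/matrixP => a b; rewrite !mxE; ring.
  have [h1 h2] := kd i j; split; first by under eq_fun do rewrite E.
  by move=> x; under eq_integral do rewrite E; exact: h2.
Qed.

End weakly_singular_sub.

Section restriction.
Context {R : realType} {d : nat}.
Local Notation mu := (lebesgue_cV R d).
Variables (Omega : set 'cV[R]_d) (mO : measurable Omega) (fO : (mu Omega < +oo)%E).

(** Lebesgue measure carried by Omega, as a finite measure on the whole space, so
that fields on Omega need no type of their own. *)
Definition domain_measure : {finite_measure set 'cV[R]_d -> \bar R} :=
  mfrestr mO fO.
Local Notation nu := domain_measure.

Lemma integral_domain (f : 'cV[R]_d -> \bar R) : (forall y, ~ Omega y -> f y = 0%E) ->
  (\int[nu]_y f y = \int[mu]_(y in Omega) f y)%E.
Proof.
move=> f0; transitivity (\int[nu]_(y in Omega) f y)%E.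
  rewrite [RHS]integral_mkcond; apply: eq_integral => y _.
  by rewrite patchE; case: ifPn => // /negP yO; apply: f0; rewrite inE in yO.
apply: eq_measure_integral => A mA AO.
by transitivity (mu (A `&` Omega)); rewrite // setIidl.
Qed.

Lemma ae_domain (P : set 'cV[R]_d) :
  {ae nu, forall x, P x} <-> {ae mu, forall x, Omega x -> P x}.
Proof.
split=> -[N [mN N0 PN]].
  exists (N `&` Omega); split; [exact: measurableI|exact: N0|].
  by move=> x /not_implyP[Ox Px]; split=> //; exact: PN.
exists (N `|` ~` Omega); split.
- by apply: measurableU => //; exact: measurableC.
- rewrite -[LHS]/(mu ((N `|` ~` Omega) `&` Omega)) setIUl setICl setU0.
  have : (mu (N `&` Omega) <= mu N)%E.
    by apply: le_measure; rewrite ?inE//; exact: measurableI.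
  by rewrite N0 => h; apply/eqP; rewrite eq_le h measure_ge0.
- move=> x /= Px; have [Ox|] := pselect (Omega x); last by right.
  by left; apply: PN => /= h; apply: Px; exact: h.
Qed.

Lemma Rintegral_domain (f : 'cV[R]_d -> R) : measurable_fun setT f ->
  \int[nu]_y f y = \int[mu]_(y in Omega) f y.
Proof.
move=> mf; rewrite [RHS]Rintegral_mkcond /Rintegral; congr fine.
have mf' : measurable_fun setT (f \_ Omega).
  by apply/(measurable_restrictT f mO); exact: measurable_funTS.
rewrite (@ae_eq_integral _ _ _ nu setT (EFin \o (f \_ Omega)) (EFin \o f))//.
- rewrite integral_domain; last by move=> y yO /=; rewrite patchE memNset.
  rewrite [LHS]integral_mkcond; apply: eq_integral => y _.
  by rewrite /= !patchE; case: ifP => yO //=; rewrite patchE yO.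
- exact/measurable_EFinP.
- exact/measurable_EFinP.
- have : {ae nu, forall x, Omega x} by apply/ae_domain; exact: nearW.
  by apply: filterS => x Ox _ /=; rewrite patchE mem_set.
Qed.

Lemma measurable_pairB i :
  measurable_fun setT (fun z : 'cV[R]_d * 'cV[R]_d => (z.2 - z.1) i 0).
Proof.
under eq_fun do rewrite !mxE.
by apply: measurable_funB; apply: (measurableT_comp (measurable_coord i));
  [exact: measurable_snd|exact: measurable_fst].
Qed.

Lemma measurable_dist :
  measurable_fun setT (fun z : 'cV[R]_d * 'cV[R]_d => enorm (z.2 - z.1)).
Proof. by apply: measurable_enorm => i; exact: measurable_pairB. Qed.

Let near_mass x r : (1 < d)%N -> 0 < r -> r <= 1 ->
  (\int[mu]_(y in Omega) (\1_(eball x r) y * (enorm (y - x))^-1)%:E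
   <= (2 ^+ d.+2 * r)%:E)%E.
Proof.
move=> d2 r0 r1; apply: le_trans (integral_inv_enorm x d2 r0 r1).
have meb : measurable (eball x r) by exact: measurable_eball.
have mi : measurable_fun setT (fun y : 'cV[R]_d => (enorm (y - x))^-1).
  by apply: measurable_invr_comp; exact: measurable_enormB.
apply: (@le_trans _ _ (\int[mu]_y (\1_(eball x r) y * (enorm (y - x))^-1)%:E)%E).
  apply: ge0_subset_integral => //.
  - apply/measurable_EFinP/measurable_funM => //; exact: measurable_indic.
  - by move=> y _; rewrite lee_fin mulr_ge0// invr_ge0 enorm_ge0.
rewrite [leRHS]integral_mkcond le_eqVlt; apply/orP; left; apply/eqP.
apply: eq_integral => y _; rewrite patchE indicE.
by case: (y \in _); rewrite ?mul1r ?mul0r.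
Qed.

(** The part of the kernel near the diagonal is small in operator norm and the
rest is bounded. *)
Lemma riesz_weakly_singular (k : 'cV[R]_d -> 'cV[R]_d -> 'M[R]_d) C : (1 < d)%N ->
  0 <= C -> mxmeas k -> (forall x y, ~ Omega y -> k x y = 0) ->
  (forall x y i j, `|k x y i j| <= C * (enorm (y - x))^-1) ->
  weakly_singular nu k.
Proof.
move=> d2 C0 mk k0 hk.
have mkx x i j : measurable_fun setT (fun y => k x y i j).
  exact: (measurable_fun_pair2 (f := fun z => k z.1 z.2 i j) x).
have mnear x r : measurable_fun setT
    (fun y => \1_(eball x r) y * (enorm (y - x))^-1 : R).
  apply: measurable_funM; first by apply: measurable_indic; exact: measurable_eball.
  by apply: measurable_invr_comp; exact: measurable_enormB.
have mnE x r : measurable_fun Omega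
    (fun y => (\1_(eball x r) y * (enorm (y - x))^-1)%:E).
  by apply/measurable_EFinP; apply: measurable_funTS; exact: mnear.
have mCn x r : measurable_fun Omega
    (fun y => C%:E * (\1_(eball x r) y * (enorm (y - x))^-1)%:E)%E.
  apply/(measurable_EFinP Omega (fun y => C * (\1_(eball x r) y * (enorm (y - x))^-1))).
  by apply: measurable_funM => //; apply: measurable_funTS; exact: mnear.
have near0 x r y : 0 <= \1_(eball x r) y * (enorm (y - x))^-1 :> R.
  by rewrite mulr_ge0// invr_ge0 enorm_ge0.
have fin_O : mu Omega \is a fin_num by rewrite ge0_fin_numE.
split.
  exists (C * (2 ^+ d.+2 * 1) + C * fine (mu Omega)) => i j; split => // x.
  rewrite integral_domain; last by move=> y yO; rewrite k0// mxE normr0.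
  apply: (@le_trans _ _ (\int[mu]_(y in Omega)
     (C%:E * (\1_(eball x 1) y * (enorm (y - x))^-1)%:E + C%:E))%E).
    apply: ge0_le_integral => //.
    - by apply/measurable_EFinP; apply: measurableT_comp => //; exact: measurable_funTS.
    - exact: emeasurable_funD.
    - move=> y _; rewrite -EFinM -EFinD lee_fin; apply: le_trans (hk x y i j) _.
      rewrite indicE; case: (boolP (y \in _)) => yx; first by rewrite mul1r lerDl.
      rewrite mul0r mulr0 add0r ler_piMr//.
      have : 1 <= enorm (y - x).
        by rewrite leNgt; apply/negP => h; move: yx; rewrite notin_setE; apply.
      by move=> h; rewrite invf_le1//; lra.
  rewrite ge0_integralD//; last by move=> y _; rewrite -EFinM lee_fin mulr_ge0.
  rewrite EFinD; apply: leeD.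
    rewrite ge0_integralZl_EFin//; last by move=> y _; rewrite lee_fin.
    by rewrite EFinM lee_wpmul2l ?lee_fin//; exact: near_mass.
  by rewrite integral_cst// EFinM fineK.
move=> delta delta0.
have D0 : 0 < C * 2 ^+ d.+2 + 1 by rewrite ltr_wpDl// mulr_ge0// exprn_ge0.
pose r := Num.min 1 (delta / (C * 2 ^+ d.+2 + 1)).
have r0 : 0 < r by rewrite lt_min ltr01 divr_gt0.
have r1 : r <= 1 by rewrite ge_min lexx.
have rD : r * (C * 2 ^+ d.+2 + 1) <= delta by rewrite -ler_pdivlMr// ge_min lexx orbT.
exists (fun x y => if enorm (y - x) < r then 0 else k x y); split.
- move=> i j.
  rewrite (_ : (fun z => _) = fun z => if enorm (z.2 - z.1) < r then 0 else k z.1 z.2 i j).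
    apply: measurable_fun_ifT => //.
    by apply: measurable_fun_ltr => //; exact: measurable_dist.
  by apply/funext => z; case: ifP => //; rewrite mxE.
- exists (C / r) => x y i j; case: ltP => yr.
    by rewrite mxE normr0 divr_ge0// ltW.
  apply: le_trans (hk x y i j) _; rewrite ler_wpM2l// lef_pV2// posrE.
  exact: lt_le_trans yr.
have hd x y i j : `|(k x y - (if enorm (y - x) < r then 0 else k x y)) i j| <=
    C * (\1_(eball x r) y * (enorm (y - x))^-1).
  rewrite indicE; case: ifP => yr.
    by rewrite subr0 mem_set// mul1r.
  by rewrite subrr mxE normr0 mulr_ge0// mulr_ge0// invr_ge0 enorm_ge0.
move=> i j; split.
  under eq_fun do rewrite mxE; apply: measurable_funD => //.
  rewrite (_ : (fun z => _) = fun z => if enorm (z.2 - z.1) < r then 0 else - k z.1 z.2 i j).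
    apply: measurable_fun_ifT => //; last exact: measurableT_comp.
    by apply: measurable_fun_ltr => //; exact: measurable_dist.
  by apply/funext => z; case: ifP => _; rewrite !mxE ?oppr0.
move=> x; rewrite integral_domain; last first.
  by move=> y yO; rewrite k0//; case: ifP => _; rewrite subrr mxE normr0.
apply: (@le_trans _ _ (\int[mu]_(y in Omega)
   (C%:E * (\1_(eball x r) y * (enorm (y - x))^-1)%:E))%E).
  apply: ge0_le_integral => //.
  - apply/measurable_EFinP; apply: measurableT_comp => //; apply: measurable_funTS.
    under eq_fun do rewrite mxE; apply: measurable_funD => //.
    rewrite (_ : (fun y => _) = fun y => if enorm (y - x) < r then 0 else - k x y i j).
      apply: measurable_fun_ifT => //; last exact: measurableT_comp.
      by apply: measurable_fun_ltr => //; exact: measurable_enormB.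
    by apply/funext => z; case: ifP => _; rewrite !mxE ?oppr0.
  - by move=> y _; rewrite -EFinM lee_fin; exact: hd.
rewrite ge0_integralZl_EFin//; last by move=> y _; rewrite lee_fin.
apply: (@le_trans _ _ (C%:E * (2 ^+ d.+2 * r)%:E)%E).
  by rewrite lee_wpmul2l ?lee_fin//; exact: near_mass.
rewrite -EFinM lee_fin; apply: le_trans rD.
have -> : r * (C * 2 ^+ d.+2 + 1) = C * (2 ^+ d.+2 * r) + r by ring.
by rewrite lerDl ltW.
Qed.

End restriction.

(** * Energy of antisymmetric fluxes *)

Section flux.
Context {disp} {T : measurableType disp} {R : realType}.
Variable nu : {finite_measure set T -> \bar R}.

Lemma ker_sum (I : Type) (r : seq I) (k : I -> T -> T -> R) (M : I -> R) :
  (forall i, ker nu (k i) (M i)) ->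
  ker nu (fun x y => \sum_(i <- r) k i x y) (\sum_(i <- r) M i).
Proof.
move=> hk; elim: r => [|i r IH].
  rewrite big_nil (_ : (fun x y => _) = fun _ _ => 0); last first.
    by apply/funext => x; apply/funext => y; rewrite big_nil.
  split=> // x; under eq_integral do rewrite normr0.
  by rewrite integral0.
rewrite big_cons (_ : (fun x y => _) =
    fun x y => k i x y - (\sum_(j <- r) - k j x y)); last first.
  by apply/funext => x; apply/funext => y; rewrite big_cons sumrN opprK.
apply: kerB => //; have [h1 h2] := IH; split.
  by under eq_fun do rewrite sumrN; exact: measurable_funN.
by move=> x; under eq_integral do rewrite sumrN normrN; exact: h2.
Qed.

Lemma Rintegral_eq0_ae (f : T -> R) : nu.-integrable setT (EFin \o f) ->
  (forall x, 0 <= f x) -> \int[nu]_x f x = 0 -> {ae nu, forall x, f x = 0}.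
Proof.
move=> i f0 h.
have : (\int[nu]_x `|(f x)%:E| = 0)%E.
  rewrite (_ : (fun _ => _) = EFin \o f); last first.
    by apply/funext => x /=; rewrite ger0_norm.
  by rewrite -[LHS]fineK ?integrable_fin_num//; congr EFin.
move/(ae_eq_integral_abs nu measurableT (measurable_int _ i)).
by apply: filterS => x /(_ I) [].
Qed.

Lemma eq_ae_Rintegral (f g : T -> R) : measurable_fun setT f ->
  measurable_fun setT g -> {ae nu, forall x, f x = g x} ->
  \int[nu]_x f x = \int[nu]_x g x.
Proof.
move=> mf mg h; rewrite /Rintegral; congr fine.
apply: ae_eq_integral => //; [exact/measurable_EFinP|exact/measurable_EFinP|].
by apply: filterS h => x /= ->.
Qed.

(** Action and reaction: an antisymmetric flux tested against b sees only the
differences of b. *)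
Lemma flux_energy (G : T -> T -> R) M (b : T -> R) : ker nu G M ->
  (forall x y, G y x = - G x y) -> bmeas b ->
  2 * \int[nu]_x (kint nu G (fun=> 1) x * b x) =
  \int[nu]_x kint nu (fun x y => G x y * (b x - b y)) (fun=> 1) x.
Proof.
move=> hG aG bb.
have hN : ker nu (fun x y => - G x y) M.
  split; first by apply: measurable_funN; exact: hG.1.
  by move=> x; under eq_integral do rewrite normrN; exact: hG.2.
have b1 : bmeas (fun _ : T => 1 : R) by exact: bmeas_cst.
have bG1 := bmeas_kint hG b1; have bGb := bmeas_kint hG bb.
have i1 := bmeas_integrable nu (bmeasM bG1 bb).
have i2 := bmeas_integrable nu bGb.
have E1 : \int[nu]_x (kint nu G (fun=> 1) x * b x) = - \int[nu]_x kint nu G b x.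
  rewrite (kint_adjoint hG hN (fun x y => esym (aG x y)) b1 bb).
  rewrite -mulN1r -(RintegralZl (-1) measurableT i2); apply: eq_Rintegral => x _.
  rewrite mul1r mulN1r /kint -mulN1r -RintegralZl//; last first.
    exact: kint_integrable hG bb.
  by apply: eq_Rintegral => y _; rewrite mulN1r mulNr.
rewrite mulr_natl mulr2n {2}E1 -RintegralB//.
apply: eq_Rintegral => x _; rewrite /kint -RintegralZr//; last first.
  exact: kint_integrable hG b1.
rewrite -RintegralB//.
- by apply: eq_Rintegral => y _; ring.
- have := integrableZl measurableT (b x) (kint_integrable x hG b1).
  by congr (_.-integrable _ _); apply/funext => y; rewrite /= -EFinM mulrC.
- exact: kint_integrable hG bb.
Qed.

End flux.

(** * The linear nonlocal elastic operator *)

Section elastic.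
Context {R : realType} {d : nat}.
Local Notation mu := (lebesgue_cV R d).
Variables (Omega : set 'cV[R]_d) (mO : measurable Omega) (fO : (mu Omega < +oo)%E).
Local Notation nu := (domain_measure mO fO).
Implicit Types (w phi : 'cV[R]_d -> 'cV[R]_d).
Variables (eps C gamma rO : R) (c : 'cV[R]_d -> 'cV[R]_d -> R).
Hypothesis d2 : (1 < d)%N.
Hypotheses (oO : open Omega) (cnO : connected Omega) (rO0 : 0 < rO).
Hypothesis OrO : Omega `<=` cube 0 rO.
Hypotheses (eps0 : 0 < eps) (gamma0 : 0 < gamma).
Hypothesis mc : measurable_fun setT (fun z : 'cV[R]_d * 'cV[R]_d => c z.1 z.2).
Hypothesis c_ge0 : forall x y, 0 <= c x y.
Hypothesis c_le : forall x y, c x y <= C.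
Hypothesis c_sym : forall x y, c y x = c x y.
Hypothesis c_out : forall x y, ~ Omega x -> c x y = 0.
Hypothesis c_gt0 : forall x y, Omega x -> Omega y -> y != x ->
  enorm (y - x) < eps -> 0 < c x y.

(** Springs of stiffness c act along the bonds: the force exerted by y on x is
k x y applied to w y - w x. *)
Definition elastic_kernel x y : 'M[R]_d :=
  (c x y * (enorm (y - x))^-1) *: (dir y x *m (dir y x)^T).
Local Notation k := elastic_kernel.

Definition elastic_tensor x : 'M[R]_d :=
  \matrix_(i, j) kint nu (fun x y => k x y i j) (fun=> 1) x.

Hypothesis coercive : forall x (v : 'cV[R]_d), Omega x ->
  gamma * dot v v <= dot (elastic_tensor x *m v) v.

Definition elastic (w : 'cV[R]_d -> 'cV[R]_d) x : 'cV[R]_d :=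
  elastic_tensor x *m w x - mop nu k w x.
Local Notation L := elastic.

Lemma dirN (x y : 'cV[R]_d) : dir x y = - dir y x.
Proof. by rewrite /dir -(opprB y x) enormN scalerN. Qed.

Lemma dir_le1 (x y : 'cV[R]_d) i : `|dir y x i 0| <= 1.
Proof.
rewrite mxE normrM normfV (ger0_norm (enorm_ge0 _)).
have [->|n0] := eqVneq (enorm (y - x)) 0; first by rewrite invr0 mul0r.
by rewrite ler_pdivrMl ?lt_def ?n0 ?enorm_ge0// mulr1 coord_le_enorm.
Qed.

Lemma elastic_kernelE x y i j :
  k x y i j = c x y * (enorm (y - x))^-1 * (dir y x i 0 * dir y x j 0).
Proof. by rewrite mxE mxE big_ord1 [in X in _ * (_ * X)]mxE. Qed.

Lemma elastic_kernel_sym x y : k y x = k x y.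
Proof.
apply/matrixP => i j; rewrite !elastic_kernelE c_sym (dirN y x).
by rewrite -(opprB y x) enormN !mxE mulrNN.
Qed.

Lemma elastic_kernel_tr x y : (k x y)^T = k x y.
Proof.
by apply/matrixP => i j; rewrite mxE !elastic_kernelE (mulrC (dir y x j 0)).
Qed.

Lemma elastic_kernel_mul x y (a : 'cV[R]_d) i :
  (k x y *m a) i 0 = c x y * (enorm (y - x))^-1 * dot (dir y x) a * dir y x i 0.
Proof.
rewrite mxE /dot mulr_sumr mulr_suml; apply: eq_bigr => j _.
by rewrite elastic_kernelE; ring.
Qed.

Lemma elastic_kernel_dot x y (a b : 'cV[R]_d) : dot (k x y *m a) b =
  c x y * (enorm (y - x))^-1 * (dot (dir y x) a * dot (dir y x) b).
Proof.
rewrite {1}/dot (eq_bigr (fun i => c x y * (enorm (y - x))^-1 * dot (dir y x) a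
   * (dir y x i 0 * b i 0))).
  by rewrite -mulr_sumr -/(dot (dir y x) b) !mulrA.
by move=> i _; rewrite elastic_kernel_mul !mulrA.
Qed.

Lemma measurable_dir i : measurable_fun setT
  (fun z : 'cV[R]_d * 'cV[R]_d => dir z.2 z.1 i 0).
Proof.
under eq_fun do rewrite mxE.
apply: measurable_funM; last exact: measurable_pairB.
by apply: measurable_invr_comp; exact: measurable_dist.
Qed.

Lemma elastic_kernel_mxmeas : mxmeas k.
Proof.
move=> i j; under eq_fun do rewrite elastic_kernelE.
apply: measurable_funM; last by apply: measurable_funM; exact: measurable_dir.
apply: measurable_funM => //.
by apply: measurable_invr_comp; exact: measurable_dist.
Qed.

Lemma elastic_kernel_out x y : ~ Omega y -> k x y = 0.
Proof. by move=> yO; rewrite /k -c_sym c_out// mul0r scale0r. Qed.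

Lemma elastic_kernel_singular : weakly_singular nu k.
Proof.
apply: (@riesz_weakly_singular _ _ _ _ _ _ C) => //.
- exact: le_trans (c_ge0 0 0) (c_le 0 0).
- exact: elastic_kernel_mxmeas.
- exact: elastic_kernel_out.
move=> x y i j; rewrite elastic_kernelE !normrM.
rewrite (ger0_norm (c_ge0 x y)) (ger0_norm (_ : 0 <= (enorm (y - x))^-1)); last first.
  by rewrite invr_ge0 enorm_ge0.
have h0 : 0 <= (enorm (y - x))^-1 by rewrite invr_ge0 enorm_ge0.
apply: (@le_trans _ _ (c x y * (enorm (y - x))^-1)).
  by rewrite ler_piMr ?mulr_ge0// mulr_ile1// dir_le1.
by rewrite ler_wpM2r.
Qed.

Let kM := cid elastic_kernel_singular.1.
Let M := projT1 kM.
Let hM : mker nu k M := projT2 kM.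

Let b1 : bmeas (fun _ : 'cV[R]_d => 1 : R). Proof. exact: bmeas_cst. Qed.

Lemma bmeas_tensor i j : bmeas (fun x => elastic_tensor x i j).
Proof. by under eq_fun do rewrite mxE; exact: bmeas_kint (hM i j) b1. Qed.

Lemma vbm_elastic w : vbm w -> vbm (L w).
Proof.
move=> bw; apply: vbmB; last exact: bop_vbm (mop_bop hM) _ bw.
move=> i; under eq_fun do rewrite mxE; apply: bmeas_sum => j.
by apply: bmeasM; [exact: bmeas_tensor|exact: bw].
Qed.

Let measurable_diff w i : vbm w -> measurable_fun setT
  (fun z : 'cV[R]_d * 'cV[R]_d => w z.1 i 0 - w z.2 i 0).
Proof.
move=> bw; apply: measurable_funB; apply: (measurableT_comp (bw i).1);
  [exact: measurable_fst|exact: measurable_snd].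
Qed.

Let flux w i x y : R := (k x y *m (w x - w y)) i 0.

Let flux_ker w i : vbm w -> exists M', ker nu (flux w i) M'.
Proof.
move=> bw; have [m m0 hm] := vbm_bound bw.
exists (\sum_(j < d) M * (m + m)).
rewrite (_ : flux w i = fun x y => \sum_(j < d) k x y i j * (w x j 0 - w y j 0)).
  apply: ker_sum => j; apply: ker_mul (hM i j) _ _; first exact: measurable_diff.
  by move=> x y; apply: le_trans (ler_normB _ _) _; rewrite lerD.
apply/funext => x; apply/funext => y; rewrite /flux mxE.
by apply: eq_bigr => j _; rewrite !mxE.
Qed.

(** The value a at x is kept apart from the integrated field w, so that w can be
modified on a null set. *)
Lemma elastic_flux_at w (a : 'cV[R]_d) x i : vbm w ->
  (elastic_tensor x *m a - mop nu k w x) i 0 =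
  \int[nu]_y (k x y *m (a - w y)) i 0.
Proof.
move=> bw; have ik j : bmeas (fun y => a j 0 - w y j 0).
  by apply: bmeasD; [exact: bmeas_cst|exact: bmeasN (bw j)].
transitivity (\sum_j 1 * \int[nu]_y (k x y i j * (a j 0 - w y j 0))).
  rewrite !mxE -sumrB; apply: eq_bigr => j _; rewrite mul1r.
  rewrite mxE /kint -RintegralZr//; last exact: kint_integrable (hM i j) b1.
  rewrite -RintegralB//.
  - by apply: eq_Rintegral => y _; ring.
  - have := integrableZl measurableT (a j 0) (kint_integrable x (hM i j) b1).
    by congr (_.-integrable _ _); apply/funext => y; rewrite /= -EFinM mulrC.
  - exact: kint_integrable (hM i j) (bw j).
rewrite -Rintegral_sumZ; last by move=> j; exact: kint_integrable (hM i j) (ik j).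
apply: eq_Rintegral => y _; rewrite [RHS]mxE; apply: eq_bigr => j _.
by rewrite mul1r; congr (_ * _); rewrite !mxE.
Qed.

Let elastic_flux w x i : vbm w -> L w x i 0 = kint nu (flux w i) (fun=> 1) x.
Proof.
move=> bw; rewrite /elastic elastic_flux_at//.
by apply: eq_Rintegral => y _; rewrite mulr1.
Qed.

Lemma elasticB w1 w2 x : vbm w1 -> vbm w2 ->
  L (fun x => w1 x - w2 x) x = L w1 x - L w2 x.
Proof.
move=> bw1 bw2; rewrite /elastic (bopB (mop_bop hM))// mulmxBr.
by rewrite !opprD !opprK addrACA.
Qed.

Lemma elastic_tensor_dot x (a b : 'cV[R]_d) :
  let density y := c x y * (enorm (y - x))^-1 *
    (dot (dir y x) a * dot (dir y x) b) in
  nu.-integrable setT (EFin \o density) /\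
  dot (elastic_tensor x *m a) b = \int[nu]_y density y.
Proof.
have dotE (B : 'M[R]_d) : dot (B *m a) b =
    \sum_(p : 'I_d * 'I_d) (a p.2 0 * b p.1 0) * B p.1 p.2.
  rewrite -(pair_bigA _ (fun i j => (a j 0 * b i 0) * B i j))/=.
  apply: eq_bigr => i _; rewrite mxE mulr_suml; apply: eq_bigr => j _.
  by rewrite -mulrA mulrC.
have E : (fun y => c x y * (enorm (y - x))^-1 *
      (dot (dir y x) a * dot (dir y x) b)) =
    fun y => \sum_(p : 'I_d * 'I_d) (a p.2 0 * b p.1 0) * k x y p.1 p.2.
  by apply/funext => y; rewrite -elastic_kernel_dot dotE.
rewrite /= E; split; last first.
  rewrite dotE Rintegral_sumZ => [|p]; last exact: ker_integrable (hM p.1 p.2).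
  apply: eq_bigr => p _; rewrite mxE; congr (_ * _).
  by apply: eq_Rintegral => y _; rewrite mulr1.
apply: (@ker_integrable _ _ _ nu (fun x y =>
  \sum_(p : 'I_d * 'I_d) (a p.2 0 * b p.1 0) * k x y p.1 p.2)
  (\sum_(p : 'I_d * 'I_d) M * `|a p.2 0 * b p.1 0|)).
under eq_fun do under eq_fun do under eq_bigr do rewrite mulrC.
by apply: ker_sum => p; apply: ker_mul (hM p.1 p.2) _ _.
Qed.

Definition energy_density w phi x y :=
  c x y * (enorm (y - x))^-1 *
  (dot (dir y x) (w x - w y) * dot (dir y x) (phi x - phi y)).

Let flux_diff_ker w phi : vbm w -> vbm phi -> exists F, forall i,
  ker nu (fun x y => flux w i x y * (phi x i 0 - phi y i 0)) (F i).
Proof.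
move=> bw bphi; have [m m0 hm] := vbm_bound bphi.
have /choice[F hF] := fun i => flux_ker i bw.
exists (fun i => F i * (m + m)) => i; apply: ker_mul (hF i) _ _.
  exact: measurable_diff.
by move=> x y; apply: le_trans (ler_normB _ _) _; rewrite lerD.
Qed.

Lemma energy_ker w phi : vbm w -> vbm phi ->
  exists M', ker nu (energy_density w phi) M'.
Proof.
move=> bw bphi; have [F hF] := flux_diff_ker bw bphi; exists (\sum_(i < d) F i).
rewrite (_ : energy_density w phi =
    fun x y => \sum_(i < d) flux w i x y * (phi x i 0 - phi y i 0)).
  exact: ker_sum.
apply/funext => x; apply/funext => y.
rewrite /energy_density -elastic_kernel_dot; apply: eq_bigr => i _.
by congr (_ * _); rewrite !mxE.
Qed.

(** The flux k x y (w x - w y) is antisymmetric in x and y. *)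
Lemma elastic_energy w phi : vbm w -> vbm phi ->
  2 * \int[nu]_x dot (L w x) (phi x) =
  \int[nu]_x kint nu (energy_density w phi) (fun=> 1) x.
Proof.
move=> bw bphi; have [F' hF'] := flux_diff_ker bw bphi.
have /choice[F hF] := fun i => flux_ker i bw.
have bL := vbm_elastic bw.
transitivity (\sum_i 1 * \int[nu]_x
    kint nu (fun x y => flux w i x y * (phi x i 0 - phi y i 0)) (fun=> 1) x).
  transitivity (2 * \sum_(i < d) 1 * \int[nu]_x (L w x i 0 * phi x i 0)).
    congr (2 * _); rewrite -Rintegral_lincomb; last by move=> i; exact: bmeasM.
    by apply: eq_Rintegral => x _; apply: eq_bigr => i _; rewrite mul1r.
  rewrite mulr_sumr; apply: eq_bigr => i _; rewrite !mul1r.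
  rewrite -(flux_energy (hF i))//.
    by congr (2 * _); apply: eq_Rintegral => x _; rewrite elastic_flux.
  by move=> x y; rewrite /flux elastic_kernel_sym -(opprB (w x)) mulmxN mxE.
rewrite -Rintegral_lincomb; last by move=> i; exact: bmeas_kint (hF' i) b1.
apply: eq_Rintegral => x _.
transitivity (\int[nu]_y (\sum_i 1 * (flux w i x y * (phi x i 0 - phi y i 0) * 1))).
  by rewrite Rintegral_sumZ// => i; exact: kint_integrable (hF' i) b1.
apply: eq_Rintegral => y _; rewrite mulr1 /energy_density -elastic_kernel_dot.
by apply: eq_bigr => i _; rewrite mul1r mulr1; congr (_ * _); rewrite !mxE.
Qed.

Lemma bmeas_elastic_dot w phi : vbm w -> vbm phi ->
  bmeas (fun x => dot (L w x) (phi x)).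
Proof. by move=> bw bphi; apply: bmeas_dot => //; exact: vbm_elastic. Qed.

Lemma energy_density_ge0 w x y : 0 <= energy_density w w x y.
Proof.
rewrite /energy_density -expr2; apply: mulr_ge0; last exact: sqr_ge0.
by rewrite mulr_ge0// invr_ge0 enorm_ge0.
Qed.

Lemma elastic_energy_ge0 w : vbm w -> 0 <= \int[nu]_x dot (L w x) (w x).
Proof.
move=> bw; rewrite -(pmulr_rge0 _ (ltr0n R 2)) elastic_energy//.
apply: Rintegral_ge0 => x _; apply: Rintegral_ge0 => y _.
by rewrite mulr1 energy_density_ge0.
Qed.

(** The energy density is nonnegative, hence zero almost everywhere, and c is
positive on the bonds shorter than eps. *)
Lemma elastic_energy_rigid w : vbm w -> \int[nu]_x dot (L w x) (w x) = 0 ->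
  exists Q b, Q^T = - Q /\ rigid_on Omega w Q b.
Proof.
move=> bw w0; apply: (@strain_free_rigid _ _ Omega eps w) => //.
have [M' hE] := energy_ker bw bw.
have b_E := bmeas_kint hE b1.
have E0 : \int[nu]_x kint nu (energy_density w w) (fun=> 1) x = 0.
  by rewrite -elastic_energy// w0 mulr0.
have := Rintegral_eq0_ae (bmeas_integrable nu b_E) _ E0.
have pos x : 0 <= kint nu (energy_density w w) (fun=> 1) x.
  by apply: Rintegral_ge0 => y _; rewrite mulr1 energy_density_ge0.
move=> /(_ pos)/ae_domain; apply: filterS => x hx Ox.
have := hx Ox; rewrite /kint => hx0.
have := Rintegral_eq0_ae (kint_integrable x hE b1) _ hx0.
have pos' y : 0 <= energy_density w w x y * 1.
  by rewrite mulr1 energy_density_ge0.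
move=> /(_ pos')/ae_domain; apply: filterS => y hy Oy xy.
have [->|yx] := eqVneq y x; first by rewrite subrr dot0l.
have nz : 0 < enorm (y - x) by rewrite enorm_gt0// subr_eq0.
have cxy := c_gt0 Ox Oy yx xy.
have := hy Oy; rewrite mulr1 => /eqP; rewrite !mulf_eq0 invr_eq0.
rewrite (gt_eqF cxy) (gt_eqF nz)/= orbb /dir dotZl mulf_eq0 invr_eq0 (gt_eqF nz)/=.
by move=> /eqP h; rewrite dotC -(opprB (w x)) dotNr h oppr0.
Qed.

(** Generators of the rigid motions: a rotation for each ordered pair of axes and
a translation for each axis. *)
Definition rigid_index := ('I_d * 'I_d + 'I_d)%type.

Definition rigid_gen (l : rigid_index) (x : 'cV[R]_d) : 'cV[R]_d :=
  match l with
  | inl (i, j) => x j 0 *: unitv i - x i 0 *: unitv j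
  | inr i => unitv i
  end.

Lemma rigid_gen_motion l : rigid_motions (rigid_gen l).
Proof.
case: l => [[i j]|i].
  exists (delta_mx i j - delta_mx j i), 0; split.
    by rewrite linearB/= !trmx_delta opprB.
  apply/funext => x; rewrite addr0 mulmxBl; apply/colP => a.
  have E (i' j' : 'I_d) : (delta_mx i' j' *m x) a 0 = x j' 0 * (a == i')%:R.
    rewrite mxE (bigD1 j')//= big1 ?addr0 => [|l lj].
      by rewrite mxE eqxx andbT mulrC.
    by rewrite mxE (negbTE lj) andbF mul0r.
  by rewrite [in RHS]mxE [X in _ = _ + X]mxE !E /= !mxE !eqxx !andbT.
exists 0, (unitv i); split; first by rewrite trmx0 oppr0.
by apply/funext => x; rewrite mul0mx add0r.
Qed.

(** The pairs (i, j) and (j, i) give opposite rotations, whence the factor 1/2. *)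
Lemma rigid_decomp (Q : 'M[R]_d) (b x : 'cV[R]_d) : Q^T = - Q ->
  Q *m x + b = \sum_(l : rigid_index)
    (match l with inl ij => 2^-1 * Q ij.1 ij.2 | inr i => b i 0 end)
    *: rigid_gen l x.
Proof.
move=> sQ; rewrite big_sumType/=; congr (_ + _); last first.
  apply/colP => a; rewrite summxE (bigD1 a)//= big1 ?addr0 => [|i ia].
    by rewrite !mxE !eqxx mulr1.
  by rewrite !mxE eq_sym (negbTE ia) mulr0.
have sQE i j : Q j i = - Q i j by have /matrixP/(_ i j) := sQ; rewrite !mxE.
rewrite (eq_bigr (fun ij : 'I_d * 'I_d => (2^-1 * Q ij.1 ij.2 * x ij.2 0) *: unitv ij.1
    - (2^-1 * Q ij.1 ij.2 * x ij.1 0) *: unitv ij.2)); last first.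
  by move=> [i j] _; rewrite /= scalerBr !scalerA.
rewrite sumrB -(pair_bigA _ (fun i j => (2^-1 * Q i j * x j 0) *: unitv i))/=.
rewrite -(pair_bigA _ (fun i j => (2^-1 * Q i j * x i 0) *: unitv j))/=.
rewrite [X in _ - X]exchange_big/= -sumrB.
apply/colP => a; rewrite summxE (bigD1 a)//= [X in _ = _ + X]big1 ?addr0; last first.
  move=> i ia; rewrite mxE [X in _ + X]mxE !summxE big1 ?big1 ?oppr0 ?addr0//;
    by move=> j _; rewrite !mxE eq_sym (negbTE ia) mulr0.
rewrite !mxE !summxE -sumrB; apply: eq_bigr => j _.
by rewrite !mxE !eqxx (sQE a j) /=; field.
Qed.

Definition rigid_gen_on l x : 'cV[R]_d := \1_Omega x *: rigid_gen l x.
Local Notation phi_ := rigid_gen_on.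

Lemma rigid_gen_in l x : Omega x -> phi_ l x = rigid_gen l x.
Proof. by move=> Ox; rewrite /phi_ indicE mem_set// scale1r. Qed.

Lemma vbm_rigid_gen l : vbm (phi_ l).
Proof.
have b_coord j : bmeas (fun x => \1_Omega x * x j 0 : R).
  split; first by apply: measurable_funM; [exact: measurable_indic|exact: measurable_coord].
  exists rO => x; rewrite indicE; case: (boolP (x \in _)) => xO.
    rewrite mul1r; have := OrO (set_mem xO) j.
    by rewrite mxE subr0 => /ltW.
  by rewrite mul0r normr0 ltW.
have b_ind : bmeas (\1_Omega : 'cV[R]_d -> R) by exact: bmeas_indic.
case: l => [[i j]|i] a.
  rewrite (_ : (fun x => _) = fun x => unitv i a 0 * (\1_Omega x * x j 0) -
     unitv j a 0 * (\1_Omega x * x i 0)); last first.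
    by apply/funext => x; rewrite /phi_ /rigid_gen ![in LHS]mxE /unitv; rewrite !mxE; ring.
  by apply: bmeasD; [exact: bmeasZ|apply: bmeasN; exact: bmeasZ].
rewrite (_ : (fun x => _) = fun x => unitv i a 0 * \1_Omega x); last first.
  by apply/funext => x; rewrite /phi_ /rigid_gen [in LHS]mxE mulrC.
exact: bmeasZ.
Qed.

(** Rigid motions carry no strain, so the total force and torque of L w vanish. *)
Lemma elastic_orthogonal w l : vbm w -> \int[nu]_x dot (L w x) (phi_ l x) = 0.
Proof.
move=> bw; have bp := vbm_rigid_gen l.
apply: (mulfI (_ : 2 != 0 :> R)); first by rewrite pnatr_eq0.
rewrite mulr0 elastic_energy//.
have [Q [b [sQ hQ]]] := rigid_gen_motion l.
have -> : \int[nu]_x kint nu (energy_density w (phi_ l)) (fun=> 1) x =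
    \int[nu]_x (0 : R).
  apply: eq_Rintegral => x _; rewrite /kint.
  rewrite (_ : \int[nu]_y _ = \int[nu]_y (0 : R)).
    by rewrite Rintegral_cst// mul0r.
  apply: eq_Rintegral => y _; rewrite mulr1 /energy_density.
  have [Ox|Ox] := pselect (Omega x); last by rewrite c_out// !mul0r.
  have [Oy|Oy] := pselect (Omega y); last by rewrite -c_sym c_out// !mul0r.
  rewrite !rigid_gen_in// hQ opprD addrACA subrr addr0 -mulmxBr.
  suff -> : dot (dir y x) (Q *m (x - y)) = 0 by rewrite !mulr0.
  rewrite -(opprB y x) mulmxN dotNr /dir dotZl; set v := y - x.
  have dotE (a e : 'cV[R]_d) : dot a e = (a^T *m e) 0 0.
    by rewrite mxE; apply: eq_bigr => i _; rewrite mxE.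
  have h : dot v (Q *m v) = - dot v (Q *m v).
    rewrite {1}dotC !dotE trmx_mul sQ mulmxN mulNmx mxE.
    by rewrite -mulmxA.
  have -> : dot v (Q *m v) = 0 by move: h; lra.
  by rewrite mulr0 oppr0.
by rewrite Rintegral_cst// mul0r.
Qed.

Definition rigid_coef w l : R := \int[nu]_x dot (phi_ l x) (w x).

(** A field of zero energy that is orthogonal to the rigid motions is itself a
rigid motion, hence orthogonal to itself. *)
Lemma elastic_zero w : vbm w -> \int[nu]_x dot (L w x) (w x) = 0 ->
  (forall l, rigid_coef w l = 0) -> {ae nu, forall x, w x = 0}.
Proof.
move=> bw w0 hl; have [Q [b [sQ hQ]]] := elastic_energy_rigid bw w0.
apply: vbm_ae0 => //.
pose cf (l : rigid_index) :=
  match l with inl ij => 2^-1 * Q ij.1 ij.2 | inr i => b i 0 end.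
transitivity (\int[nu]_x \sum_l cf l * dot (phi_ l x) (w x)).
  apply: eq_ae_Rintegral.
  - exact: (bmeas_dot bw bw).1.
  - apply: measurable_sum => l; apply: measurable_funM => //.
    exact: (bmeas_dot (vbm_rigid_gen l) bw).1.
  apply/ae_domain; apply: filterS hQ => x hx Ox.
  rewrite {1}hx// rigid_decomp// /dot.
  under [RHS]eq_bigr do rewrite mulr_sumr.
  rewrite exchange_big/=; apply: eq_bigr => i _.
  rewrite summxE mulr_suml; apply: eq_bigr => l _.
  by rewrite rigid_gen_in// mxE mulrA.
rewrite Rintegral_lincomb; last by move=> l; exact: bmeas_dot (vbm_rigid_gen l) bw.
by rewrite big1// => l _; rewrite -/(rigid_coef w l) hl mulr0.
Qed.

Definition rigid_kernel x y : 'M[R]_d := \sum_l phi_ l x *m (phi_ l y)^T.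
Local Notation p := rigid_kernel.

Lemma rigid_kernelE x y i j : p x y i j = \sum_l phi_ l x i 0 * phi_ l y j 0.
Proof.
rewrite summxE; apply: eq_bigr => l _.
by rewrite mxE big_ord1 [X in _ * X]mxE.
Qed.

Lemma rigid_kernel_mxmeas : mxmeas p.
Proof.
move=> i j; under eq_fun do rewrite rigid_kernelE; apply: measurable_sum => l.
by apply: measurable_funM; apply: (measurableT_comp (vbm_rigid_gen l _).1);
  [exact: measurable_fst|exact: measurable_snd].
Qed.

Lemma rigid_kernel_bounded : exists C', forall x y i j, `|p x y i j| <= C'.
Proof.
have /choice[m hm] : forall l, exists m, vle (phi_ l) m.
  by move=> l; have [m _ hm] := vbm_bound (vbm_rigid_gen l); exists m.
exists (\sum_l m l * m l) => x y i j; rewrite rigid_kernelE.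
apply: le_trans (ler_norm_sum _ _ _) _; apply: ler_sum => l _.
by rewrite normrM ler_pM//; exact: hm.
Qed.

Let pM := cid (mker_bounded nu rigid_kernel_mxmeas (fun i j =>
  let: ex_intro C' h := rigid_kernel_bounded in
  ex_intro _ C' (fun x y => h x y i j))).
Let hp : mker nu p (projT1 pM) := projT2 pM.

Lemma mop_rigid_kernel w x : vbm w ->
  mop nu p w x = \sum_l rigid_coef w l *: phi_ l x.
Proof.
move=> bw; apply/colP => i; rewrite mxE summxE.
transitivity (\sum_(j < d) \sum_l phi_ l x i 0 * \int[nu]_y (phi_ l y j 0 * w y j 0)).
  apply: eq_bigr => j _; rewrite -Rintegral_lincomb; last first.
    by move=> l; exact: bmeasM (vbm_rigid_gen l j) (bw j).
  apply: eq_Rintegral => y _; rewrite rigid_kernelE mulr_suml.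
  by apply: eq_bigr => l _; rewrite mulrA.
rewrite exchange_big; apply: eq_bigr => l _; rewrite [RHS]mxE -mulr_sumr [RHS]mulrC.
congr (_ * _); rewrite /rigid_coef (eq_bigr (fun j => 1 *
   \int[nu]_y (phi_ l y j 0 * w y j 0))); last by move=> j _; rewrite mul1r.
rewrite -Rintegral_lincomb; last by move=> j; exact: bmeasM (vbm_rigid_gen l j) (bw j).
by apply: eq_Rintegral => y _; apply: eq_bigr => j _; rewrite mul1r.
Qed.

Let A x : 'M[R]_d := if x \in Omega then elastic_tensor x else gamma%:M.
Let K x y := k x y - p x y.

Let mopK w x : vbm w -> mop nu K w x = mop nu k w x - mop nu p w x.
Proof. by move=> bw; exact: mopB hM hp bw. Qed.

Let dot_sumZ (I : finType) (cf : I -> R) (v : I -> 'cV[R]_d) (u : 'cV[R]_d) :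
  dot (\sum_l cf l *: v l) u = \sum_l cf l * dot (v l) u.
Proof.
rewrite /dot; under [RHS]eq_bigr do rewrite mulr_sumr.
rewrite exchange_big/=; apply: eq_bigr => i _.
by rewrite summxE mulr_suml; apply: eq_bigr => l _; rewrite mxE mulrA.
Qed.

(** Adding the projector-like operator with kernel p fills the kernel and the
cokernel of L, both equal to the rigid motions. *)
Theorem elastic_solve : exists C0, forall f m, vbm f -> vle f m ->
  (forall l, rigid_coef f l = 0) -> exists w, [/\ vbm w, vle w (C0 * m),
    forall l, rigid_coef w l = 0 & forall x, Omega x -> L w x = f x].
Proof.
have ker0 w : vbm w -> (forall x, A x *m w x = mop nu K w x) ->
    {ae nu, forall x, w x = 0}.
  move=> bw h.
  have hL x : Omega x -> L w x = - \sum_l rigid_coef w l *: phi_ l x.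
    move=> Ox; have := h x; rewrite /A mem_set// mopK// mop_rigid_kernel// => hx.
    by rewrite /elastic hx addrAC subrr add0r.
  have e1 : \int[nu]_x dot (L w x) (w x) = - \sum_l rigid_coef w l ^+ 2.
    transitivity (\int[nu]_x \sum_l - rigid_coef w l * dot (phi_ l x) (w x)).
      apply: eq_ae_Rintegral.
      - exact: (bmeas_elastic_dot bw bw).1.
      - apply: measurable_sum => l; apply: measurable_funM => //.
        exact: (bmeas_dot (vbm_rigid_gen l) bw).1.
      apply/ae_domain; apply: nearW => x Ox; rewrite hL// dotNl dot_sumZ -sumrN.
      by apply: eq_bigr => l _; rewrite mulNr.
    rewrite Rintegral_lincomb; last by move=> l; exact: bmeas_dot (vbm_rigid_gen l) bw.
    by rewrite -sumrN; apply: eq_bigr => l _; rewrite mulNr -expr2.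
  have s0 : \sum_l rigid_coef w l ^+ 2 = 0.
    apply/eqP; rewrite eq_le sumr_ge0 ?andbT; last by move=> l _; exact: sqr_ge0.
    by have := elastic_energy_ge0 bw; rewrite e1; lra.
  apply: elastic_zero => //; first by rewrite e1 s0 oppr0.
  move=> l; apply/eqP; rewrite -sqrf_eq0 eq_le sqr_ge0 andbT -s0.
  by rewrite (bigD1 l)//= lerDl sumr_ge0// => j _; exact: sqr_ge0.
have mA i j : measurable_fun setT (fun x => A x i j).
  rewrite (_ : (fun x => _) = fun x => \1_Omega x * elastic_tensor x i j +
    (1 - \1_Omega x) * (gamma%:M : 'M[R]_d) i j); last first.
    apply/funext => x; rewrite /A indicE; case: ifP => _.
      by rewrite subrr mul0r addr0 mul1r.
    by rewrite mul0r add0r subr0 mul1r.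
  have mi : measurable_fun setT (\1_Omega : 'cV[R]_d -> R) by exact: measurable_indic.
  apply: measurable_funD; first by apply: measurable_funM => //; exact: (bmeas_tensor i j).1.
  by apply: measurable_funM => //; exact: measurable_funB.
have sA x : (A x)^T = A x.
  rewrite /A; case: ifP => _; last by rewrite tr_scalar_mx.
  apply/matrixP => i j; rewrite mxE !mxE; congr (kint nu _ _ x).
  by apply/funext => a; apply/funext => b; rewrite !elastic_kernelE (mulrC (dir b a i 0)).
have coA x (z : 'cV[R]_d) : gamma * dot z z <= dot (A x *m z) z.
  rewrite /A; case: ifP => [/set_mem Ox|_]; first exact: coercive.
  by rewrite mul_scalar_mx dotZl.
have wK : weakly_singular nu K.
  apply: weakly_singularB rigid_kernel_bounded; first exact: elastic_kernel_singular.
  exact: rigid_kernel_mxmeas.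
have sK x y : K y x = (K x y)^T.
  rewrite /K linearB/= elastic_kernel_tr elastic_kernel_sym; congr (_ - _).
  apply/matrixP => i j; rewrite mxE !rigid_kernelE.
  by apply: eq_bigr => l _; rewrite mulrC.
have [C0 hC0] := coercive_fredholm mA sA gamma0 coA wK sK ker0.
exists C0 => f m bf hf f0; have [w [bw hw Ew]] := hC0 f m bf hf.
have LP x : Omega x -> L w x + \sum_l rigid_coef w l *: phi_ l x = f x.
  move=> Ox; rewrite -Ew /A mem_set// mopK// mop_rigid_kernel//.
  by rewrite /elastic opprB addrA addrAC.
pose P x : 'cV[R]_d := \sum_l rigid_coef w l *: phi_ l x.
have bP : vbm P by apply: vbm_sum => l; apply: vbmZ; exact: vbm_rigid_gen.
have bL := vbm_elastic bw.
have P0 l : \int[nu]_x dot (P x) (phi_ l x) = 0.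
  transitivity (\int[nu]_x (dot (f x) (phi_ l x) - dot (L w x) (phi_ l x))).
    apply: eq_ae_Rintegral.
    - exact: (bmeas_dot bP (vbm_rigid_gen l)).1.
    - apply: measurable_funB; first exact: (bmeas_dot bf (vbm_rigid_gen l)).1.
      exact: (bmeas_elastic_dot bw (vbm_rigid_gen l)).1.
    apply/ae_domain; apply: nearW => x Ox; rewrite -dotBl -LP//.
    by rewrite addrAC subrr add0r.
  rewrite RintegralB//.
  - rewrite elastic_orthogonal// subr0 -[RHS](f0 l).
    by apply: eq_Rintegral => x _; rewrite dotC.
  - exact: (bmeas_integrable nu (bmeas_dot bf (vbm_rigid_gen l))).
  - exact: (bmeas_integrable nu (bmeas_elastic_dot bw (vbm_rigid_gen l))).
have PP : {ae nu, forall x, P x = 0}.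
  apply: vbm_ae0 => //.
  transitivity (\int[nu]_x \sum_l rigid_coef w l * dot (P x) (phi_ l x)).
    apply: eq_Rintegral => x _; rewrite {1}/P dot_sumZ; apply: eq_bigr => l _.
    by rewrite dotC.
  rewrite Rintegral_lincomb; last by move=> l; exact: bmeas_dot bP (vbm_rigid_gen l).
  by rewrite big1// => l _; rewrite P0 mulr0.
have sq0 : \sum_l rigid_coef w l ^+ 2 = 0.
  transitivity (\int[nu]_x \sum_l rigid_coef w l * dot (phi_ l x) (w x)).
    rewrite Rintegral_lincomb; last by move=> l; exact: bmeas_dot (vbm_rigid_gen l) bw.
    by apply: eq_bigr => l _; rewrite expr2.
  transitivity (\int[nu]_x (0 : R)); last by rewrite Rintegral_cst// mul0r.
  apply: eq_ae_Rintegral => //.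
    apply: measurable_sum => l; apply: measurable_funM => //.
    exact: (bmeas_dot (vbm_rigid_gen l) bw).1.
  by apply: filterS PP => x Px; rewrite -dot_sumZ -/(P x) Px dot0l.
have w0 l : rigid_coef w l = 0.
  apply/eqP; rewrite -sqrf_eq0 eq_le sqr_ge0 andbT -sq0.
  by rewrite (bigD1 l)//= lerDl sumr_ge0// => j _; exact: sqr_ge0.
exists w; split=> // x Ox; rewrite -LP// big1 ?addr0// => l _.
by rewrite w0 scale0r.
Qed.

End elastic.

(** * Essentially bounded fields and their bounded representatives *)

Section linf.
Context {R : realType} {d : nat}.
Local Notation mu := (lebesgue_cV R d).
Variable Omega : set 'cV[R]_d.
Implicit Types f g w : 'cV[R]_d -> 'cV[R]_d.

Let mu_gt0 : (0 < mu setT)%E.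
Proof. by apply: open_lebesgue_gt0 => //; [exact: openT|exists 0]. Qed.

Lemma linf_normE f : linf_norm Omega f =
  ess_sup mu (abse \o ((fun x => (enorm (f x))%:E) \_ Omega)).
Proof. by rewrite /linf_norm Lnorm.unlock mu_gt0. Qed.

Let restrictE f x : (abse \o ((fun x => (enorm (f x))%:E) \_ Omega)) x =
  (if x \in Omega then enorm (f x) else 0)%:E.
Proof.
rewrite /= patchE; case: ifP => _; last by rewrite abse0.
by rewrite /= ger0_norm// enorm_ge0.
Qed.

Lemma linf_norm_ge0 f : (0 <= linf_norm Omega f)%E.
Proof. exact: Lnorm_ge0. Qed.

Lemma linf_norm_leP f (m : R) : 0 <= m -> (linf_norm Omega f <= m%:E)%E <->
  {ae mu, forall x, Omega x -> enorm (f x) <= m}.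
Proof.
move=> m0; rewrite linf_normE; split=> [/ess_supP h|h].
  apply: filterS h => x; rewrite restrictE lee_fin => h Ox.
  by move: h; rewrite mem_set.
apply/ess_supP; apply: filterS h => x; rewrite restrictE lee_fin => h.
by case: ifPn => // /set_mem; exact: h.
Qed.

Lemma linf_norm_ae f : (linf_norm Omega f < +oo)%E ->
  {ae mu, forall x, Omega x -> enorm (f x) <= fine (linf_norm Omega f)}.
Proof.
move=> h; apply/linf_norm_leP; first exact/fine_ge0/linf_norm_ge0.
by rewrite fineK// ge0_fin_numE// linf_norm_ge0.
Qed.

Lemma linf_norm_gt0 f : (linf_norm Omega f < +oo)%E ->
  ~ aeeq Omega f (fun=> 0) -> (0 < linf_norm Omega f)%E.
Proof.
move=> h nf; rewrite lt_neqAle linf_norm_ge0 andbT eq_sym; apply/eqP => f0.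
apply: nf; have := linf_norm_ae h; rewrite f0.
apply: filterS => x hx /hx hx'; apply/enorm_eq0/eqP.
by rewrite eq_le enorm_ge0 andbT.
Qed.

End linf.

Section bounded_representative.
Context {R : realType} {d : nat}.
Local Notation mu := (lebesgue_cV R d).
Variables (Omega : set 'cV[R]_d) (mO : measurable Omega) (fO : (mu Omega < +oo)%E).
Local Notation nu := (domain_measure mO fO).
Implicit Types f g w : 'cV[R]_d -> 'cV[R]_d.
Variable rO : R.
Hypotheses (rO0 : 0 < rO) (OrO : Omega `<=` cube 0 rO).

(** An everywhere bounded representative that vanishes off Omega. *)
Definition truncate f x : 'cV[R]_d :=
  if (x \in Omega) && (enorm (f x) <= fine (linf_norm Omega f)) then f x else 0.

Lemma measurable_indicZ f i : measurable_fun Omega f ->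
  measurable_fun setT (fun x => (\1_Omega x *: f x) i 0).
Proof.
move=> mf; rewrite (_ : (fun x => _) = (fun x => f x i 0) \_ Omega).
  apply/(measurable_restrictT _ mO).
  by apply: (measurableT_comp (measurable_coord i)).
apply/funext => x; rewrite patchE indicE mxE.
by case: (x \in _); rewrite ?mul1r ?mul0r.
Qed.

Lemma truncate_vle f : vle (truncate f) (fine (linf_norm Omega f)).
Proof.
move=> x i; rewrite /truncate; case: ifP => [/andP[_ h]|_].
  exact: le_trans (coord_le_enorm _ _) h.
by rewrite mxE normr0; exact/fine_ge0/linf_norm_ge0.
Qed.

Lemma truncate_vbm f : measurable_fun Omega f -> vbm (truncate f).
Proof.
move=> mf i; split; last by exists (fine (linf_norm Omega f)) => x; exact: truncate_vle.
have mi j := measurable_indicZ j mf.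
rewrite (_ : (fun x => _) = fun x =>
    if enorm (\1_Omega x *: f x) <= fine (linf_norm Omega f)
    then (\1_Omega x *: f x) i 0 else 0).
  apply: measurable_fun_ifT => //.
  by apply: measurable_fun_ler => //; exact: measurable_enorm.
apply/funext => x; rewrite /truncate indicE; case: (x \in Omega) => /=.
  by rewrite scale1r; case: ifP => _ //; rewrite mxE.
by rewrite scale0r mxE if_same.
Qed.

Lemma truncate_ae f : Linfty Omega f -> {ae nu, forall x, f x = truncate f x}.
Proof.
move=> [_ /linf_norm_ae h]; apply/ae_domain; apply: filterS h => x h Ox.
by rewrite /truncate mem_set// h.
Qed.

Lemma rigid_coef_ae f g l : measurable_fun Omega f -> vbm g ->
  {ae nu, forall x, f x = g x} ->
  rigid_coef mO fO g l = \int[mu]_(x in Omega) dot (f x) (rigid_gen l x).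
Proof.
move=> mf bg h; have bp := vbm_rigid_gen mO rO0 OrO l.
have mpf : measurable_fun setT
    (fun x => dot (\1_Omega x *: f x) (rigid_gen_on Omega l x)).
  apply: measurable_dot => i; [exact: measurable_indicZ|exact: (bp i).1].
transitivity (\int[nu]_x dot (\1_Omega x *: f x) (rigid_gen_on Omega l x)).
  apply: eq_ae_Rintegral => //; first exact: (bmeas_dot bp bg).1.
  move/ae_domain : h => h; apply/ae_domain; apply: filterS h => x h Ox.
  by rewrite -h// dotC indicE mem_set// scale1r.
rewrite Rintegral_domain//; apply: eq_Rintegral => x /set_mem Ox.
by rewrite indicE mem_set// scale1r rigid_gen_in.
Qed.

Lemma V_rigid_coef f g l : V Omega f -> vbm g -> {ae nu, forall x, f x = g x} ->
  rigid_coef mO fO g l = 0.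
Proof.
move=> [[mf _] hf] bg h; rewrite (rigid_coef_ae l mf bg h).
exact/hf/rigid_gen_motion.
Qed.

(** Orthogonality to the finitely many generators suffices. *)
Lemma V_of_bounded f g : measurable_fun Omega f -> vbm g ->
  {ae nu, forall x, f x = g x} -> (forall l, rigid_coef mO fO g l = 0) ->
  V Omega f.
Proof.
move=> mf bg h g0; have [m m0 hm] := vbm_bound bg.
have fin : (linf_norm Omega f < +oo)%E.
  apply: (@le_lt_trans _ _ (d%:R * m)%:E); last exact: ltry.
  apply/linf_norm_leP; first by rewrite mulr_ge0.
  move/ae_domain : h; apply: filterS => x h /h ->.
  apply: le_trans (enorm_le_norm _) _; rewrite ler_wpM2l//.
  by apply/cV_norm_leP => // i; exact: hm.
split=> // _ [Q [b [sQ ->]]].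
pose cf (l : @rigid_index d) :=
  match l with inl ij => 2^-1 * Q ij.1 ij.2 | inr i => b i 0 end.
transitivity (\int[nu]_x \sum_l cf l * dot (rigid_gen_on Omega l x) (g x)).
  have mpf : measurable_fun setT (fun x => dot (\1_Omega x *: f x) (Q *m x + b)).
    apply: measurable_dot => i; first exact: measurable_indicZ.
    under eq_fun do rewrite !mxE; apply: measurable_funD => //.
    apply: measurable_sum => j; apply: measurable_funM => //.
    exact: measurable_coord.
  transitivity (\int[nu]_x dot (\1_Omega x *: f x) (Q *m x + b)).
    rewrite Rintegral_domain//; apply: eq_Rintegral => x /set_mem Ox.
    by rewrite indicE mem_set// scale1r.
  apply: eq_ae_Rintegral => //.
    apply: measurable_sum => l; apply: measurable_funM => //.
    exact: (bmeas_dot (vbm_rigid_gen mO rO0 OrO l) bg).1.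
  move/ae_domain : h => h; apply/ae_domain; apply: filterS h => x h Ox.
  rewrite -h// dotC rigid_decomp// indicE mem_set// scale1r {1}/dot.
  under eq_bigr do rewrite summxE mulr_suml.
  rewrite exchange_big/=; apply: eq_bigr => l _.
  rewrite rigid_gen_in// /dot mulr_sumr; apply: eq_bigr => i _.
  by rewrite mxE mulrA.
rewrite Rintegral_lincomb; last by move=> l; exact: bmeas_dot (vbm_rigid_gen mO rO0 OrO l) bg.
by rewrite big1// => l _; rewrite -/(rigid_coef mO fO g l) g0 mulr0.
Qed.

End bounded_representative.

(** * The peridynamic operator as an elastic operator *)

Lemma omega_gt0 (R : realType) (d : nat) : 0 < omega R d.
Proof.
apply: fine_gt0; apply/andP; split.
  apply: open_lebesgue_gt0; [exact: open_eball|exact: measurable_eball|].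
  by exists 0; rewrite /eball/= subrr enorm0.
apply: (@le_lt_trans _ _ (lebesgue_cV R d (cube 0 1))).
  apply: le_measure; rewrite ?inE; [exact: measurable_eball|exact: measurable_cube|].
  exact: eball_cube.
by rewrite lebesgue_cV_cube// ltry.
Qed.

Section peridynamic.
Context {R : realType} {d : nat}.
Local Notation mu := (lebesgue_cV R d).
Variables (Omega : set 'cV[R]_d) (mO : measurable Omega) (fO : (mu Omega < +oo)%E).
Local Notation nu := (domain_measure mO fO).
Implicit Types (w f : 'cV[R]_d -> 'cV[R]_d).
Variables (eps rO : R) (J g g2 : R -> R) (re rc : R) (u0 : 'cV[R]_d -> 'cV[R]_d).
Hypothesis d2 : (1 < d)%N.
Hypotheses (oO : open Omega) (cnO : connected Omega) (rO0 : 0 < rO).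
Hypothesis OrO : Omega `<=` cube 0 rO.
Hypotheses (hcone : interior_cone_condition Omega) (eps0 : 0 < eps).
Hypotheses (hJ : influence_function J) (hg : potential_function g re rc).
(* The second derivative enters as an abstract function, which keeps the iterated
derivative folded. *)
Hypothesis g2E : derive1n 2 g = g2.
Hypothesis mu0 : measurable_fun Omega u0.
Hypothesis hstrict : strictly_inside_strength_domain Omega eps re rc u0.
Local Notation N := (eps ^+ d.+1 * omega R d).

Let N0 : 0 < N. Proof. by rewrite mulr_gt0 ?exprn_gt0 ?omega_gt0. Qed.

Let u x := \1_Omega x *: u0 x.

(** The field u0 is cut off outside Omega, where it need not be measurable. *)
Definition bond_stiffness x y : R := \1_Omega x * \1_Omega y *
  (if enorm (y - x) < eps then J (enorm (y - x) / eps) / N *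
     g2 (Num.sqrt (enorm (y - x)) * strain y x u) else 0).
Local Notation c := bond_stiffness.

Lemma bond_stiffnessE x y : Omega x -> Omega y -> enorm (y - x) < eps ->
  c x y = J (enorm (y - x) / eps) / N * g2 (Num.sqrt (enorm (y - x)) * strain y x u0).
Proof.
move=> Ox Oy xy; have iE z : Omega z -> \1_Omega z = 1 :> R.
  by move=> Oz; rewrite indicE mem_set.
have -> : strain y x u0 = strain y x u by rewrite /strain /u (iE x)// (iE y)// !scale1r.
by rewrite /c xy (iE x)// (iE y)// mulr1 mul1r.
Qed.

Lemma bond_stiffness_far x y : (enorm (y - x) < eps) = false -> c x y = 0.
Proof. by move=> xy; rewrite /c xy mulr0. Qed.

Let g2_continuous : continuous g2.
Proof.
move=> x; rewrite -g2E; apply: differentiable_continuous; apply/derivable1_diffP.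
exact: (potential_derivable hg).
Qed.

Let g2_pos r : re < r -> r < rc -> 0 < g2 r.
Proof. by rewrite -g2E; exact: (potential_d2_gt0 hg). Qed.

Let g2_0 : 0 < g2 0.
Proof. by apply: g2_pos; [exact: (potential_re hg)|exact: (potential_rc hg)]. Qed.

(** The stretch stays in a compact part of the interval where g is strictly
convex. *)
Let g2_low : exists2 m, 0 < m & forall x y, Omega x -> Omega y ->
  enorm (y - x) < eps -> m <= g2 (Num.sqrt (enorm (y - x)) * strain y x u0).
Proof.
have [a [b [rea ab brc hab]]] := hstrict.
have cab : {within `[a, b], continuous g2} by apply: continuous_subspaceT.
have [t tab ht] := EVT_min ab cab.
have t0 : 0 < g2 t.
  apply: g2_pos; move: tab; rewrite in_itv/= => /andP[h1 h2].
    exact: lt_le_trans h1.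
  exact: le_lt_trans brc.
exists (Num.min (g2 t) (g2 0)); first by rewrite lt_min t0 g2_0.
move=> x y Ox Oy xy; rewrite ge_min; have [->|yx] := eqVneq y x.
  by rewrite subrr enorm0 sqrtr0 mul0r lexx orbT.
by rewrite ht// in_itv/= hab.
Qed.

Let g2_gt0 x y : Omega x -> Omega y -> enorm (y - x) < eps ->
  0 < g2 (Num.sqrt (enorm (y - x)) * strain y x u0).
Proof. by move=> Ox Oy xy; have [m m0 h] := g2_low; exact: lt_le_trans (h _ _ _ _ _). Qed.

Lemma bond_stiffness_cases x y :
  c x y = 0 \/ [/\ Omega x, Omega y & enorm (y - x) < eps].
Proof.
have [Ox|Ox] := pselect (Omega x); last by left; rewrite /c indicE memNset// !mul0r.
have [Oy|Oy] := pselect (Omega y); last first.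
  by left; rewrite /c !indicE (memNset Oy) mulr0 mul0r.
by case: (boolP (enorm (y - x) < eps)) => [|/negbTE/bond_stiffness_far]; [right|left].
Qed.

Lemma bond_stiffness_ge0 x y : 0 <= c x y.
Proof.
have [-> //|[Ox Oy xy]] := bond_stiffness_cases x y.
rewrite bond_stiffnessE// mulr_ge0 ?(ltW (g2_gt0 _ _ _))// divr_ge0 ?(ltW N0)//.
exact: influence_ge0.
Qed.

Lemma bond_stiffness_le : exists C, forall x y, c x y <= C.
Proof.
have [B [_ hB]] := influence_bounded hJ.
have {}hB r : J r <= B + 1.
  by apply: le_trans (ler_norm _) _; apply: hB => //; rewrite ltrDl.
have B0 : 0 <= B + 1 by exact: le_trans (influence_ge0 hJ 0) (hB 0).
have C0 : 0 <= (B + 1) / N * g2 0 by rewrite mulr_ge0 ?divr_ge0 ?(ltW N0)// ltW.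
exists ((B + 1) / N * g2 0) => x y.
have [-> //|[Ox Oy xy]] := bond_stiffness_cases x y.
rewrite bond_stiffnessE// ler_pM ?(ltW (g2_gt0 _ _ _))//.
- by rewrite divr_ge0 ?(ltW N0)//; exact: influence_ge0.
- by rewrite ler_wpM2r ?invr_ge0 ?(ltW N0).
- by apply: le_trans (ler_norm _) _; rewrite -g2E; exact: (potential_d2_max hg).
Qed.

Lemma strain_sym (x y : 'cV[R]_d) v : strain x y v = strain y x v.
Proof.
by rewrite /strain dirN -(opprB y x) enormN -(opprB (v y)) scalerN dotNl dotNr opprK.
Qed.

Lemma bond_stiffness_sym x y : c y x = c x y.
Proof. by rewrite /c strain_sym -(opprB y x) enormN [\1_Omega y * _]mulrC. Qed.

Lemma bond_stiffness_out x y : ~ Omega x -> c x y = 0.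
Proof. by move=> Ox; rewrite /c indicE memNset// !mul0r. Qed.

Lemma bond_stiffness_gt0 x y : Omega x -> Omega y -> y != x ->
  enorm (y - x) < eps -> 0 < c x y.
Proof.
move=> Ox Oy _ xy; rewrite bond_stiffnessE// mulr_gt0 ?g2_gt0// divr_gt0//.
by apply: influence_gt0 => //; rewrite ?divr_ge0 ?enorm_ge0 ?(ltW eps0)// ltr_pdivrMr ?mul1r.
Qed.

Lemma measurable_bond_stiffness :
  measurable_fun setT (fun z : 'cV[R]_d * 'cV[R]_d => c z.1 z.2).
Proof.
have mi : measurable_fun setT (\1_Omega : 'cV[R]_d -> R) by exact: measurable_indic.
have mu_ i : measurable_fun setT (fun x => u x i 0) by exact: measurable_indicZ.
apply: measurable_funM.
  by apply: measurable_funM; apply: (measurableT_comp mi);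
    [exact: measurable_fst|exact: measurable_snd].
apply: measurable_fun_ifT => //.
  by apply: measurable_fun_ltr => //; exact: measurable_dist.
apply: measurable_funM.
  apply: measurable_funM => //; apply: (measurableT_comp (influence_measurable hJ)).
  by apply: measurable_funM => //; exact: measurable_dist.
apply: (measurableT_comp (continuous_measurable_fun g2_continuous)).
apply: measurable_funM.
  apply: (measurableT_comp (f := @Num.sqrt R)); last exact: measurable_dist.
  apply: continuous_measurable_fun; exact: sqrt_continuous.
apply: measurable_dot => i; last exact: measurable_dir.
rewrite (_ : (fun z => _) = fun z : 'cV[R]_d * 'cV[R]_d =>
    (enorm (z.2 - z.1))^-1 * (u z.2 i 0 - u z.1 i 0)); last first.
  by apply/funext => z; rewrite !mxE.
apply: measurable_funM.
  by apply: measurable_invr_comp; exact: measurable_dist.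
apply: measurable_funB; apply: (measurableT_comp (mu_ i));
  [exact: measurable_snd|exact: measurable_fst].
Qed.

Let C := projT1 (cid bond_stiffness_le).
Let c_le : forall x y, c x y <= C := projT2 (cid bond_stiffness_le).
Let mc := measurable_bond_stiffness.
Let c_ge0 := bond_stiffness_ge0.
Let c_sym := bond_stiffness_sym.
Let c_out := bond_stiffness_out.
Local Notation k := (elastic_kernel c).
Local Notation L := (elastic mO fO c).

Let Rintegral_ball x (f h : 'cV[R]_d -> R) :
  (forall y, Omega y -> f y = if enorm (y - x) < eps then h y else 0) ->
  \int[mu]_(y in Omega) f y = \int[mu]_(y in eball x eps `&` Omega) h y.
Proof.
move=> fh; rewrite /Rintegral [in RHS]setIC integral_mkcondr; congr fine.
apply: eq_integral => y /set_mem Oy; rewrite fh// patchE.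
by case: ifPn => xy; [rewrite mem_set|rewrite memNset//; exact/negP].
Qed.

Lemma stability_tensor_elastic x : Omega x ->
  stability_tensor Omega eps J g u0 x = elastic_tensor mO fO c x.
Proof.
move=> Ox; apply/matrixP => i j; rewrite mxE [RHS]mxE /kint Rintegral_domain; last first.
  under eq_fun do rewrite mulr1.
  exact: (measurable_fun_pair2 (f := fun z => k z.1 z.2 i j) x) (elastic_kernel_mxmeas mc i j).
symmetry; apply: Rintegral_ball => y Oy; rewrite mulr1 /elastic_kernel.
case: ifP => xy; last by rewrite bond_stiffness_far// mul0r scale0r mxE.
rewrite bond_stiffnessE// g2E; congr (fun_of_matrix (_ *: _) i j).
by rewrite (invfM N) mulrA mulrAC.
Qed.

(** Every bond contributes a nonnegative amount, and those given by [uniform_mass]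
contribute at least kappa |v|^2 each. *)
Lemma bond_coercive : exists2 gamma, 0 < gamma & forall x (v : 'cV[R]_d),
  Omega x -> gamma * dot v v <= dot (elastic_tensor mO fO c x *m v) v.
Proof.
have [delta [rho [m0 [delta0 rho0 m00 hS]]]] := uniform_mass hcone hJ eps0.
have [m m_gt0 hm] := g2_low.
pose kappa := delta / N * m * eps^-1 * (eps^-1 * rho) ^+ 2.
have kappa0 : 0 < kappa.
  by rewrite /kappa pmulr_rgt0 ?exprn_gt0 ?mulr_gt0 ?divr_gt0 ?invr_gt0.
exists (kappa * m0); first exact: mulr_gt0.
move=> x v Ox; have [->|v0] := eqVneq v 0; first by rewrite mulmx0 dot0l mulr0.
have [S [mS mS0 SP]] := hS _ _ Ox v0.
have [i ->] := elastic_tensor_dot mO fO d2 mc c_ge0 c_le c_sym c_out x v v.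
have SO : S `<=` Omega by move=> y /SP[].
have nuS : nu S = mu S by transitivity (mu (S `&` Omega)); rewrite // setIidl.
have finS : nu S \is a fin_num by exact: fin_num_measure.
apply: (@le_trans _ _ (\int[nu]_y (kappa * dot v v * \1_S y))).
  rewrite RintegralZl//; last first.
    exact: (bmeas_integrable nu (bmeas_indic mS)).
  have -> : \int[nu]_y \1_S y = fine (nu S).
    by rewrite /Rintegral integral_indic// setIT.
  have m0S : m0 <= fine (nu S) by rewrite -lee_fin fineK// nuS.
  by rewrite mulrAC ler_wpM2l// mulr_ge0 ?dotxx_ge0// ltW.
apply: le_Rintegral => //.
  exact: (bmeas_integrable nu (bmeasZ _ (bmeas_indic mS))).
move=> y _; rewrite indicE; case: (boolP (y \in S)) => yS; last first.
  by rewrite mulr0 -expr2 mulr_ge0 ?sqr_ge0// divr_ge0// enorm_ge0.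
have [Oy xy dJ rv] := SP _ (set_mem yS); rewrite mulr1.
have yx : 0 < enorm (y - x).
  rewrite enorm_gt0//; apply/eqP => h; move: rv; rewrite h dot0l normr0.
  by rewrite leNgt mulr_gt0// enorm_gt0.
have einv : eps^-1 <= (enorm (y - x))^-1 by rewrite lef_pV2 ?posrE// ltW.
have dN : 0 <= delta / N by rewrite divr_ge0 ?(ltW N0) ?(ltW delta0).
have Ninv : 0 <= N^-1 by rewrite invr_ge0 (ltW N0).
have einv0 : 0 <= eps^-1 by rewrite invr_ge0 (ltW eps0).
rewrite bond_stiffnessE// /kappa -mulrA ler_pM//.
- by rewrite mulr_ge0// mulr_ge0// (ltW m_gt0).
- by rewrite mulr_ge0 ?sqr_ge0 ?dotxx_ge0.
- apply: ler_pM => //; first by rewrite mulr_ge0// (ltW m_gt0).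
  apply: ler_pM => //; [exact: ltW|by rewrite ler_wpM2r// ltW|exact: hm].
rewrite -expr2 -sqr_enorm -exprMn -[leRHS]real_normK ?num_real//.
have rv0 : 0 <= rho * enorm v by rewrite mulr_ge0 ?enorm_ge0// ltW.
rewrite -mulrA lerXn2r ?nnegrE//; first exact: mulr_ge0.
by rewrite /dir dotZl normrM gtr0_norm ?invr_gt0// ler_pM.
Qed.

(** This holds at every point of Omega: only the integrated occurrence of w is
replaced by its bounded representative. *)
Lemma DL_elastic w w' x : measurable_fun Omega w -> vbm w' ->
  {ae nu, forall y, w y = w' y} -> Omega x ->
  DL Omega eps J g u0 w x = elastic_tensor mO fO c x *m w x - mop nu k w' x.
Proof.
move=> mw bw ww' Ox; apply/colP => i.
have [[M hM] _] := elastic_kernel_singular mO fO d2 mc c_ge0 c_le c_sym c_out.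
(* The strain of w contains w y - w x, the flux w x - w y. *)
transitivity (- \int[nu]_y (k x y *m (- w x - (-1) *: w' y)) i 0); last first.
  rewrite -(elastic_flux_at mO fO d2 mc c_ge0 c_le c_sym c_out)//; last exact: vbmZ.
  rewrite (bopZ (mop_bop hM))// scaleN1r mulmxN !mxE; ring.
rewrite !mxE; congr (- _).
have mk (a : 'cV[R]_d -> 'cV[R]_d) : (forall j, measurable_fun setT (fun y => a y j 0)) ->
    measurable_fun setT (fun y => (k x y *m a y) i 0).
  move=> ma; under eq_fun do rewrite mxE; apply: measurable_sum => j.
  apply: measurable_funM => //.
  exact: (measurable_fun_pair2 (f := fun z => k z.1 z.2 i j) x) (elastic_kernel_mxmeas mc i j).
have m1 : measurable_fun setT (fun y => (k x y *m (\1_Omega y *: w y - w x)) i 0).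
  apply: mk => j; rewrite (_ : (fun y => _) = fun y => (\1_Omega y *: w y) j 0 - w x j 0).
    by apply: measurable_funB => //; exact: measurable_indicZ.
  by apply/funext => y; rewrite !mxE.
transitivity (\int[nu]_y (k x y *m (\1_Omega y *: w y - w x)) i 0); last first.
  apply: eq_ae_Rintegral => //.
    apply: mk => j; rewrite (_ : (fun y => _) = fun y => - w x j 0 + w' y j 0).
      by apply: measurable_funD => //; exact: (bw j).1.
    by apply/funext => y; rewrite !mxE; ring.
  move/ae_domain : ww' => ww'; apply/ae_domain; apply: filterS ww' => y h Oy.
  by rewrite h// indicE mem_set// scale1r scaleN1r opprK addrC.
rewrite Rintegral_domain//; symmetry; apply: Rintegral_ball => y Oy.
rewrite indicE mem_set// scale1r elastic_kernel_mul.
case: ifP => xy; last by rewrite bond_stiffness_far// !mul0r.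
have -> : strain y x w = (enorm (y - x))^-1 * dot (dir y x) (w y - w x).
  by rewrite {1}/strain dotZl dotC.
rewrite bond_stiffnessE// g2E [RHS]mxE; ring.
Qed.

Local Notation DLu := (DL Omega eps J g u0).

Let bL w : vbm w -> vbm (L w).
Proof. by move=> bw; exact: (vbm_elastic mO fO d2 mc c_ge0 c_le c_sym c_out bw). Qed.

Lemma DL_ae w w' : measurable_fun Omega w -> vbm w' ->
  {ae nu, forall y, w y = w' y} -> {ae nu, forall x, DLu w x = L w' x}.
Proof.
move=> mw bw ww'; move: (ww') => /ae_domain h; apply/ae_domain.
by apply: filterS h => x wx Ox; rewrite (DL_elastic mw bw ww' Ox) wx.
Qed.

Lemma measurable_DL w : V Omega w -> measurable_fun Omega (DLu w).
Proof.
move=> [Lw _]; have mw := Lw.1; have bw := truncate_vbm mO mw.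
have ww := truncate_ae mO fO Lw.
apply: measurable_fun_coordP => // i.
apply: (eq_measurable_fun (fun x =>
    (elastic_tensor mO fO c x *m w x - mop nu k (truncate Omega w) x) i 0)).
  by move=> x /set_mem Ox; rewrite (DL_elastic mw bw ww Ox).
have [[M hM] _] := elastic_kernel_singular mO fO d2 mc c_ge0 c_le c_sym c_out.
have mwi j : measurable_fun Omega (fun x => w x j 0).
  exact: (measurableT_comp (measurable_coord j) mw).
have bt := bmeas_tensor mO fO d2 mc c_ge0 c_le c_sym c_out.
rewrite (_ : (fun x => _) = fun x => \sum_j elastic_tensor mO fO c x i j * w x j 0
    - mop nu k (truncate Omega w) x i 0); last first.
  by apply/funext => x; rewrite mxE [X in X + _]mxE [X in _ + X]mxE.
apply: measurable_funB; last first.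
  exact: measurable_funTS (bop_vbm (mop_bop hM) bw i).1.
apply: measurable_sum => j; apply: measurable_funM => //.
exact: measurable_funTS (bt i j).1.
Qed.

(** The total force and torque of a system of internal forces vanish. *)
Lemma V_DL w : V Omega w -> V Omega (DLu w).
Proof.
move=> Vw; have [Lw _] := Vw; have bw := truncate_vbm mO Lw.1.
have ww := truncate_ae mO fO Lw.
apply: (V_of_bounded rO0 OrO (measurable_DL Vw) (bL bw) (DL_ae Lw.1 bw ww)) => l.
rewrite -[RHS](elastic_orthogonal mO fO d2 rO0 OrO mc c_ge0 c_le c_sym c_out l bw).
by apply: eq_Rintegral => x _; rewrite dotC.
Qed.

(** The difference of two bounded representatives has zero energy and is orthogonal
to the rigid motions. *)
Lemma DL_inj w1 w2 : V Omega w1 -> V Omega w2 ->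
  aeeq Omega (DLu w1) (DLu w2) -> aeeq Omega w1 w2.
Proof.
move=> V1 V2 /(ae_domain mO fO) E.
have [[L1 _] [L2 _]] := (V1, V2).
have b1 := truncate_vbm mO L1.1; have b2 := truncate_vbm mO L2.1.
have e1 := truncate_ae mO fO L1; have e2 := truncate_ae mO fO L2.
have bw : vbm (fun x => truncate Omega w1 x - truncate Omega w2 x) by exact: vbmB.
have L0 : {ae nu, forall x, L (fun x => truncate Omega w1 x - truncate Omega w2 x) x = 0}.
  apply: filterS3 E (DL_ae L1.1 b1 e1) (DL_ae L2.1 b2 e2) => x E E1 E2.
  apply: etrans (elasticB mO fO d2 mc c_ge0 c_le c_sym c_out x b1 b2) _.
  by apply/eqP; rewrite subr_eq0 -E1 -E2; exact/eqP.
apply/(ae_domain mO fO).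
have : {ae nu, forall x, truncate Omega w1 x - truncate Omega w2 x = 0}.
  apply: (elastic_zero d2 oO cnO rO0 OrO eps0 mc c_ge0 c_le c_sym c_out
    bond_stiffness_gt0 bw).
    transitivity (\int[nu]_x (0 : R)); last by rewrite Rintegral_cst// mul0r.
    apply: eq_ae_Rintegral => //; first exact: (bmeas_dot (bL bw) bw).1.
    by apply: filterS L0 => x ->; rewrite dot0l.
  move=> l; transitivity (rigid_coef mO fO (truncate Omega w1) l -
                          rigid_coef mO fO (truncate Omega w2) l); last first.
    by rewrite (V_rigid_coef rO0 OrO l V1 b1 e1) (V_rigid_coef rO0 OrO l V2 b2 e2) subrr.
  have bp := vbm_rigid_gen mO rO0 OrO l.
  rewrite /rigid_coef -RintegralB//.
  - by apply: eq_Rintegral => x _; rewrite dotBr.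
  - exact: (bmeas_integrable nu (bmeas_dot bp b1)).
  - exact: (bmeas_integrable nu (bmeas_dot bp b2)).
apply: filterS3 e1 e2 => x -> -> /eqP; rewrite subr_eq0 => /eqP; exact.
Qed.

Lemma DL_congr w1 w2 : V Omega w1 -> V Omega w2 -> aeeq Omega w1 w2 ->
  aeeq Omega (DLu w1) (DLu w2).
Proof.
move=> [L1 _] [L2 _] /(ae_domain mO fO) E; apply/(ae_domain mO fO).
have b1 := truncate_vbm mO L1.1; have e1 := truncate_ae mO fO L1.
have e2 : {ae nu, forall x, w2 x = truncate Omega w1 x}.
  by apply: filterS2 E e1 => x ->.
by apply: filterS2 (DL_ae L1.1 b1 e1) (DL_ae L2.1 b1 e2) => x -> ->.
Qed.

Lemma V0 : V Omega (fun=> 0).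
Proof.
apply: (V_of_bounded (g := fun=> 0) rO0 OrO) => //; first exact: vbm0.
  exact: nearW.
move=> l; rewrite /rigid_coef; under eq_Rintegral do rewrite dot0r.
by rewrite Rintegral_cst// mul0r.
Qed.

Lemma DL0 : aeeq Omega (DLu (fun=> 0)) (fun=> 0).
Proof.
apply/(ae_domain mO fO).
apply: filterS (DL_ae V0.1.1 vbm0 (nearW _ (fun _ => erefl))) => x ->.
have [[M hM] _] := elastic_kernel_singular mO fO d2 mc c_ge0 c_le c_sym c_out.
by rewrite /elastic mulmx0 (bop0 (mop_bop hM)) subr0.
Qed.

Lemma DL_Ker : Ker Omega DLu = [set w | V Omega w /\ aeeq Omega w (fun=> 0)].
Proof.
apply/seteqP; split=> w [Vw h]; split=> //.
  apply: (DL_inj Vw V0); apply: filterS2 h DL0 => x h1 h2 Ox.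
  exact: etrans (h1 Ox) (esym (h2 Ox)).
apply: filterS2 (DL_congr Vw V0 h) DL0 => x h1 h2 Ox.
exact: etrans (h1 Ox) (h2 Ox).
Qed.

Lemma DL_inverse : exists2 T, inverse_on_V Omega DLu T &
  (opnorm Omega T < +oo)%E.
Proof.
have [gamma gamma0 co] := bond_coercive.
have [C0 hC0] := elastic_solve d2 oO cnO rO0 OrO eps0 gamma0 mc c_ge0 c_le
  c_sym c_out bond_stiffness_gt0 co.
have /choice[T hT] : forall f, exists w, V Omega f ->
    [/\ vbm w, vle w (C0 * fine (linf_norm Omega f)),
       forall l, rigid_coef mO fO w l = 0 &
       forall x, Omega x -> L w x = truncate Omega f x].
  move=> f; have [Vf|Vf] := pselect (V Omega f); last by exists (fun=> 0).
  have [Lf _] := Vf; have bf := truncate_vbm mO Lf.1.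
  have [w hw] := hC0 _ _ bf (truncate_vle Omega f)
    (fun l => V_rigid_coef rO0 OrO l Vf bf (truncate_ae mO fO Lf)).
  by exists w.
have OnO : {ae nu, forall x, Omega x} by apply/ae_domain; exact: nearW.
have mT f : V Omega f -> measurable_fun Omega (T f).
  move=> /hT[bw _ _ _]; apply: measurable_fun_coordP => // i.
  exact: measurable_funTS (bw i).1.
have TV f : V Omega f -> V Omega (T f).
  move=> Vf; have [bw _ w0 _] := hT _ Vf.
  by apply: (V_of_bounded rO0 OrO (mT _ Vf) bw) => //; exact: nearW.
have LT f : V Omega f -> aeeq Omega (DLu (T f)) f.
  move=> Vf; have [bw _ _ Ew] := hT _ Vf; have [Lf _] := Vf.
  have e1 : {ae nu, forall x, DLu (T f) x = L (T f) x}.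
    by apply: DL_ae => //; [exact: mT|exact: nearW].
  apply/(ae_domain mO fO); apply: filterS3 e1 (truncate_ae mO fO Lf) OnO.
  move=> x h1 h2 Ox.
  exact: etrans h1 (etrans (Ew _ Ox) (esym h2)).
exists T; last first.
  apply: (@le_lt_trans _ _ (d%:R * `|C0|)%:E); last exact: ltry.
  apply: ge_ereal_sup => _ [f [Vf nf] <-].
  have finf := Vf.1.2; have posf := linf_norm_gt0 finf nf.
  have fE : linf_norm Omega f = (fine (linf_norm Omega f))%:E.
    by rewrite fineK// ge0_fin_numE// ltW.
  have fpos : 0 < fine (linf_norm Omega f) by rewrite -lte_fin -fE.
  rewrite fE inver gt_eqF// lee_pdivrMr//.
  rewrite -EFinM; have [bw hw _ _] := hT _ Vf.
  apply/linf_norm_leP; first by rewrite !mulr_ge0// ltW.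
  apply: nearW => x Ox; apply: le_trans (enorm_le_norm _) _.
  rewrite -mulrA ler_wpM2l//; apply/cV_norm_leP => [|i].
    by rewrite mulr_ge0// ltW.
  apply: le_trans (hw x i) _; rewrite ler_wpM2r ?ler_norm// ltW//.
split.
- exact: V_DL.
- exact: TV.
- exact: DL_congr.
- move=> f f' Vf Vf' ff'; apply: DL_inj (TV _ Vf) (TV _ Vf') _.
  apply: filterS3 ff' (LT _ Vf) (LT _ Vf') => x h h1 h2 Ox.
  exact: etrans (h1 Ox) (etrans (h Ox) (esym (h2 Ox))).
- exact: LT.
- by move=> w Vw; apply: DL_inj (TV _ (V_DL Vw)) Vw (LT _ (V_DL Vw)).
Qed.

End peridynamic.

Theorem theorem3 (R : realType) (d : nat) (hd : d = 2%N \/ d = 3%N)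
  (Omega : set 'cV[R]_d)
  (hbounded : bounded_set Omega) (hopen : open Omega) (hconn : connected Omega)
  (hcone : interior_cone_condition Omega)
  (eps : R) (heps : 0 < eps)
  (J : R -> R) (hJ : influence_function J)
  (g : R -> R) (re rc : R) (hg : potential_function g re rc)
  (u0 : 'cV[R]_d -> 'cV[R]_d) (hu0 : V Omega u0)
  (hstrict : strictly_inside_strength_domain Omega eps re rc u0) :
  [/\ Ker Omega (DL Omega eps J g u0)
        = [set w | V Omega w /\ aeeq Omega w (fun=> 0)],
      exists2 gamma : R, 0 < gamma &
        forall x, Omega x -> forall v : 'cV[R]_d, v != 0 ->
          0 < dot (stability_tensor Omega eps J g u0 x *m v) v
              - gamma * enorm v ^+ 2 &
      exists2 DLinv, inverse_on_V Omega (DL Omega eps J g u0) DLinv &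
        (opnorm Omega DLinv < +oo)%E].
Proof.
have d2 : (1 < d)%N by case: hd => ->.
have mO : measurable Omega by exact: open_cV_measurable.
have [rO rO0 OrO] := bounded_subset_cube hbounded.
have fO : (lebesgue_cV R d Omega < +oo)%E.
  apply: (@le_lt_trans _ _ (lebesgue_cV R d (cube 0 rO))).
    by apply: le_measure; rewrite ?inE//; exact: measurable_cube.
  by rewrite lebesgue_cV_cube// ltry.
have mu0 := hu0.1.1.
split.
- exact: (DL_Ker mO fO d2 hopen hconn rO0 OrO heps hJ hg erefl mu0 hstrict).
- have [gamma gamma0 h] := bond_coercive mO fO d2 hcone heps hJ hg erefl mu0 hstrict.
  (* Half the constant makes the inequality strict. *)
  exists (gamma / 2); first exact: divr_gt0.
  move=> x Ox v v0; rewrite sqr_enorm.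
  rewrite (stability_tensor_elastic mO fO eps hJ hg (erefl (derive1n 2 g)) mu0 Ox).
  have v_gt0 : 0 < dot v v by rewrite -sqr_enorm exprn_gt0// enorm_gt0.
  have := h x v Ox; have := mulr_gt0 gamma0 v_gt0; lra.
- exact: (DL_inverse mO fO d2 hopen hconn rO0 OrO hcone heps hJ hg erefl mu0 hstrict).
Qed.
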